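(* Let $\mathfrak{X}$ be an abstract state space, $(\mathcal{U}(t))_{t\ge0}$ a substochastic $C_0$-semigroup on $\mathfrak{X}$ with generator $\mathcal{A}$, $\mathcal{B}:\mathscr{D}(\mathcal{A})\to\mathfrak{X}$ a positive linear operator with $\langle\mathbf{\Psi},(\mathcal{A}+\mathcal{B})u\rangle\le0$ for all $u\in\mathscr{D}(\mathcal{A})\cap\mathfrak{X}_+$, and let $(\mathcal{V}(t))_{t\ge0}$ be the associated minimal semigroup, with generator $\mathcal{G}$. The two functionals $\widehat{\mathfrak{a}}$ and $\overline{\mathfrak{a}}$ on $\mathscr{D}(\mathcal{G})$ coincide, and consequently, for $u\in\mathfrak{X}_+$, the trajectory $(\mathcal{V}(t)u)_{t\ge0}$ is honest if and only if it is mild honest.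
   Context: An abstract state space is a real ordered Banach space $\mathfrak{X}$ whose positive cone $\mathfrak{X}_+$ is closed, generating ($\mathfrak{X}=\mathfrak{X}_+-\mathfrak{X}_+$), and on which the norm is additive: $\|u+v\|=\|u\|+\|v\|$ for $u,v\in\mathfrak{X}_+$. $\mathbf{\Psi}\in\mathfrak{X}^\star_+$ is the positive functional with $\langle\mathbf{\Psi},u\rangle=\|u\|$ for $u\in\mathfrak{X}_+$. A linear operator is positive if it maps positive elements of its domain into $\mathfrak{X}_+$. A $C_0$-semigroup $(T(t))_{t\ge0}$ is substochastic if each $T(t)$ is positive and $\|T(t)u\|\le\|u\|$ for $u\in\mathfrak{X}_+$. Minimal semigroup: under the stated hypotheses there is a smallest (for the operator order, for each $t$) substochastic $C_0$-semigroup $(\mathcal{V}(t))_{t\ge0}$ whose generator $\mathcal{G}$ extends $(\mathcal{A}+\mathcal{B},\mathscr{D}(\mathcal{A}))$; it satisfies $(\lambda-\mathcal{G})^{-1}u=\lim_{n\to\infty}(\lambda-\mathcal{A})^{-1}\sum_{k=0}^n[\mathcal{B}(\lambda-\mathcal{A})^{-1}]^ku$ for all $\lambda>0$, $u\in\mathfrak{X}$, and $\mathcal{V}(t)u=\sum_{n\ge0}\mathcal{V}_n(t)u$. Dyson–Phillips iterates: $\mathcal{V}_0(t)=\mathcal{U}(t)$, and $\mathcal{V}_{n+1}(t)$ is the unique bounded (positive) operator on $\mathfrak{X}$ with $\mathcal{V}_{n+1}(t)u=\int_0^t\mathcal{V}_n(t-s)\mathcal{B}\,\mathcal{U}(s)u\,\mathrm{d}s$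 for $u\in\mathscr{D}(\mathcal{A})$, $t\ge0$, $n\ge0$; one has $\int_0^t\mathcal{V}_n(s)v\,\mathrm{d}s\in\mathscr{D}(\mathcal{A})$ for $v\in\mathfrak{X}$. Functionals: $\mathfrak{a}(u)=-\langle\mathbf{\Psi},\mathcal{A}u+\mathcal{B}u\rangle$ for $u\in\mathscr{D}(\mathcal{A})$. $\overline{\mathfrak{a}}:\mathscr{D}(\mathcal{G})\to\mathbb{R}$ is defined by $\overline{\mathfrak{a}}((\lambda-\mathcal{G})^{-1}u)=\sum_{n=0}^\infty\mathfrak{a}\big((\lambda-\mathcal{A})^{-1}[\mathcal{B}(\lambda-\mathcal{A})^{-1}]^nu\big)$, $u\in\mathfrak{X}$, where the series converges and the resulting functional does not depend on $\lambda>0$. $\widehat{\mathfrak{a}}:\mathscr{D}(\mathcal{G})\to\mathbb{R}$ is defined by $\widehat{\mathfrak{a}}(v)=\lim_{t\to0^+}\frac1t\sum_{n=0}^\infty\mathfrak{a}\big(\int_0^t\mathcal{V}_n(s)v\,\mathrm{d}s\big)$ (the limit exists for every $v\in\mathscr{D}(\mathcal{G})$, and $\widehat{\mathfrak{a}}$ is continuous for the graph norm of $\mathcal{G}$). For $u\in\mathfrak{X}_+$, the trajectory $(\mathcal{V}(t)u)_{t\ge0}$ is honest (resp. mild honest) if $\|\mathcal{V}(t)u\|=\|u\|-\overline{\mathfrak{a}}\big(\int_0^t\mathcal{V}(s)u\,\mathrm{d}s\big)$ (resp. $\|\mathcal{V}(t)u\|=\|u\|-\widehat{\mathfrak{a}}\big(\int_0^t\mathcal{V}(s)u\,\mathrm{d}s\big)$)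 for all $t\ge0$. *)

(* Defs.v *)
(* A real Banach space is a [CompleteNormedModule R_AbsRing]; the integrands
   below are continuous, so Riemann integrals [RInt] suffice. *)
From Stdlib Require Import Reals.
From Coquelicot Require Import Coquelicot.
Open Scope R_scope.

Set Implicit Arguments.

(* The order is encoded by its positive cone: [u <= v] iff [cone (v - u)]. *)
Record AbstractStateSpace := {
  ass_space :> CompleteNormedModule R_AbsRing;
  cone : ass_space -> Prop;
  cone_zero : cone zero;
  cone_plus : forall u v, cone u -> cone v -> cone (plus u v);
  cone_scal : forall (r : R) u, 0 <= r -> cone u -> cone (scal r u);
  cone_pointed : forall u, cone u -> cone (opp u) -> u = zero;
  cone_closed : closed cone;
  cone_generating :
    forall u, exists u1 u2, cone u1 /\ cone u2 /\ u = minus u1 u2;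
  cone_norm_additive :
    forall u v, cone u -> cone v -> norm (plus u v) = norm u + norm v
}.

Arguments cone {_} _.

Definition ord {X : AbstractStateSpace} (u v : X) : Prop := cone (minus v u).

(* [is_linear] includes boundedness; positivity on the cone follows from the
   second clause. The functional is unique because the cone is generating. *)
Definition is_norm_functional {X : AbstractStateSpace} (Psi : X -> R) : Prop :=
  is_linear (V := R_NormedModule) Psi /\ forall u, cone u -> Psi u = norm u.

(* An unbounded operator is a domain with a total function, whose values
   outside of the domain are never used. *)
Record operator (X : CompleteNormedModule R_AbsRing) := Operator {
  dom : X -> Prop;
  op :> X -> X
}.

Arguments Operator {X} _ _.
Arguments dom {X} _ _.
Arguments op {X} _ _.

Record is_C0_semigroup {X : CompleteNormedModule R_AbsRing}
    (T : R -> X -> X) : Prop := {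
  sg_bounded : forall t, 0 <= t -> is_linear (T t);
  sg_zero : forall u, T 0 u = u;
  sg_plus : forall t s u, 0 <= t -> 0 <= s -> T (t + s) u = T t (T s u);
  sg_continuous : forall u, filterlim (fun t => T t u) (at_right 0) (locally u)
}.

Record is_substochastic {X : AbstractStateSpace} (T : R -> X -> X) : Prop := {
  sub_C0 : is_C0_semigroup T;
  sub_positive : forall t u, 0 <= t -> cone u -> cone (T t u);
  sub_contractive : forall t u, 0 <= t -> cone u -> norm (T t u) <= norm u
}.

Definition is_generator_value {X : CompleteNormedModule R_AbsRing}
    (T : R -> X -> X) (u w : X) : Prop :=
  filterlim (fun h => scal (/ h) (minus (T h u) u)) (at_right 0) (locally w).

Definition generator {X : CompleteNormedModule R_AbsRing}
    (T : R -> X -> X) : operator X :=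
  Operator (fun u => exists w, is_generator_value T u w)
           (fun u => iota (is_generator_value T u)).

(* [(lam - A)^{-1} u]; meaningful when [lam - A] is bijective from [dom A]. *)
Definition resolvent {X : CompleteNormedModule R_AbsRing}
    (A : operator X) (lam : R) (u : X) : X :=
  iota (fun w => dom A w /\ minus (scal lam w) (A w) = u).

Record is_positive_linear_on {X : AbstractStateSpace}
    (D : X -> Prop) (B : X -> X) : Prop := {
  pl_plus : forall u v, D u -> D v -> B (plus u v) = plus (B u) (B v);
  pl_scal : forall (r : R) u, D u -> B (scal r u) = scal r (B u);
  pl_positive : forall u, D u -> cone u -> cone (B u)
}.

Definition extends_sum {X : CompleteNormedModule R_AbsRing}
    (G A : operator X) (B : X -> X) : Prop :=
  forall u, dom A u -> dom G u /\ G u = plus (A u) (B u).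

Record is_minimal_semigroup {X : AbstractStateSpace}
    (U : R -> X -> X) (B : X -> X) (V : R -> X -> X) : Prop := {
  min_substochastic : is_substochastic V;
  min_extends : extends_sum (generator V) (generator U) B;
  min_least : forall W : R -> X -> X,
    is_substochastic W -> extends_sum (generator W) (generator U) B ->
    forall t u, 0 <= t -> cone u -> ord (V t u) (W t u)
}.

Record is_dyson_phillips {X : AbstractStateSpace}
    (U : R -> X -> X) (B : X -> X) (Vn : nat -> R -> X -> X) : Prop := {
  dp_zero : forall t u, 0 <= t -> Vn 0%nat t u = U t u;
  dp_bounded : forall n t, 0 <= t -> is_linear (Vn n t);
  dp_succ : forall n t u, 0 <= t -> dom (generator U) u ->
    is_RInt (fun s => Vn n (t - s) (B (U s u))) 0 t (Vn (S n) t u)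
}.

Definition fun_a {X : AbstractStateSpace} (Psi : X -> R)
    (A : operator X) (B : X -> X) (u : X) : R :=
  - Psi (plus (A u) (B u)).

(* The value [l] has to be the same for every [lam > 0]. *)
Definition is_abar {X : AbstractStateSpace} (Psi : X -> R)
    (A : operator X) (B : X -> X) (G : operator X) (v : X) (l : R) : Prop :=
  forall lam u, 0 < lam -> v = resolvent G lam u ->
    is_series
      (fun n => fun_a Psi A B
         (resolvent A lam (Nat.iter n (fun w => B (resolvent A lam w)) u))) l.

Definition abar {X : AbstractStateSpace} (Psi : X -> R)
    (A : operator X) (B : X -> X) (G : operator X) (v : X) : R :=
  iota (T := R_CompleteNormedModule) (is_abar Psi A B G v).

Definition is_ahat {X : AbstractStateSpace} (Psi : X -> R)
    (A : operator X) (B : X -> X) (Vn : nat -> R -> X -> X)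
    (v : X) (l : R) : Prop :=
  filterlim
    (fun t => / t * Series (fun n =>
       fun_a Psi A B (RInt (fun s => Vn n s v) 0 t)))
    (at_right 0) (locally l).

Definition ahat {X : AbstractStateSpace} (Psi : X -> R)
    (A : operator X) (B : X -> X) (Vn : nat -> R -> X -> X) (v : X) : R :=
  iota (T := R_CompleteNormedModule) (is_ahat Psi A B Vn v).

Definition balanced_trajectory {X : AbstractStateSpace}
    (V : R -> X -> X) (b : X -> R) (u : X) : Prop :=
  forall t, 0 <= t ->
    norm (V t u) = norm u - b (RInt (fun s => V s u) 0 t).

Definition honest {X : AbstractStateSpace} (Psi : X -> R)
    (A : operator X) (B : X -> X) (V : R -> X -> X) (u : X) : Prop :=
  balanced_trajectory V (abar Psi A B (generator V)) u.

Definition mild_honest {X : AbstractStateSpace} (Psi : X -> R)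
    (A : operator X) (B : X -> X) (Vn : nat -> R -> X -> X)
    (V : R -> X -> X) (u : X) : Prop :=
  balanced_trajectory V (ahat Psi A B Vn) u.

(* Main.v *)
(* Fix [lam > 0] and put [K = B (lam - A)^{-1}], [y_N = sum_{n<N} (lam - A)^{-1} K^n u],
   [v = lim y_N] and [c(u) = lim Psi(K^n u)], so that [abar v = Psi u - c(u) - lam Psi v].
   The product formula [V_n(t+s) = sum_k V_k(t) V_{n-k}(s)] shows that
   [S_n(t)v = int_0^t V_n(s)v ds] lies in the domain of [A], with
   [A S_n(t)v = V_n(t)v - B S_{n-1}(t)v], and that [W = sum_n V_n] is a substochastic
   semigroup whose generator extends [A + B] and has resolvent [u |-> v]; by minimality the
   resolvent of [V] is the same.
   For positive [u], the number [f(t) = sum_n a(S_n(t)v)] is squeezed: positivity gives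
   [f(t) >= a(S_0(t) y_N)], and since [c o K = c <= Psi], evaluating the telescoping
   identities with [c] instead of [Psi] gives
   [f(t) <= (Psi - c)(v - W(t)v) - lam c(S_0(t)v)].  Divided by [t], both bounds tend to
   [abar v] (after [N -> oo] in the first one).  Hence [ahat v] exists and equals the value
   of the series defining [abar v], which therefore does not depend on [lam]. *)
Require Import Defs.
From Stdlib Require Import Reals Lra Lia List Classical ClassicalEpsilon.
From Coquelicot Require Import Coquelicot.
Open Scope R_scope.

Set Implicit Arguments.

(** * A decision procedure for linear identities in real modules *)

(** The iterates are given only as bounded operators with an integral identity on the domain of [A]:
    continuity in time, the product law and both series for the minimal semigroup have to be
    derived. Two features of the space take the place of dominated convergence. Additivity of the
    norm makes the norm of a positive increment a difference of masses, so increasing sequences of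
    bounded mass converge. A closed generating cone admits decompositions u = p - q of total mass at
    most [M] times the norm of u, so estimates on the cone hold everywhere up to the factor [M]. The
    delicate point is the upper bound for f(t). Its partial sums contain a remainder -Psi(B
    S_N(t)v), which need not vanish as N grows when mass is lost; discarding it gives a bound whose
    quotient by t tends to a value too large by c(u). The functional c is a lower bound for Psi on
    the cone that can be computed on this remainder. The lower bound goes through y_N because v
    itself need not lie in the domain of [A], where a is defined. *)

Inductive lin_expr :=
| LVar (n : nat) | LZero | LPlus (a b : lin_expr) | LMinus (a b : lin_expr)
| LOpp (a : lin_expr) | LScal (r : R) (a : lin_expr).

Section LinExpr.
Context {V : ModuleSpace R_Ring}.

Fixpoint lin_eval (env : list V) (e : lin_expr) : V :=
  match e with
  | LVar n => nth n env zero
  | LZero => zero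
  | LPlus a b => plus (lin_eval env a) (lin_eval env b)
  | LMinus a b => minus (lin_eval env a) (lin_eval env b)
  | LOpp a => opp (lin_eval env a)
  | LScal r a => scal r (lin_eval env a)
  end.

Fixpoint lin_coef (e : lin_expr) (k : nat) : R :=
  match e with
  | LVar n => if Nat.eqb n k then 1 else 0
  | LZero => 0
  | LPlus a b => lin_coef a k + lin_coef b k
  | LMinus a b => lin_coef a k - lin_coef b k
  | LOpp a => - lin_coef a k
  | LScal r a => r * lin_coef a k
  end.

Fixpoint lin_comb (env : list V) (f : nat -> R) : V :=
  match env with
  | nil => zero
  | v :: l => plus (scal (f 0%nat) v) (lin_comb l (fun n => f (S n)))
  end.

Lemma lin_comb_ext (env : list V) (f g : nat -> R) :
  (forall k, f k = g k) -> lin_comb env f = lin_comb env g.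
Proof.
  revert f g; induction env as [|v l IH]; intros f g H; simpl; auto.
  rewrite H, (IH (fun n => f (S n)) (fun n => g (S n))); auto.
Qed.

Lemma lin_comb_zero (env : list V) : lin_comb env (fun _ => 0) = zero.
Proof.
  induction env as [|v l IH]; simpl; auto.
  rewrite IH, plus_zero_r. exact (scal_zero_l (K := R_Ring) v).
Qed.

Lemma lin_comb_plus (env : list V) (f g : nat -> R) :
  lin_comb env (fun k => f k + g k) = plus (lin_comb env f) (lin_comb env g).
Proof.
  revert f g; induction env as [|v l IH]; intros f g; simpl.
  - symmetry; apply plus_zero_r.
  - rewrite (IH (fun n => f (S n)) (fun n => g (S n))).
    assert (E : scal (f 0%nat + g 0%nat) v = plus (scal (f 0%nat) v) (scal (g 0%nat) v))
      by exact (scal_distr_r (K := R_Ring) _ _ v).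
    rewrite E.
    rewrite <- !plus_assoc. f_equal.
    rewrite !plus_assoc. f_equal. apply plus_comm.
Qed.

Lemma lin_comb_scal (env : list V) (r : R) (f : nat -> R) :
  lin_comb env (fun k => r * f k) = scal r (lin_comb env f).
Proof.
  revert f; induction env as [|v l IH]; intros f; simpl.
  - symmetry. exact (scal_zero_r (K := R_Ring) r).
  - rewrite (IH (fun n => f (S n))), scal_distr_l. f_equal.
    symmetry. exact (scal_assoc (K := R_Ring) r (f 0%nat) v).
Qed.

Lemma lin_comb_opp (env : list V) (f : nat -> R) :
  lin_comb env (fun k => - f k) = opp (lin_comb env f).
Proof.
  rewrite (@lin_comb_ext env (fun k => - f k) (fun k => (-1) * f k)).
  - rewrite lin_comb_scal. exact (scal_opp_one (K := R_Ring) _).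
  - intros k; ring.
Qed.

Lemma lin_comb_nth (env : list V) (n : nat) :
  lin_comb env (fun k => if Nat.eqb n k then 1 else 0) = nth n env zero.
Proof.
  revert n; induction env as [|v l IH]; intros [|n]; simpl; auto.
  - rewrite lin_comb_zero, plus_zero_r. exact (scal_one (K := R_Ring) v).
  - rewrite IH.
    assert (E : scal 0 v = zero) by exact (scal_zero_l (K := R_Ring) v).
    rewrite E. apply plus_zero_l.
Qed.

Lemma lin_eval_comb (env : list V) (e : lin_expr) :
  lin_eval env e = lin_comb env (lin_coef e).
Proof.
  induction e; simpl.
  - symmetry; apply lin_comb_nth.
  - symmetry; apply lin_comb_zero.
  - rewrite IHe1, IHe2; symmetry; apply lin_comb_plus.
  - rewrite IHe1, IHe2. unfold minus. rewrite <- lin_comb_opp, <- lin_comb_plus.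
    apply lin_comb_ext; intros; ring.
  - rewrite IHe; symmetry; apply lin_comb_opp.
  - rewrite IHe; symmetry; apply lin_comb_scal.
Qed.

Fixpoint coefs_agree (n : nat) (f g : nat -> R) : Prop :=
  match n with
  | O => True
  | S n => f 0%nat = g 0%nat /\ coefs_agree n (fun k => f (S k)) (fun k => g (S k))
  end.

(** Both sides normalise to the combination of the atoms with coefficients [lin_coef]. A vector
    identity thus splits into one scalar identity per atom, which [module] hands to [ring] or to a
    given tactic; the criterion is only sufficient, since atoms count as independent. *)
Lemma lin_eval_eq (env : list V) (a b : lin_expr) :
  coefs_agree (length env) (lin_coef a) (lin_coef b) ->
  lin_eval env a = lin_eval env b.
Proof.
  rewrite !lin_eval_comb. generalize (lin_coef a) (lin_coef b).
  induction env as [|v l IH]; intros f g; simpl; auto.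
  intros [H1 H2]. rewrite H1. f_equal. now apply IH.
Qed.
End LinExpr.

(* Coquelicot infers [plus], [minus], [scal] and [locally] along several
   canonical-structure paths, which are convertible but not syntactically equal;
   the following constants fix one path, so that rewriting is predictable. *)
Definition vadd {V : NormedModule R_AbsRing} (x y : V) : V := plus x y.
Definition vsub {V : NormedModule R_AbsRing} (x y : V) : V := minus x y.
Definition vscal {V : NormedModule R_AbsRing} (r : R) (x : V) : V := scal r x.
Definition vzero {V : NormedModule R_AbsRing} : V := zero.
Definition tends {V : NormedModule R_AbsRing} {T : Type} (f : T -> V)
    (F : (T -> Prop) -> Prop) (l : V) : Prop :=
  filterlim f F (locally l).

Notation "x ⊕ y" := (vadd x y) (at level 50, left associativity).
Notation "x ⊖ y" := (vsub x y) (at level 50, left associativity).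
Notation "r ⊙ x" := (vscal r x) (at level 40, left associativity).

Ltac lin_index x l :=
  match l with
  | ?y :: ?l' => let _ := match goal with _ => constr_eq x y end in constr:(0%nat)
  | _ :: ?l' => let n := lin_index x l' in constr:(S n)
  end.

Ltac lin_atoms l e :=
  match e with
  | @plus _ ?a ?b => let l := lin_atoms l a in lin_atoms l b
  | @minus _ ?a ?b => let l := lin_atoms l a in lin_atoms l b
  | @opp _ ?a => lin_atoms l a
  | @scal _ _ _ ?a => lin_atoms l a
  | @vadd _ ?a ?b => let l := lin_atoms l a in lin_atoms l b
  | @vsub _ ?a ?b => let l := lin_atoms l a in lin_atoms l b
  | @vscal _ _ ?a => lin_atoms l a
  | @vzero _ => l
  | @zero _ => l
  | _ => let _ := match goal with _ => let n := lin_index e l in idtac end in l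
  | _ => constr:(e :: l)
  end.

Ltac lin_reify l e :=
  match e with
  | @plus _ ?a ?b =>
      let a := lin_reify l a in let b := lin_reify l b in constr:(LPlus a b)
  | @minus _ ?a ?b =>
      let a := lin_reify l a in let b := lin_reify l b in constr:(LMinus a b)
  | @opp _ ?a => let a := lin_reify l a in constr:(LOpp a)
  | @scal _ _ ?r ?a => let a := lin_reify l a in constr:(LScal r a)
  | @vadd _ ?a ?b =>
      let a := lin_reify l a in let b := lin_reify l b in constr:(LPlus a b)
  | @vsub _ ?a ?b =>
      let a := lin_reify l a in let b := lin_reify l b in constr:(LMinus a b)
  | @vscal _ ?r ?a => let a := lin_reify l a in constr:(LScal r a)
  | @vzero _ => constr:(LZero)
  | @zero _ => constr:(LZero)
  | _ => let n := lin_index e l in constr:(LVar n)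
  end.

Ltac module_with tac :=
  lazymatch goal with
  | |- @eq ?T ?a ?b =>
      let l := lin_atoms (@nil T) a in
      let l := lin_atoms l b in
      let ra := lin_reify l a in
      let rb := lin_reify l b in
      refine (@lin_eval_eq _ l ra rb _);
      cbn [lin_coef coefs_agree length Nat.eqb];
      repeat split; tac
  end.

Tactic Notation "module" := module_with ltac:(ring).
Tactic Notation "module" "by" tactic(t) := module_with ltac:(t).

(** * Limits, continuity on the half-line and right derivatives *)

Lemma at_right_0_iff (P : R -> Prop) :
  at_right 0 P <-> exists d, 0 < d /\ forall h, 0 < h < d -> P h.
Proof.
  split.
  - intros [d Hd]. exists d. split; [apply cond_pos|].
    intros h Hh. apply Hd; [|lra].
    change (Rabs (h - 0) < d). rewrite Rabs_pos_eq; lra.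
  - intros (d & Hd & H). exists (mkposreal d Hd). intros h Hh Hp.
    apply H. change (Rabs (h - 0) < d) in Hh. apply Rabs_def2 in Hh. lra.
Qed.

Section Limits.
Context {V : NormedModule R_AbsRing}.

Lemma norm_vzero : norm (vzero : V) = 0.
Proof. exact (norm_zero (V := V)). Qed.

Lemma norm_vadd (x y : V) : norm (x ⊕ y) <= norm x + norm y.
Proof. exact (norm_triangle x y). Qed.

Lemma norm_vscal r (x : V) : norm (r ⊙ x) <= Rabs r * norm x.
Proof. exact (norm_scal r x). Qed.

Lemma norm_vsub_diag (x : V) : norm (x ⊖ x) = 0.
Proof. replace (x ⊖ x) with (vzero : V) by module. apply norm_vzero. Qed.

Lemma norm_vsub_sym (x y : V) : norm (x ⊖ y) = norm (y ⊖ x).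
Proof.
  rewrite <- (norm_opp (x ⊖ y)). f_equal. module.
Qed.

Lemma norm_vsub_triangle (y x z : V) : norm (x ⊖ z) <= norm (x ⊖ y) + norm (y ⊖ z).
Proof.
  replace (x ⊖ z) with ((x ⊖ y) ⊕ (y ⊖ z)) by module. apply norm_vadd.
Qed.

Lemma norm_vsub (x y : V) : norm (x ⊖ y) <= norm x + norm y.
Proof.
  replace x with (x ⊖ vzero) at 2 by module.
  replace (norm y) with (norm (vzero ⊖ y)); [apply norm_vsub_triangle|].
  rewrite norm_vsub_sym. f_equal. module.
Qed.

Lemma norm_vsub_eq (x y : V) : norm (x ⊖ y) <= 0 -> x = y.
Proof.
  intros H. assert (H0 := norm_ge_0 (x ⊖ y)).
  assert (E : x ⊖ y = vzero) by (apply (norm_eq_zero (x ⊖ y)); lra).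
  replace x with ((x ⊖ y) ⊕ y) by module. rewrite E. module.
Qed.

Section Filter.
Context {T : Type} {F : (T -> Prop) -> Prop} {FF : Filter F}.

Lemma tends_norm_iff (f : T -> V) (l : V) :
  tends f F l <-> forall eps, 0 < eps -> F (fun p => norm (f p ⊖ l) < eps).
Proof.
  unfold tends. rewrite filterlim_locally_ball_norm. split.
  - intros H eps He. exact (H (mkposreal eps He)).
  - intros H eps. exact (H eps (cond_pos eps)).
Qed.

Lemma tends_dominated (f : T -> V) (g : T -> R) (l : V) :
  F (fun p => norm (f p ⊖ l) <= g p) -> tends g F 0 -> tends f F l.
Proof.
  intros H Hg. apply tends_norm_iff. intros eps He.
  generalize (proj1 (@filterlim_locally _ _ F FF g 0) Hg (mkposreal eps He)).
  intros Hb; generalize (filter_and _ _ H Hb).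
  apply filter_imp. intros p [H1 H2].
  change (Rabs (g p - 0) < eps) in H2. apply Rabs_def2 in H2. lra.
Qed.

Lemma tends_const (c : V) : tends (fun _ => c) F c.
Proof. apply filterlim_const. Qed.

Lemma tends_ext (f g : T -> V) l : (forall p, f p = g p) -> tends f F l -> tends g F l.
Proof. apply filterlim_ext. Qed.

Lemma tends_ext_loc (f g : T -> V) l :
  F (fun p => f p = g p) -> tends f F l -> tends g F l.
Proof. apply filterlim_ext_loc. Qed.

Lemma tends_vadd (f g : T -> V) a b :
  tends f F a -> tends g F b -> tends (fun p => f p ⊕ g p) F (a ⊕ b).
Proof.
  intros Hf Hg. eapply filterlim_comp_2; [exact Hf|exact Hg|].
  apply (filterlim_plus a b).
Qed.

Lemma tends_vscal (k : T -> R) (f : T -> V) (c : R) a :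
  tends k F c -> tends f F a -> tends (fun p => k p ⊙ f p) F (c ⊙ a).
Proof.
  intros Hf Hg.
  eapply (filterlim_comp_2 (G := locally c) (H := locally a) k f
            (fun (r : R) (u : V) => r ⊙ u)); [exact Hf|exact Hg|].
  apply (filterlim_scal (K := R_AbsRing) c a).
Qed.

Lemma tends_vscal_r (c : R) (f : T -> V) a :
  tends f F a -> tends (fun p => c ⊙ f p) F (c ⊙ a).
Proof. intros Hf. apply tends_vscal; [apply filterlim_const|exact Hf]. Qed.

Lemma tends_vsub (f g : T -> V) a b :
  tends f F a -> tends g F b -> tends (fun p => f p ⊖ g p) F (a ⊖ b).
Proof.
  intros Hf Hg. apply (tends_vadd Hf (g := fun p => opp (g p)) (b := opp b)).
  eapply filterlim_comp; [exact Hg|apply (filterlim_opp b)].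
Qed.

Lemma tends_linear {W : NormedModule R_AbsRing} (L : V -> W) (f : T -> V) a :
  is_linear L -> tends f F a -> tends (fun p => L (f p)) F (L a).
Proof.
  intros HL Hf. eapply filterlim_comp; [exact Hf|].
  exact (linear_cont L a HL).
Qed.
End Filter.

Lemma tends_unique {T} {F : (T -> Prop) -> Prop} {FF : ProperFilter F}
    (f : T -> V) a b : tends f F a -> tends f F b -> a = b.
Proof. apply filterlim_locally_unique. Qed.

Section Linear.
Context {W : NormedModule R_AbsRing} (L : V -> W) (HL : is_linear L).

Lemma linear_vadd x y : L (x ⊕ y) = L x ⊕ L y.
Proof. exact (linear_plus L HL x y). Qed.

Lemma linear_vsub x y : L (x ⊖ y) = L x ⊖ L y.
Proof. exact (linear_minus L x y HL). Qed.

Lemma linear_vscal r x : L (r ⊙ x) = r ⊙ L x.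
Proof. exact (linear_scal L HL r x). Qed.

Lemma linear_vzero : L vzero = vzero.
Proof. exact (linear_zero L HL). Qed.
End Linear.

End Limits.

Section HalfLine.
Context {V : NormedModule R_AbsRing}.

(** Continuity on [0, oo). Semigroups are unconstrained at negative times; reflection by [Rabs]
    turns the half-line condition into ordinary continuity on the line, the form that the
    integration lemmas expect. *)
Definition hcont {W : NormedModule R_AbsRing} (f : R -> W) : Prop :=
  forall t, continuous (fun s => f (Rabs s)) t.

Lemma hcont_vadd (f g : R -> V) :
  hcont f -> hcont g -> hcont (fun t => f t ⊕ g t).
Proof. intros Hf Hg t. apply (continuous_plus _ _ _ (Hf t) (Hg t)). Qed.

Lemma hcont_const {W : NormedModule R_AbsRing} (c : W) : hcont (fun _ => c).
Proof. intros t. apply continuous_const. Qed.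

Lemma hcont_vscal (k : R -> R) (f : R -> V) :
  hcont k -> hcont f -> hcont (fun t => k t ⊙ f t).
Proof.
  intros Hf Hg t. apply (continuous_scal (K := R_AbsRing) _ _ _ (Hf t) (Hg t)).
Qed.

Lemma hcont_vsub (f g : R -> V) :
  hcont f -> hcont g -> hcont (fun t => f t ⊖ g t).
Proof. intros Hf Hg t. apply (continuous_minus _ _ _ (Hf t) (Hg t)). Qed.

Lemma hcont_linear {W : NormedModule R_AbsRing} (L : V -> W) (f : R -> V) :
  is_linear L -> hcont f -> hcont (fun t => L (f t)).
Proof.
  intros HL Hf t. apply (continuous_comp (fun s => f (Rabs s)) L); auto.
  apply linear_cont, HL.
Qed.

Lemma hcont_of_continuous {W : NormedModule R_AbsRing} (f : R -> W) :
  (forall t, continuous f t) -> hcont f.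
Proof.
  intros Hf t. apply (continuous_comp Rabs f); auto. apply continuous_Rabs.
Qed.

(** A right modulus uniform in the base point also controls the left side: of two times, the smaller
    serves as base point. For orbits the semigroup law supplies such a modulus, the operators being
    uniformly bounded. *)
Lemma hcont_modulus (f : R -> V) :
  (forall eps, 0 < eps -> exists d, 0 < d /\
    forall s h, 0 <= s -> 0 < h < d -> norm (f (s + h) ⊖ f s) < eps) ->
  hcont f.
Proof.
  intros H t. apply tends_norm_iff. intros eps He.
  destruct (H eps He) as (d & Hd & Hm).
  exists (mkposreal d Hd). intros s Hs. change (Rabs (s - t) < d) in Hs.
  assert (Hst : Rabs (Rabs s - Rabs t) < d)
    by (eapply Rle_lt_trans; [apply Rabs_triang_inv2|exact Hs]).
  apply Rabs_def2 in Hst.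
  generalize (Rabs_pos s) (Rabs_pos t); intros Ps Pt.
  destruct (Rtotal_order (Rabs s) (Rabs t)) as [L|[E|G]].
  - assert (K := Hm (Rabs s) (Rabs t - Rabs s) Ps ltac:(lra)).
    replace (Rabs s + (Rabs t - Rabs s)) with (Rabs t) in K by ring.
    rewrite norm_vsub_sym. exact K.
  - rewrite E, norm_vsub_diag. exact He.
  - assert (K := Hm (Rabs t) (Rabs s - Rabs t) Pt ltac:(lra)).
    replace (Rabs t + (Rabs s - Rabs t)) with (Rabs s) in K by ring. exact K.
Qed.

Lemma hcont_right {W : NormedModule R_AbsRing} (f : R -> W) t :
  0 <= t -> hcont f ->
  tends (fun h => f (t + h)) (at_right 0) (f t).
Proof.
  intros Ht Hf P HP.
  assert (HP' : locally (f (Rabs t)) P) by (rewrite Rabs_pos_eq; auto).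
  destruct (Hf t P HP') as [d Hd]. apply at_right_0_iff.
  exists d. split; [apply cond_pos|]. intros h Hh.
  assert (K := Hd (t + h)). simpl in K. rewrite Rabs_pos_eq in K by lra.
  apply K. change (Rabs (t + h - t) < d). rewrite Rabs_pos_eq; lra.
Qed.

(** One-sided because generators are defined by right limits; the mean value inequality below asks
    for no more. *)
Definition rderiv (f : R -> V) (t : R) (l : V) : Prop :=
  filterlim (fun h => (/ h) ⊙ (f (t + h) ⊖ f t)) (at_right 0) (locally l).

(** Mean value inequality for right derivatives. Take the supremum of the times at which the bound
    with slope [e + eta] holds: continuity keeps the bound there, and if the supremum were below [b]
    the right derivative would push the bound further. *)
Lemma rderiv_bound_mean (f : R -> V) (b e : R) :
  0 <= b -> 0 <= e -> hcont f ->
  (forall s, 0 <= s < b -> exists l, rderiv f s l /\ norm l <= e) ->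
  norm (f b ⊖ f 0) <= e * b.
Proof.
  intros Hb He Hf Hd.
  apply le_epsilon. intros eta0 Heta0.
  (* Dividing by [b + 1] instead of [b] allows [b = 0]; the total excess [eta * b] is at most
     [eta0]. *)
  set (eta := eta0 / (b + 1)).
  assert (Heta : 0 < eta) by (apply Rdiv_lt_0_compat; lra).
  apply Rle_trans with ((e + eta) * b).
  2:{ assert (eta * b <= eta0); [|lra]. unfold eta.
      apply Rmult_le_reg_r with (b + 1); [lra|].
      replace (eta0 / (b + 1) * b * (b + 1)) with (eta0 * b) by (field; lra). nra. }
  set (E := fun s => 0 <= s <= b /\ norm (f s ⊖ f 0) <= (e + eta) * s).
  assert (E0 : E 0).
  { split; [lra|]. rewrite norm_vsub_diag. lra. }
  destruct (completeness E) as [m [Hub Hlub]].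
  { exists b. intros s [Hs _]. lra. }
  { now exists 0. }
  assert (Hm0 : 0 <= m) by (apply Hub, E0).
  assert (Hmb : m <= b) by (apply Hlub; intros s [Hs _]; lra).
  assert (Em : E m).
  { split; [lra|]. apply Rnot_lt_le. intros Hlt.
    set (gap := norm (f m ⊖ f 0) - (e + eta) * m).
    assert (Hgap : 0 < gap) by (unfold gap; lra).
    assert (C := proj1 (tends_norm_iff (fun s => f (Rabs s)) (f (Rabs m))) (Hf m) gap Hgap).
    destruct C as [d Hd'].
    assert (Hlt' : ~ is_upper_bound E (m - d)).
    { intros H. assert (K := Hlub _ H). generalize (cond_pos d); lra. }
    apply not_all_ex_not in Hlt'. destruct Hlt' as [s Hs].
    apply imply_to_and in Hs. destruct Hs as [Es Hs].
    assert (Hsm : s <= m) by (apply Hub, Es). destruct Es as [Hs0 Es].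
    assert (K : norm (f s ⊖ f m) < gap).
    { assert (K := Hd' s). simpl in K. rewrite !Rabs_pos_eq in K by lra.
      apply K. change (Rabs (s - m) < d). rewrite Rabs_left1; lra. }
    assert (T := norm_vsub_triangle (f s) (f m) (f 0)).
    rewrite norm_vsub_sym in K. unfold gap in K.
    assert ((e + eta) * s <= (e + eta) * m) by (apply Rmult_le_compat_l; lra).
    lra. }
  destruct (Req_dec m b) as [<-|Hne]; [apply Em|exfalso].
  destruct (Hd m ltac:(lra)) as (l & Hl & Hle).
  assert (C := proj1 (tends_norm_iff _ _) Hl eta Heta).
  apply at_right_0_iff in C. destruct C as (d & Hd0 & Hd1).
  set (h := Rmin (d / 2) (b - m)).
  assert (Hh : 0 < h) by (apply Rmin_glb_lt; lra).
  assert (Hhd : h < d) by (eapply Rle_lt_trans; [apply Rmin_l|lra]).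
  assert (Hhb : h <= b - m) by apply Rmin_r.
  assert (K := Hd1 h ltac:(lra)).
  assert (Hq : norm (/ h ⊙ (f (m + h) ⊖ f m)) <= e + eta).
  { replace (/ h ⊙ (f (m + h) ⊖ f m)) with
      (((/ h ⊙ (f (m + h) ⊖ f m)) ⊖ l) ⊕ l) by module.
    eapply Rle_trans; [apply norm_vadd|]. lra. }
  assert (Hq2 : norm (f (m + h) ⊖ f m) <= (e + eta) * h).
  { replace (f (m + h) ⊖ f m) with
      (h ⊙ (/ h ⊙ (f (m + h) ⊖ f m))) by (module by field; lra).
    eapply Rle_trans; [apply norm_vscal|]. rewrite Rabs_pos_eq by lra.
    rewrite Rmult_comm. apply Rmult_le_compat_r; lra. }
  assert (Emh : E (m + h)).
  { split; [lra|].
    eapply Rle_trans; [apply (norm_vsub_triangle (f m))|]. destruct Em as [_ Em]. lra. }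
  assert (K' := Hub _ Emh). lra.
Qed.

Lemma rderiv_zero_const (f : R -> V) (b : R) :
  0 <= b -> hcont f -> (forall s, 0 <= s < b -> rderiv f s vzero) -> f b = f 0.
Proof.
  intros Hb Hf Hd.
  assert (K : norm (f b ⊖ f 0) <= 0 * b).
  { apply rderiv_bound_mean; auto; try lra. intros s Hs. exists vzero.
    rewrite norm_vzero. split; auto. lra. }
  apply norm_vsub_eq. lra.
Qed.

Lemma rderiv_vadd (f g : R -> V) t a b :
  rderiv f t a -> rderiv g t b -> rderiv (fun s => f s ⊕ g s) t (a ⊕ b).
Proof.
  intros Hf Hg. unfold rderiv.
  eapply tends_ext; [|apply (tends_vadd Hf Hg)].
  intros h. simpl. module.
Qed.

Lemma rderiv_vsub (f g : R -> V) t a b :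
  rderiv f t a -> rderiv g t b -> rderiv (fun s => f s ⊖ g s) t (a ⊖ b).
Proof.
  intros Hf Hg. unfold rderiv.
  eapply tends_ext; [|apply (tends_vsub Hf Hg)].
  intros h. simpl. module.
Qed.

Lemma rderiv_vscal (k : R -> R) (f : R -> V) t (k' : R) (a : V) :
  tends (fun h => / h * (k (t + h) - k t)) (at_right 0) k' ->
  tends (fun h => k (t + h)) (at_right 0) (k t) ->
  rderiv f t a ->
  rderiv (fun s => k s ⊙ f s) t ((k' ⊙ f t) ⊕ (k t ⊙ a)).
Proof.
  intros Hk Hk0 Hf. unfold rderiv.
  eapply tends_ext;
    [|apply (tends_vadd (tends_vscal Hk (tends_const (c := f t))) (tends_vscal Hk0 Hf))].
  intros h. simpl. module.
Qed.

Lemma RInt_average (f : R -> V) (a h e : R) (l y : V) :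
  0 < h -> is_RInt f a (a + h) l ->
  (forall s, a <= s <= a + h -> norm (f s ⊖ y) <= e) ->
  norm ((/ h ⊙ l) ⊖ y) <= e.
Proof.
  intros Hh Hl Hf.
  assert (K : norm (l ⊖ (h ⊙ y)) <= h * e).
  { replace h with (a + h - a) at 1 2 by ring.
    eapply norm_RInt_le_const; [lra|exact Hf|].
    apply (is_RInt_minus f (fun _ => y)); auto. apply is_RInt_const. }
  replace ((/ h ⊙ l) ⊖ y) with (/ h ⊙ (l ⊖ (h ⊙ y)))
    by (module by field; lra).
  eapply Rle_trans; [apply norm_vscal|].
  assert (0 < / h) by now apply Rinv_0_lt_compat.
  rewrite Rabs_pos_eq by lra.
  replace e with (/ h * (h * e)) by (field; lra). apply Rmult_le_compat_l; lra.
Qed.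

Lemma is_RInt_linear {W : NormedModule R_AbsRing} (L : V -> W) (f : R -> V) a b l :
  is_linear L -> is_RInt f a b l -> is_RInt (fun s => L (f s)) a b (L l).
Proof.
  intros HL Hf. unfold is_RInt.
  eapply tends_ext; [|apply (tends_linear HL Hf)].
  intros p. simpl. rewrite (linear_scal L HL). f_equal.
  apply SF_cons_ind with (s := p).
  - intros x0. apply (linear_zero L HL).
  - intros [x y] s IH. rewrite !Riemann_sum_cons, (linear_plus L HL), IH.
    f_equal. apply (linear_scal L HL).
Qed.

Lemma is_RInt_shift (f : R -> V) a b c l :
  is_RInt f (a + c) (b + c) l -> is_RInt (fun s => f (s + c)) a b l.
Proof.
  intros H.
  assert (K := is_RInt_comp_lin f 1 c a b l). rewrite !Rmult_1_l in K.
  apply (is_RInt_ext (fun y => 1 ⊙ f (1 * y + c))); auto.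
  intros x _. rewrite Rmult_1_l. apply (scal_one (K := R_AbsRing)).
Qed.

End HalfLine.

(** Riemann sums of a [C]-valued function have nonnegative weights, so they stay in [C], and
    closedness passes this to the limit. *)
Lemma is_RInt_closed_cone {V : NormedModule R_AbsRing} (C : V -> Prop)
    (f : R -> V) a b l :
  C zero -> (forall u v, C u -> C v -> C (u ⊕ v)) ->
  (forall r u, 0 <= r -> C u -> C (r ⊙ u)) -> closed C ->
  a <= b -> (forall s, a < s < b -> C (f s)) -> is_RInt f a b l -> C l.
Proof.
  intros C0 Cp Cs Cc Hab Hf Hl.
  (* Tags may fall on the end points, where nothing is known about [f]; replacing [f] by [zero] off
     the open interval leaves the integral intact. *)
  set (g := fun s => match excluded_middle_informative (a < s < b) with
                     | left _ => f s | right _ => zero end).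
  assert (Hg : is_RInt g a b l).
  { apply (is_RInt_ext f); auto. rewrite Rmin_left, Rmax_right by lra.
    intros x Hx. unfold g. now destruct excluded_middle_informative. }
  assert (Cg : forall s, C (g s)).
  { intros s. unfold g. destruct excluded_middle_informative; auto. }
  eapply (@closed_filterlim_loc _ _ (Riemann_fine a b)); [|exact Hg| |exact Cc].
  - apply Proper_StrongProper, Riemann_fine_filter.
  - exists (mkposreal 1 Rlt_0_1). intros p _ [Hp _].
    apply Cs.
    + destruct Hab as [H|H].
      * rewrite sign_eq_1; lra.
      * replace (b - a) with 0 by lra. rewrite sign_0; lra.
    + revert Hp. apply SF_cons_ind with (s := p).
      * intros x0 _. exact C0.
      * intros [x y] s IH Hp. rewrite Riemann_sum_cons. apply Cp.
        -- apply Cs; [|apply Cg].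
           assert (K := Hp 0%nat ltac:(rewrite SF_size_cons; lia)). simpl in K. simpl. lra.
        -- apply IH. eapply ptd_cons, Hp.
Qed.

(** * Riemann integrals of functions continuous on the half-line *)

Section Integrals.
Context {V : CompleteNormedModule R_AbsRing}.

Lemma hcont_ex_RInt (f : R -> V) a b : 0 <= a <= b -> hcont f -> ex_RInt f a b.
Proof.
  intros Hab Hf. apply (ex_RInt_ext (fun s => f (Rabs s))).
  - rewrite Rmin_left, Rmax_right by lra. intros x Hx. rewrite Rabs_pos_eq; auto; lra.
  - apply ex_RInt_continuous. intros z _. apply Hf.
Qed.

Lemma hcont_is_RInt (f : R -> V) a b :
  0 <= a <= b -> hcont f -> is_RInt f a b (RInt f a b).
Proof. intros Hab Hf. apply RInt_correct, hcont_ex_RInt; auto. Qed.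

Lemma hcont_RInt_Chasles (f : R -> V) a b c :
  0 <= a <= b -> b <= c -> hcont f ->
  RInt f a b ⊕ RInt f b c = RInt f a c.
Proof. intros Ha Hb Hf. apply RInt_Chasles; apply hcont_ex_RInt; auto; lra. Qed.

Lemma rderiv_RInt (f : R -> V) t :
  0 <= t -> hcont f -> rderiv (fun s => RInt f 0 s) t (f t).
Proof.
  intros Ht Hf. apply tends_norm_iff. intros eps He.
  assert (K := proj1 (tends_norm_iff _ _) (hcont_right Ht Hf) (eps / 2) ltac:(lra)).
  apply at_right_0_iff in K. destruct K as (d & Hd & K). apply at_right_0_iff.
  exists d. split; auto. intros h Hh.
  rewrite <- (@hcont_RInt_Chasles f 0 t (t + h)) by (auto; lra).
  replace ((RInt f 0 t ⊕ RInt f t (t + h)) ⊖ RInt f 0 t)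
    with (RInt f t (t + h)) by module.
  apply Rle_lt_trans with (eps / 2); [|lra].
  eapply RInt_average; [lra| apply hcont_is_RInt; auto; lra|].
  intros s Hs. destruct (Req_dec s t) as [->|Hne].
  - rewrite norm_vsub_diag. lra.
  - left. replace s with (t + (s - t)) by ring. apply K. lra.
Qed.

Lemma hcont_RInt (f : R -> V) : hcont f -> hcont (fun s => RInt f 0 s).
Proof.
  intros Hf t.
  apply (continuous_ext (fun s => RInt (fun r => f (Rabs r)) 0 (Rabs s))).
  { intros s. apply RInt_ext. rewrite Rmin_left, Rmax_right by apply Rabs_pos.
    intros x Hx. rewrite Rabs_pos_eq; auto; lra. }
  apply (continuous_comp Rabs (fun s => RInt (fun r => f (Rabs r)) 0 s)).
  - apply continuous_Rabs.
  - apply (continuous_RInt_1 (fun r => f (Rabs r)) 0).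
    apply filter_forall. intros z. apply RInt_correct, ex_RInt_continuous.
    intros; apply Hf.
Qed.

(** The difference of [f] and the integral of [g] has zero right derivative, hence is constant: the
    fundamental theorem of calculus with right derivatives only. *)
Lemma rderiv_is_RInt (f g : R -> V) b :
  0 <= b -> hcont f -> hcont g -> (forall s, 0 <= s < b -> rderiv f s (g s)) ->
  RInt g 0 b = f b ⊖ f 0.
Proof.
  intros Hb Hf Hg Hd.
  assert (K : (f b) ⊖ RInt g 0 b = f 0 ⊖ RInt g 0 0).
  { apply (rderiv_zero_const (f := fun s => f s ⊖ RInt g 0 s)); auto.
    - apply hcont_vsub; auto. now apply hcont_RInt.
    - intros s Hs. replace vzero with (g s ⊖ g s) by module.
      apply rderiv_vsub; auto. apply rderiv_RInt; auto; lra. }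
  rewrite RInt_point in K.
  replace (RInt g 0 b) with (f b ⊖ (f b ⊖ RInt g 0 b)) by module.
  rewrite K. module.
Qed.

End Integrals.

(** * Ordered spaces with additive norm *)

(** [P] is the invariant kept along the sequence and [Q] the link between consecutive terms. The
    construction drives both the nested balls and the successive approximation of the open mapping
    argument. *)
Lemma dependent_choice (A : Type) (P : nat -> A -> Prop) (Q : nat -> A -> A -> Prop) a0 :
  P 0%nat a0 -> (forall n a, P n a -> exists b, P (S n) b /\ Q n a b) ->
  exists s : nat -> A,
    s 0%nat = a0 /\ (forall n, P n (s n)) /\ forall n, Q n (s n) (s (S n)).
Proof.
  intros H0 H.
  pose (next := fun n (a : {a | P n a}) =>
    let h := constructive_indefinite_description _ (H n (proj1_sig a) (proj2_sig a)) in
    exist (P (S n)) (proj1_sig h) (proj1 (proj2_sig h))).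
  pose (s := fix s n : {a | P n a} :=
    match n with O => exist _ a0 H0 | S n => next n (s n) end).
  exists (fun n => proj1_sig (s n)). split; [reflexivity|]. split.
  - intros n. exact (proj2_sig (s n)).
  - intros n. exact (proj2 (proj2_sig (constructive_indefinite_description _
      (H n (proj1_sig (s n)) (proj2_sig (s n)))))).
Qed.

Section Sequences.
Context {V : CompleteNormedModule R_AbsRing}.

Lemma cauchy_tends (x : nat -> V) :
  (forall eps, 0 < eps -> exists N, forall m n, (N <= m)%nat -> (N <= n)%nat ->
     norm (x m ⊖ x n) < eps) ->
  exists l, tends x eventually l.
Proof.
  intros H. apply (proj1 (@filterlim_locally_cauchy nat V eventually _ x)).
  intros eps. destruct (H eps (cond_pos eps)) as [N HN].
  exists (fun n => (N <= n)%nat). split; [now exists N|].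
  intros m n Hm Hn. apply (norm_compat1 (x m) (x n)). exact (HN n m Hn Hm).
Qed.

Lemma geometric_cauchy (x : nat -> V) C :
  0 <= C -> (forall n, norm (x (S n) ⊖ x n) <= C * (1 / 2) ^ n) ->
  exists l, tends x eventually l.
Proof.
  intros HC Hx.
  (* The exact partial sum of the geometric series, which makes the induction on [p] close. *)
  assert (K : forall n p, norm (x (n + p)%nat ⊖ x n) <= 2 * C * (1 / 2) ^ n * (1 - (1 / 2) ^ p)).
  { intros n p. induction p as [|p IH].
    - rewrite Nat.add_0_r, norm_vsub_diag. simpl. lra.
    - eapply Rle_trans; [apply (norm_vsub_triangle (x (n + p)%nat))|].
      rewrite Nat.add_succ_r. assert (K := Hx (n + p)%nat). rewrite pow_add in K.
      simpl. lra. }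
  assert (P : forall n, 0 < (1 / 2) ^ n) by (intros; apply pow_lt; lra).
  apply cauchy_tends. intros eps He.
  assert (L : is_lim_seq (fun n => 4 * C * (1 / 2) ^ n) 0).
  { replace (Finite 0) with (Rbar_mult (4 * C) 0) by (simpl; f_equal; ring).
    apply is_lim_seq_scal_l, is_lim_seq_geom. rewrite Rabs_pos_eq; lra. }
  apply is_lim_seq_spec in L. destruct (L (mkposreal eps He)) as [N HN].
  exists N. intros m n Hm Hn.
  eapply Rle_lt_trans; [apply (norm_vsub_triangle (x N))|].
  rewrite (norm_vsub_sym (x N)).
  assert (K1 := K N (m - N)%nat). assert (K2 := K N (n - N)%nat).
  replace (N + (m - N))%nat with m in K1 by lia.
  replace (N + (n - N))%nat with n in K2 by lia.
  assert (K3 := HN N (le_n N)). simpl in K3. apply Rabs_def2 in K3.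
  assert (forall p, 2 * C * (1 / 2) ^ N * (1 - (1 / 2) ^ p) <= 2 * C * (1 / 2) ^ N).
  { intros p. assert (H1 := P p). assert (H2 := P N).
    assert (0 <= 2 * C * (1 / 2) ^ N * (1 / 2) ^ p)
      by (repeat apply Rmult_le_pos; lra). lra. }
  generalize (H (m - N)%nat) (H (n - N)%nat). lra.
Qed.

Lemma tends_norm_le {T} {F : (T -> Prop) -> Prop} {FF : ProperFilter F}
    (f : T -> V) l y c :
  tends f F l -> F (fun p => norm (f p ⊖ y) <= c) -> norm (l ⊖ y) <= c.
Proof.
  intros Hf Hc. apply le_epsilon. intros eps He.
  assert (K := proj1 (tends_norm_iff f l) Hf eps He).
  destruct (filter_ex _ (filter_and _ _ Hc K)) as [p [H1 H2]].
  eapply Rle_trans; [apply (norm_vsub_triangle (f p))|].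
  rewrite norm_vsub_sym. lra.
Qed.

Lemma tends_norm {T} {F : (T -> Prop) -> Prop} {FF : Filter F} (f : T -> V) l :
  tends f F l -> tends (fun p => norm (f p)) F (norm l).
Proof.
  intros Hf. eapply filterlim_comp; [exact Hf|apply (filterlim_norm l)].
Qed.

Lemma tends_le {T} {F : (T -> Prop) -> Prop} {FF : ProperFilter F} (f g : T -> R) a b :
  F (fun p => f p <= g p) -> tends f F a -> tends g F b -> a <= b.
Proof.
  intros H Hf Hg.
  exact (filterlim_le (F := F) f g (Finite a) (Finite b) H Hf Hg).
Qed.

Lemma tends_subst_seq (x : nat -> V) l (s : nat -> nat) :
  (forall n, (n <= s n)%nat) -> tends x eventually l ->
  tends (fun n => x (s n)) eventually l.
Proof.
  intros Hs Hx P HP. destruct (Hx P HP) as [N HN].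
  exists N. intros n Hn. apply HN. specialize (Hs n). lia.
Qed.
End Sequences.

Section Cone.
Context {X : AbstractStateSpace}.
Implicit Types u v w : X.

Lemma cone_vzero : cone (vzero : X).
Proof. exact (cone_zero X). Qed.

Lemma cone_vadd u v : cone u -> cone v -> cone (u ⊕ v).
Proof. exact (@cone_plus X u v). Qed.

Lemma cone_vscal r u : 0 <= r -> cone u -> cone (r ⊙ u).
Proof. exact (@cone_scal X r u). Qed.

Lemma cone_antisym u v : cone (u ⊖ v) -> cone (v ⊖ u) -> u = v.
Proof.
  intros H1 H2.
  assert (E : u ⊖ v = vzero).
  { apply (cone_pointed X (u ⊖ v)); [exact H1|].
    change (cone (opp (u ⊖ v))).
    replace (opp (u ⊖ v)) with (v ⊖ u) by module. exact H2. }
  replace u with ((u ⊖ v) ⊕ v) by module. rewrite E. module.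
Qed.

Lemma cone_trans v u w : cone (u ⊖ v) -> cone (v ⊖ w) -> cone (u ⊖ w).
Proof.
  intros H1 H2. replace (u ⊖ w) with ((u ⊖ v) ⊕ (v ⊖ w)) by module.
  now apply cone_vadd.
Qed.

Lemma cone_tends {T} {F : (T -> Prop) -> Prop} {FF : ProperFilter F} (f : T -> X) l :
  F (fun p => cone (f p)) -> tends f F l -> cone l.
Proof.
  intros H Hf.
  exact (@closed_filterlim_loc _ _ F (Proper_StrongProper _ FF) f cone l Hf H (@cone_closed X)).
Qed.

Lemma cone_RInt (f : R -> X) a b l :
  a <= b -> (forall s, a < s < b -> cone (f s)) -> is_RInt f a b l -> cone l.
Proof.
  apply is_RInt_closed_cone; [apply cone_vzero|apply cone_vadd|apply cone_vscal|apply cone_closed].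
Qed.

(** The image, under the map sending (p, q) to p - q, of the pairs of positive vectors of total mass
    at most [c]: the sets to which the Baire argument applies. *)
Definition decomposable (c : R) u : Prop :=
  exists p q, cone p /\ cone q /\ u = p ⊖ q /\ norm p + norm q <= c.

Lemma decomposable_scal c r u :
  0 <= r -> decomposable c u -> decomposable (r * c) (r ⊙ u).
Proof.
  intros Hr (p & q & Hp & Hq & -> & H). exists (r ⊙ p), (r ⊙ q).
  repeat split; try (now apply cone_vscal); [module|].
  assert (K1 := norm_vscal r p). assert (K2 := norm_vscal r q).
  rewrite Rabs_pos_eq in K1, K2 by lra.
  assert (r * (norm p + norm q) <= r * c) by (apply Rmult_le_compat_l; lra). lra.
Qed.

Lemma decomposable_vsub c d u v :
  decomposable c u -> decomposable d v -> decomposable (c + d) (u ⊖ v).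
Proof.
  intros (p & q & Hp & Hq & -> & H) (p' & q' & Hp' & Hq' & -> & H').
  exists (p ⊕ q'), (q ⊕ p'). repeat split; try (now apply cone_vadd); [module|].
  generalize (norm_vadd p q') (norm_vadd q p'). lra.
Qed.

(** Baire category argument. If none of the sets of decomposable vectors were dense in a ball,
    nested closed balls would shrink to a point avoiding all of them, although the cone is
    generating. *)
Lemma decomposable_dense_in_ball :
  exists (n : nat) (x0 : X) (r : R), 0 < r /\
    forall y, norm (y ⊖ x0) < r -> forall rho, 0 < rho ->
      exists z, norm (z ⊖ y) < rho /\ decomposable (INR n) z.
Proof.
  apply NNPP. intros Hn.
  assert (Hstep : forall n (p : X * R), 0 < snd p -> exists q : X * R,
    (0 < snd q <= (1 / 2) ^ S n) /\ (norm (fst q ⊖ fst p) + snd q <= snd p /\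
    forall z, norm (z ⊖ fst q) <= snd q -> ~ decomposable (INR n) z)).
  { intros n [x r] Hr. simpl in *.
    apply NNPP. intros Hno. apply Hn. exists n, x, r. split; auto.
    intros y Hy rho Hrho. apply NNPP. intros Hz. apply Hno.
    assert (Hp : 0 < (1 / 2) ^ S n) by (apply pow_lt; lra).
    (* The three bounds keep the closed ball free of decomposable vectors, keep it inside the
       previous ball, and make the centres a Cauchy sequence. *)
    set (r' := Rmin (rho / 2) (Rmin (r - norm (y ⊖ x)) ((1 / 2) ^ S n))).
    assert (A1 : r' <= rho / 2) by apply Rmin_l.
    assert (A2 : r' <= r - norm (y ⊖ x)) by (eapply Rle_trans; [apply Rmin_r|apply Rmin_l]).
    assert (A3 : r' <= (1 / 2) ^ S n) by (eapply Rle_trans; [apply Rmin_r|apply Rmin_r]).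
    assert (A4 : 0 < r') by (repeat apply Rmin_glb_lt; lra).
    exists (y, r'). simpl snd; simpl fst. split; [split; auto|]. split; [lra|].
    intros z Hzy Hd. apply Hz. exists z. split; auto. lra. }
  destruct (@dependent_choice (X * R) (fun n p => 0 < snd p <= (1 / 2) ^ n)
    (fun n p q => norm (fst q ⊖ fst p) + snd q <= snd p /\
      forall z, norm (z ⊖ fst q) <= snd q -> ~ decomposable (INR n) z) (vzero, 1))
    as (s & _ & Hs & Hq).
  { simpl. lra. }
  { intros n p Hp. apply Hstep. apply Hp. }
  destruct (@geometric_cauchy X (fun n => fst (s n)) 1) as [l Hl]; [lra| |].
  { intros n. destruct (Hq n) as [H _]. destruct (Hs n) as [_ H2].
    destruct (Hs (S n)) as [H3 _]. lra. }
  assert (Hball : forall n, norm (l ⊖ fst (s n)) <= snd (s n)).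
  { intros n. apply (tends_norm_le _ _ Hl). exists n. intros m Hm.
    assert (K : norm (fst (s m) ⊖ fst (s n)) + snd (s m) <= snd (s n)).
    { induction Hm as [|m Hm IH].
      - rewrite norm_vsub_diag. lra.
      - destruct (Hq m) as [H _].
        generalize (norm_vsub_triangle (fst (s m)) (fst (s (S m))) (fst (s n))). lra. }
    destruct (Hs m). lra. }
  destruct (cone_generating X l) as (p & q & Hp & Hc & E).
  destruct (INR_unbounded (norm p + norm q)) as [n Hnn].
  (* Ball number [S n] is the one chosen to avoid [decomposable (INR n)], hence the shift in
     [Hball]. *)
  destruct (Hq n) as [_ H]. apply (H l (Hball (S n))).
  exists p, q. repeat split; auto. lra.
Qed.

(* The open mapping argument for the addition map on pairs of positive vectors. *)
Lemma bounded_decomposition :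
  exists M, 1 <= M /\ forall u, decomposable (M * norm u) u.
Proof.
  destruct decomposable_dense_in_ball as (n & x0 & r & Hr & Hball).
  (* The ball is moved to the origin by writing [y] as half the difference of x0 + y and x0 - y;
     differences of decomposable vectors are decomposable. *)
  assert (H0 : forall y rho, norm y < r -> 0 < rho ->
    exists z, norm (z ⊖ y) < rho /\ decomposable (INR n) z).
  { intros y rho Hy Hrho.
    destruct (Hball (x0 ⊕ y)) with (rho := rho) as (a & Ha & Da); auto.
    { replace (x0 ⊕ y ⊖ x0) with y by module. auto. }
    destruct (Hball (x0 ⊖ y)) with (rho := rho) as (b & Hb & Db); auto.
    { rewrite norm_vsub_sym. replace (x0 ⊖ (x0 ⊖ y)) with y by module. auto. }
    exists (1 / 2 ⊙ (a ⊖ b)). split.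
    - replace (1 / 2 ⊙ (a ⊖ b) ⊖ y) with
        (1 / 2 ⊙ ((a ⊖ (x0 ⊕ y)) ⊖ (b ⊖ (x0 ⊖ y)))) by (module by field).
      eapply Rle_lt_trans; [apply norm_vscal|]. rewrite Rabs_pos_eq by lra.
      generalize (norm_vsub (a ⊖ (x0 ⊕ y)) (b ⊖ (x0 ⊖ y))). lra.
    - replace (INR n) with (1 / 2 * (INR n + INR n)) by field.
      apply decomposable_scal; [lra|]. now apply decomposable_vsub. }
  (* Homogeneity: a nonzero [y] is rescaled to norm [r / 2], which turns the bound [INR n] into
     [c * norm y]. *)
  set (c := 2 * INR n / r).
  assert (Hc : 0 <= c).
  { unfold c, Rdiv. repeat apply Rmult_le_pos; try lra. apply pos_INR.
    left. now apply Rinv_0_lt_compat. }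
  assert (H1 : forall y rho, 0 < rho ->
    exists z, norm (z ⊖ y) < rho /\ decomposable (c * norm y) z).
  { intros y rho Hrho.
    destruct (Rle_lt_or_eq_dec 0 (norm y) (norm_ge_0 y)) as [Hy|Hy].
    - set (t := r / (2 * norm y)).
      assert (Ht : 0 < t) by (apply Rdiv_lt_0_compat; lra).
      destruct (H0 (t ⊙ y) (t * rho)) as (z & Hz & Dz).
      + eapply Rle_lt_trans; [apply norm_vscal|]. rewrite Rabs_pos_eq by lra.
        unfold t. replace (r / (2 * norm y) * norm y) with (r / 2) by (field; lra). lra.
      + now apply Rmult_lt_0_compat.
      + exists (/ t ⊙ z). assert (Hi : 0 < / t) by now apply Rinv_0_lt_compat. split.
        * replace (/ t ⊙ z ⊖ y) with (/ t ⊙ (z ⊖ t ⊙ y)) by (module by field; lra).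
          eapply Rle_lt_trans; [apply norm_vscal|]. rewrite Rabs_pos_eq by lra.
          replace rho with (/ t * (t * rho)) by (field; lra).
          now apply Rmult_lt_compat_l.
        * replace (c * norm y) with (/ t * INR n) by (unfold c, t; field; lra).
          apply decomposable_scal; auto; lra.
    - exists vzero. split.
      + apply Rle_lt_trans with (norm (vzero : X) + norm y); [apply norm_vsub|].
        rewrite norm_vzero. lra.
      + exists vzero, vzero. repeat split; try apply cone_vzero; [module|].
        rewrite norm_vzero, <- Hy. lra. }
  (* A geometric series of ratio 1/2 starting at [c * norm u] sums to [2 * c * norm u]; the added 1
     ensures that the constant is at least 1. *)
  exists (2 * c + 1). split; [lra|]. intros u. set (e := norm u).
  assert (He : 0 <= e) by apply norm_ge_0.
  (* Successive approximation: the first component is the remainder, its bound halved at every step,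
     and the second holds the two positive parts accumulated so far. *)
  destruct (@dependent_choice (X * (X * X))
    (fun k s => cone (fst (snd s)) /\ cone (snd (snd s)) /\
       u = fst s ⊕ (fst (snd s) ⊖ snd (snd s)) /\
       norm (fst s) <= e * (1 / 2) ^ k /\
       norm (fst (snd s)) + norm (snd (snd s)) <= 2 * c * e * (1 - (1 / 2) ^ k))
    (fun k s s' =>
       norm (fst (snd s') ⊖ fst (snd s)) <= c * e * (1 / 2) ^ k /\
       norm (snd (snd s') ⊖ snd (snd s)) <= c * e * (1 / 2) ^ k)
    (u, (vzero, vzero))) as (s & _ & Hs & Hq).
  { simpl. repeat split; try apply cone_vzero; try (unfold e; lra).
    - module.
    - rewrite norm_vzero. lra. }
  { intros k (y & P & Q) (HP & HQ & E & Hy & HPQ). simpl in *.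
    assert (Hk : 0 < (1 / 2) ^ k) by (apply pow_lt; lra).
    destruct (Rle_lt_or_eq_dec 0 e He) as [He'|He'].
    - destruct (H1 y (e * (1 / 2) ^ S k)) as (z & Hz & p & q & Hp & Hq & -> & Hpq).
      { simpl. apply Rmult_lt_0_compat; lra. }
      assert (Hpq' : norm p + norm q <= c * e * (1 / 2) ^ k).
      { eapply Rle_trans; [exact Hpq|]. rewrite Rmult_assoc.
        now apply Rmult_le_compat_l. }
      assert (Np := norm_ge_0 p). assert (Nq := norm_ge_0 q).
      exists (y ⊖ (p ⊖ q), (P ⊕ p, Q ⊕ q)). simpl in *.
      rewrite norm_vsub_sym in Hz.
      repeat split; try (now apply cone_vadd); try lra.
      + rewrite E at 1. module.
      + generalize (norm_vadd P p) (norm_vadd Q q). lra.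
      + replace (P ⊕ p ⊖ P) with p by module. lra.
      + replace (Q ⊕ q ⊖ Q) with q by module. lra.
    - exists (y, (P, Q)). rewrite <- He' in *. simpl.
      assert (norm y <= 0) by lra. assert (0 <= norm y) by apply norm_ge_0.
      repeat split; auto; try rewrite norm_vsub_diag; lra. }
  destruct (@geometric_cauchy X (fun k => fst (snd (s k))) (c * e)) as [P HP].
  { now apply Rmult_le_pos. } { intros k; apply Hq. }
  destruct (@geometric_cauchy X (fun k => snd (snd (s k))) (c * e)) as [Q HQ].
  { now apply Rmult_le_pos. } { intros k; apply Hq. }
  exists P, Q. repeat split.
  - apply (cone_tends (f := fun k => fst (snd (s k))) (F := eventually)); auto.
    apply filter_forall. intros k; apply Hs.
  - apply (cone_tends (f := fun k => snd (snd (s k))) (F := eventually)); auto.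
    apply filter_forall. intros k; apply Hs.
  - apply (tends_unique (F := eventually) (f := fun k => fst (snd (s k)) ⊖ snd (snd (s k)))).
    2: now apply tends_vsub.
    apply tends_dominated with (g := fun k => e * (1 / 2) ^ k).
    + apply filter_forall. intros k. destruct (Hs k) as (_ & _ & E & Hn & _).
      rewrite norm_vsub_sym. rewrite E at 1.
      replace (fst (s k) ⊕ (fst (snd (s k)) ⊖ snd (snd (s k))) ⊖
        (fst (snd (s k)) ⊖ snd (snd (s k)))) with (fst (s k)) by module. exact Hn.
    + assert (L : is_lim_seq (fun k => e * (1 / 2) ^ k) 0); [|exact L].
      replace (Finite 0) with (Rbar_mult e 0) by (simpl; f_equal; ring).
      apply is_lim_seq_scal_l, is_lim_seq_geom. rewrite Rabs_pos_eq; lra.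
  - apply (tends_le (F := eventually) (f := fun k => norm (fst (snd (s k))) + norm (snd (snd (s k))))
      (g := fun _ => (2 * c + 1) * e)).
    + apply filter_forall. intros k. destruct (Hs k) as (_ & _ & _ & _ & H).
      assert (0 < (1 / 2) ^ k) by (apply pow_lt; lra).
      assert (0 <= c * e * (1 / 2) ^ k) by (apply Rmult_le_pos; [apply Rmult_le_pos|]; lra). lra.
    + apply (tends_vadd (V := R_NormedModule)); now apply tends_norm.
    + apply tends_const.
Qed.
End Cone.

Unset Implicit Arguments.

(** Sums over [k < n], whereas [sum_n] includes its upper index; this accounts for the shifts by [S]
    where the two meet. *)
Fixpoint vsum {V : NormedModule R_AbsRing} (x : nat -> V) (n : nat) : V :=
  match n with O => vzero | S n => vsum x n ⊕ x n end.

Lemma tends_right_of_is_derive {k : R -> R} {t l} :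
  is_derive k t l -> tends (fun h => / h * (k (t + h) - k t)) (at_right 0) l.
Proof.
  intros H. apply is_derive_Reals in H. apply tends_norm_iff. intros eps He.
  destruct (H eps He) as [d Hd]. apply at_right_0_iff.
  exists d. split; [apply cond_pos|]. intros h Hh.
  assert (K := Hd h ltac:(lra) ltac:(rewrite Rabs_pos_eq; lra)).
  change (Rabs (/ h * (k (t + h) - k t) - l) < eps).
  replace (/ h * (k (t + h) - k t)) with ((k (t + h) - k t) / h)
    by (unfold Rdiv; ring). exact K.
Qed.

Lemma hcont_exp a : hcont (fun s => exp (a * s)).
Proof.
  apply hcont_of_continuous. intros t.
  apply (ex_derive_continuous (V := R_NormedModule)). auto_derive. auto.
Qed.

Lemma rderiv_exp_vscal {V : NormedModule R_AbsRing} a {f : R -> V} {t l} :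
  0 <= t -> rderiv f t l ->
  rderiv (fun s => exp (a * s) ⊙ f s) t
    ((a * exp (a * t)) ⊙ f t ⊕ exp (a * t) ⊙ l).
Proof.
  intros Ht Hf. apply (rderiv_vscal (fun s => exp (a * s))); auto.
  - apply (tends_right_of_is_derive (k := fun s => exp (a * s))). auto_derive; auto; ring.
  - exact (hcont_right Ht (hcont_exp a)).
Qed.

(** * The norm functional and monotone convergence *)

Section Functional.
Context {X : AbstractStateSpace} {Psi : X -> R} (hPsi : is_norm_functional Psi).
Implicit Types u v w : X.

Lemma generating u : exists p q, cone p /\ cone q /\ u = p ⊖ q.
Proof. exact (cone_generating X u). Qed.

Lemma Psi_linear : is_linear (V := R_NormedModule) Psi.
Proof. apply hPsi. Qed.

Lemma Psi_vadd u v : Psi (u ⊕ v) = Psi u + Psi v.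
Proof. exact (linear_vadd Psi_linear u v). Qed.

Lemma Psi_vsub u v : Psi (u ⊖ v) = Psi u - Psi v.
Proof. exact (linear_vsub Psi_linear u v). Qed.

Lemma Psi_vscal r u : Psi (r ⊙ u) = r * Psi u.
Proof. exact (linear_vscal Psi_linear r u). Qed.

Lemma Psi_vzero : Psi vzero = 0.
Proof. exact (linear_vzero Psi_linear). Qed.

Lemma Psi_norm u : cone u -> Psi u = norm u.
Proof. apply hPsi. Qed.

Lemma Psi_ge_0 u : cone u -> 0 <= Psi u.
Proof. intros H. rewrite Psi_norm; auto. apply norm_ge_0. Qed.

Lemma Psi_mono u v : cone (v ⊖ u) -> Psi u <= Psi v.
Proof. intros H. apply Psi_ge_0 in H. rewrite Psi_vsub in H. lra. Qed.

Lemma norm_vsub_Psi u v : cone (v ⊖ u) -> norm (v ⊖ u) = Psi v - Psi u.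
Proof. intros H. rewrite <- Psi_norm; auto. apply Psi_vsub. Qed.

Lemma tends_Psi {T} {F : (T -> Prop) -> Prop} {FF : Filter F} {f : T -> X} {l} :
  tends f F l -> tends (fun p => Psi (f p)) F (Psi l).
Proof. apply tends_linear, Psi_linear. Qed.

Lemma increasing_cone {x : nat -> X} :
  (forall n, cone (x (S n) ⊖ x n)) -> forall n m, (n <= m)%nat -> cone (x m ⊖ x n).
Proof.
  intros Hx n m Hm. induction Hm as [|m Hm IH].
  - replace (x n ⊖ x n) with (vzero : X) by module. apply cone_vzero.
  - apply (cone_trans (x m)); auto.
Qed.

(** Between ordered vectors the distance is the difference of the values of [Psi], so convergence of
    the bounded monotone real sequence makes [x] Cauchy. *)
Lemma increasing_bounded_tends (x : nat -> X) C :
  (forall n, cone (x (S n) ⊖ x n)) -> (forall n, Psi (x n) <= C) ->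
  exists l, tends x eventually l /\ forall n, cone (l ⊖ x n).
Proof.
  intros Hx HC. assert (Hi := increasing_cone Hx).
  assert (Hl : ex_finite_lim_seq (fun n => Psi (x n))).
  { apply ex_finite_lim_seq_incr with C; auto. intros n. apply Psi_mono, Hx. }
  apply ex_lim_seq_cauchy_corr in Hl.
  destruct (cauchy_tends x) as [l Hl'].
  { intros eps He. destruct (Hl (mkposreal eps He)) as [N HN]. exists N.
    intros m n Hm Hn. specialize (HN m n Hm Hn). simpl in HN.
    destruct (Nat.le_ge_cases n m) as [H|H].
    - rewrite norm_vsub_Psi by now apply Hi. apply Rabs_def2 in HN. lra.
    - rewrite norm_vsub_sym, norm_vsub_Psi by now apply Hi. apply Rabs_def2 in HN. lra. }
  exists l. split; auto. intros n.
  apply (cone_tends (F := eventually) (f := fun m => x m ⊖ x n)).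
  - exists n. intros m Hm. now apply Hi.
  - apply tends_vsub; auto. apply tends_const.
Qed.

Definition decomposition_bound (M : R) : Prop :=
  1 <= M /\ forall u, decomposable (M * norm u) u.

(** Splitting [u] into positive parts of total mass at most [M * norm u] carries a bound on the cone
    over to the whole space. *)
Lemma norm_le_of_cone {M} (L : X -> X) c u : decomposition_bound M ->
  0 <= c -> (forall u v, L (u ⊖ v) = L u ⊖ L v) ->
  (forall u, cone u -> norm (L u) <= c * norm u) -> norm (L u) <= c * M * norm u.
Proof.
  intros [HM Hd] Hc HL HLc.
  destruct (Hd u) as (p & q & Hp & Hq & E & H). rewrite E at 1. rewrite HL.
  eapply Rle_trans; [apply norm_vsub|].
  generalize (HLc p Hp) (HLc q Hq). rewrite Rmult_assoc.
  assert (c * (norm p + norm q) <= c * (M * norm u)) by now apply Rmult_le_compat_l.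
  lra.
Qed.

Lemma is_linear_of_cone (L : X -> X) c : 0 <= c ->
  (forall u v, L (u ⊕ v) = L u ⊕ L v) -> (forall r u, L (r ⊙ u) = r ⊙ L u) ->
  (forall u, cone u -> norm (L u) <= c * norm u) -> is_linear L.
Proof.
  intros Hc H1 H2 H3. destruct (@bounded_decomposition X) as [M HM].
  assert (H4 : forall u v, L (u ⊖ v) = L u ⊖ L v).
  { intros u v. replace (u ⊖ v) with (u ⊕ (-1) ⊙ v) by module.
    rewrite H1, H2. module. }
  constructor; [exact H1|exact H2|].
  (* [is_linear] asks for a positive constant, while [c] may be 0. *)
  exists ((c + 1) * M). split; [apply Rmult_lt_0_compat; destruct HM; lra|].
  intros u. apply (norm_le_of_cone (M := M)); auto; [lra|].
  intros v Hv. eapply Rle_trans; [apply H3, Hv|].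
  apply Rmult_le_compat_r; [apply norm_ge_0|lra].
Qed.

End Functional.

(** * Substochastic semigroups: generator and resolvent *)

Section Semigroup.
Context {X : AbstractStateSpace} {Psi : X -> R} (hPsi : is_norm_functional Psi).
Context {T : R -> X -> X} (hT : is_substochastic T).
Context {M : R} (HM : decomposition_bound (X := X) M).
Implicit Types u v w : X.

Lemma sgr_linear {t} : 0 <= t -> is_linear (T t).
Proof. apply (sg_bounded (sub_C0 hT)). Qed.

Lemma sgr_plus t s u : 0 <= t -> 0 <= s -> T (t + s) u = T t (T s u).
Proof. intros Ht Hs. exact (sg_plus (sub_C0 hT) u Ht Hs). Qed.

Lemma cone_sgr {t u} : 0 <= t -> cone u -> cone (T t u).
Proof. apply (sub_positive hT). Qed.

Lemma sgr_Psi t u : 0 <= t -> cone u -> Psi (T t u) <= Psi u.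
Proof.
  intros Ht Hu. rewrite !(Psi_norm hPsi); auto.
  - exact (sub_contractive hT u Ht Hu).
  - now apply cone_sgr.
Qed.

Lemma sgr_norm t u : 0 <= t -> norm (T t u) <= M * norm u.
Proof.
  intros Ht. rewrite <- (Rmult_1_l M). apply norm_le_of_cone; auto; [lra| |].
  - intros; apply linear_vsub, sgr_linear, Ht.
  - intros v Hv. rewrite Rmult_1_l. exact (sub_contractive hT v Ht Hv).
Qed.

Lemma sgr_right_0 u : tends (fun t => T t u) (at_right 0) u.
Proof. exact (sg_continuous (sub_C0 hT) (u := u)). Qed.

Lemma sgr_hcont u : hcont (fun t => T t u).
Proof.
  apply hcont_modulus. intros eps He.
  assert (HM1 : 1 <= M) by apply HM.
  assert (K := proj1 (tends_norm_iff _ _) (sgr_right_0 u) (eps / M)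
    ltac:(apply Rdiv_lt_0_compat; lra)).
  apply at_right_0_iff in K. destruct K as (d & Hd & K). exists d. split; auto.
  intros s h Hs Hh. rewrite sgr_plus by lra.
  rewrite <- (linear_vsub (sgr_linear Hs)).
  eapply Rle_lt_trans; [apply sgr_norm, Hs|].
  replace eps with (M * (eps / M)) by (field; lra).
  apply Rmult_lt_compat_l; [lra|]. now apply K.
Qed.

Lemma generator_value {u w} :
  tends (fun h => / h ⊙ (T h u ⊖ u)) (at_right 0) w ->
  dom (generator T) u /\ generator T u = w.
Proof.
  intros H. split; [now exists w|].
  apply (iota_unique (is_generator_value T u)); [|exact H].
  intros y Hy. exact (tends_unique (F := at_right 0) Hy H).
Qed.

Lemma generator_tends {u} : dom (generator T) u ->
  tends (fun h => / h ⊙ (T h u ⊖ u)) (at_right 0) (generator T u).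
Proof.
  intros [w Hw]. rewrite (proj2 (generator_value Hw)). exact Hw.
Qed.

Lemma generator_vadd {u v} : dom (generator T) u -> dom (generator T) v ->
  dom (generator T) (u ⊕ v) /\ generator T (u ⊕ v) = generator T u ⊕ generator T v.
Proof.
  intros Hu Hv. apply generator_value.
  eapply tends_ext_loc; [|apply (tends_vadd (generator_tends Hu) (generator_tends Hv))].
  apply at_right_0_iff. exists 1. split; [lra|]. intros h Hh. simpl.
  rewrite (linear_vadd (sgr_linear (t := h) ltac:(lra))). module.
Qed.

Lemma generator_vscal r {u} : dom (generator T) u ->
  dom (generator T) (r ⊙ u) /\ generator T (r ⊙ u) = r ⊙ generator T u.
Proof.
  intros Hu. apply generator_value.
  eapply tends_ext_loc; [|apply (tends_vscal_r r (generator_tends Hu))].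
  apply at_right_0_iff. exists 1. split; [lra|]. intros h Hh. simpl.
  rewrite (linear_vscal (sgr_linear (t := h) ltac:(lra))). module.
Qed.

Lemma generator_vsub {u v} : dom (generator T) u -> dom (generator T) v ->
  dom (generator T) (u ⊖ v) /\ generator T (u ⊖ v) = generator T u ⊖ generator T v.
Proof.
  intros Hu Hv. destruct (generator_vscal (-1) Hv) as [Dv Ev].
  destruct (generator_vadd Hu Dv) as [D E].
  replace (u ⊖ v) with (u ⊕ (-1) ⊙ v) by module. split; auto.
  rewrite E, Ev. module.
Qed.

Lemma generator_vzero : dom (generator T) vzero /\ generator T vzero = vzero.
Proof.
  apply generator_value.
  apply tends_ext_loc with (f := fun _ => vzero); [|apply tends_const].
  apply at_right_0_iff. exists 1. split; [lra|]. intros h Hh.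
  rewrite (linear_vzero (sgr_linear (t := h) ltac:(lra))). module.
Qed.

Lemma generator_rderiv {u t} : dom (generator T) u -> 0 <= t ->
  rderiv (fun s => T s u) t (T t (generator T u)).
Proof.
  intros Hu Ht. unfold rderiv.
  eapply tends_ext_loc;
    [|apply (tends_linear (sgr_linear Ht) (generator_tends Hu))].
  apply at_right_0_iff. exists 1. split; [lra|]. intros h Hh. simpl.
  rewrite (linear_vscal (sgr_linear Ht)), (linear_vsub (sgr_linear Ht)).
  rewrite sgr_plus by lra. reflexivity.
Qed.

Lemma generator_sgr {u t} : dom (generator T) u -> 0 <= t ->
  dom (generator T) (T t u) /\ generator T (T t u) = T t (generator T u).
Proof.
  intros Hu Ht. apply generator_value.
  eapply tends_ext_loc; [|apply (generator_rderiv Hu Ht)].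
  apply at_right_0_iff. exists 1. split; [lra|]. intros h Hh. simpl.
  rewrite <- !sgr_plus by lra. now rewrite Rplus_comm.
Qed.

Lemma sgr_RInt_average u : tends (fun h => / h ⊙ RInt (fun s => T s u) 0 h) (at_right 0) u.
Proof.
  assert (K := rderiv_RInt (Rle_refl 0) (sgr_hcont u)). unfold rderiv in K.
  rewrite (sg_zero (sub_C0 hT)) in K.
  eapply tends_ext; [|exact K]. intros h. simpl.
  rewrite RInt_point, Rplus_0_l. module.
Qed.

Lemma cone_sgr_RInt {u t} : 0 <= t -> cone u -> cone (RInt (fun s => T s u) 0 t).
Proof.
  intros Ht Hu. apply (cone_RInt (f := fun s => T s u) (a := 0) (b := t)); auto.
  - intros s Hs. apply cone_sgr; auto; lra.
  - apply hcont_is_RInt; [lra|apply sgr_hcont].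
Qed.

Lemma generator_RInt u {t} : 0 <= t ->
  dom (generator T) (RInt (fun s => T s u) 0 t) /\
  generator T (RInt (fun s => T s u) 0 t) = T t u ⊖ u.
Proof.
  intros Ht. apply generator_value.
  assert (Hc := sgr_hcont u).
  assert (K0 := rderiv_RInt (Rle_refl 0) Hc).
  cbv beta in K0. rewrite (sg_zero (sub_C0 hT)) in K0.
  eapply tends_ext_loc; [|apply (tends_vsub (rderiv_RInt Ht Hc) K0)].
  apply at_right_0_iff. exists 1. split; [lra|]. intros h Hh. simpl.
  (* [T h] slides the window of integration from [0, t] to [h, t + h], so only the two end pieces
     remain in the difference. *)
  assert (E : T h (RInt (fun s => T s u) 0 t) = RInt (fun s => T s u) h (t + h)).
  { transitivity (RInt (fun s => T (s + h) u) 0 t).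
    - symmetry. apply (is_RInt_unique (fun s => T (s + h) u)).
      apply (is_RInt_ext (fun s => T h (T s u))).
      + rewrite Rmin_left, Rmax_right by lra. intros s Hs.
        rewrite <- sgr_plus by lra. now rewrite Rplus_comm.
      + apply is_RInt_linear; [apply sgr_linear; lra|]. apply hcont_is_RInt; auto; lra.
    - apply (is_RInt_unique (fun s => T (s + h) u)).
      apply (is_RInt_shift (f := fun s => T s u)). rewrite Rplus_0_l. apply hcont_is_RInt; auto; lra. }
  rewrite E, RInt_point, Rplus_0_l.
  rewrite <- (@hcont_RInt_Chasles X (fun s => T s u) 0 t (t + h)) by (auto; lra).
  assert (E2 : RInt (fun s => T s u) 0 h ⊕ RInt (fun s => T s u) h (t + h) =
               RInt (fun s => T s u) 0 t ⊕ RInt (fun s => T s u) t (t + h)).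
  { rewrite !hcont_RInt_Chasles by (auto; lra). reflexivity. }
  replace (RInt (fun s => T s u) h (t + h)) with
    (RInt (fun s => T s u) 0 h ⊕ RInt (fun s => T s u) h (t + h) ⊖ RInt (fun s => T s u) 0 h)
    by module.
  rewrite E2. module.
Qed.

(** * The resolvent as a Laplace transform *)

Section Resolvent.
Context {lam : R} (Hlam : 0 < lam).

(** The Laplace transform truncated at [tau]. For positive [u] it increases with [tau], so its limit
    along the integers takes the place of an improper integral. *)
Definition laplace (tau : R) u : X := RInt (fun s => exp (- lam * s) ⊙ T s u) 0 tau.

Lemma laplace_hcont u : hcont (fun s => exp (- lam * s) ⊙ T s u).
Proof. apply hcont_vscal; [apply hcont_exp|apply sgr_hcont]. Qed.

Lemma cone_laplace_vsub u a b : cone u -> 0 <= a <= b ->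
  cone (laplace b u ⊖ laplace a u).
Proof.
  intros Hu Hab. unfold laplace.
  rewrite <- (@hcont_RInt_Chasles X _ 0 a b) by (try apply laplace_hcont; lra).
  match goal with |- cone (?x ⊕ ?y ⊖ ?x) => replace (x ⊕ y ⊖ x) with y by module end.
  apply (cone_RInt (f := fun s => exp (- lam * s) ⊙ T s u) (a := a) (b := b)); [lra| |].
  - intros s Hs. apply cone_vscal; [left; apply exp_pos|].
    apply cone_sgr; auto; lra.
  - apply hcont_is_RInt; [lra|apply laplace_hcont].
Qed.

Lemma Psi_laplace u tau : cone u -> 0 <= tau -> Psi (laplace tau u) <= Psi u / lam.
Proof.
  intros Hu Ht.
  assert (K : is_RInt (fun s => Psi (exp (- lam * s) ⊙ T s u)) 0 tau (Psi (laplace tau u))).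
  { apply (is_RInt_linear (Psi_linear hPsi)). apply hcont_is_RInt; [lra|apply laplace_hcont]. }
  assert (K2 : is_RInt (fun s => exp (- lam * s) * Psi u) 0 tau
    (- exp (- lam * tau) * Psi u / lam - (- exp (- lam * 0) * Psi u / lam))).
  { apply (is_RInt_derive (V := R_CompleteNormedModule)
      (fun s => - exp (- lam * s) * Psi u / lam)).
    - intros s _. auto_derive; auto. field. lra.
    - intros s _. apply (ex_derive_continuous (V := R_NormedModule)). auto_derive. auto. }
  eapply Rle_trans.
  - eapply is_RInt_le; [exact Ht|exact K|exact K2|].
    intros s Hs. simpl. rewrite (Psi_vscal hPsi).
    apply Rmult_le_compat_l; [left; apply exp_pos|]. apply sgr_Psi; auto; lra.
  - rewrite Rmult_0_r, exp_0.
    assert (0 <= exp (- lam * tau) * Psi u / lam).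
    { unfold Rdiv. apply Rmult_le_pos; [apply Rmult_le_pos|].
      - left; apply exp_pos.
      - now apply (Psi_ge_0 hPsi).
      - left. now apply Rinv_0_lt_compat. }
    lra.
Qed.

Lemma sgr_laplace u h tau : 0 <= h -> 0 <= tau ->
  T h (laplace tau u) = exp (lam * h) ⊙ (laplace (tau + h) u ⊖ laplace h u).
Proof.
  intros Hh Ht. assert (Hc := laplace_hcont u).
  assert (K1 : is_RInt (fun s => exp (lam * h) ⊙ (exp (- lam * (s + h)) ⊙ T (s + h) u)) 0 tau
    (T h (laplace tau u))).
  { apply (is_RInt_ext (fun s => T h (exp (- lam * s) ⊙ T s u))).
    - rewrite Rmin_left, Rmax_right by lra. intros s Hs.
      rewrite (linear_vscal (sgr_linear Hh)), <- sgr_plus by lra.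
      rewrite (Rplus_comm h s).
      replace (exp (- lam * s)) with (exp (lam * h) * exp (- lam * (s + h))).
      + module.
      + rewrite <- exp_plus. f_equal. ring.
    - apply is_RInt_linear; [now apply sgr_linear|]. apply hcont_is_RInt; auto; lra. }
  assert (K2 : is_RInt (fun s => exp (lam * h) ⊙ (exp (- lam * (s + h)) ⊙ T (s + h) u)) 0 tau
    (exp (lam * h) ⊙ (laplace (tau + h) u ⊖ laplace h u))).
  { apply (is_RInt_scal (V := X) (fun s => exp (- lam * (s + h)) ⊙ T (s + h) u)).
    apply (is_RInt_shift (f := fun s => exp (- lam * s) ⊙ T s u)). rewrite Rplus_0_l.
    unfold laplace.
    rewrite <- (@hcont_RInt_Chasles X _ 0 h (tau + h)) by (auto; lra).
    match goal with |- is_RInt _ _ _ (?x ⊕ ?y ⊖ ?x) => replace (x ⊕ y ⊖ x) with y by module end.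
    apply hcont_is_RInt; auto; lra. }
  rewrite <- (is_RInt_unique _ _ _ _ K1). now apply is_RInt_unique.
Qed.

(** The limit satisfies T(h)w = exp(lam h) (w - laplace h u) for small h; the right derivative of
    this at 0 is lam w - u, which is the value of the generator. *)
Lemma laplace_resolvent {u} : cone u -> exists w,
  tends (fun n => laplace (INR n) u) eventually w /\ cone w /\
  dom (generator T) w /\ lam ⊙ w ⊖ generator T w = u.
Proof.
  intros Hu.
  destruct (increasing_bounded_tends hPsi (fun n => laplace (INR n) u) (Psi u / lam))
    as (w & Hw & Hi).
  { intros n. apply cone_laplace_vsub; auto. rewrite S_INR.
    generalize (pos_INR n). lra. }
  { intros n. apply Psi_laplace; auto. apply pos_INR. }
  exists w. split; auto. split.
  { specialize (Hi 0%nat). unfold laplace in Hi at 1. simpl in Hi.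
    rewrite RInt_point in Hi.
    replace w with (w ⊖ vzero) by module. exact Hi. }
  assert (E : forall h, 0 < h < 1 ->
    T h w = exp (lam * h) ⊙ (w ⊖ laplace h u)).
  { intros h Hh.
    apply (tends_unique (F := eventually) (f := fun n => T h (laplace (INR n) u))).
    { apply tends_linear; auto. apply sgr_linear; lra. }
    apply tends_ext with (f := fun n => exp (lam * h) ⊙ (laplace (INR n + h) u ⊖ laplace h u)).
    { intros n. symmetry. apply sgr_laplace; [lra|apply pos_INR]. }
    apply tends_vscal_r, tends_vsub; [|apply tends_const].
    (* As [h < 1], the surplus over [n, n + h] is dominated by the increment from n to n + 1, which
       vanishes. *)
    apply tends_ext with (f := fun n => laplace (INR n) u ⊕
      (laplace (INR n + h) u ⊖ laplace (INR n) u)); [intros; module|].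
    replace w with (w ⊕ vzero) by module. apply tends_vadd; auto.
    apply tends_dominated with
      (g := fun n => norm (laplace (INR (S n)) u ⊖ laplace (INR n) u)).
    - apply filter_forall. intros n. assert (Hn := pos_INR n).
      replace (laplace (INR n + h) u ⊖ laplace (INR n) u ⊖ vzero) with
        (laplace (INR n + h) u ⊖ laplace (INR n) u) by module.
      rewrite S_INR.
      rewrite !(norm_vsub_Psi hPsi) by (apply cone_laplace_vsub; auto; lra).
      apply Rplus_le_compat_r. apply (Psi_mono hPsi), cone_laplace_vsub; auto; lra.
    - rewrite <- (norm_vsub_diag w). apply tends_norm, tends_vsub; auto.
      apply (tends_subst_seq (x := fun n => laplace (INR n) u) S); auto. }
  assert (G : dom (generator T) w /\ generator T w = lam ⊙ w ⊖ u).
  { apply generator_value.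
    assert (K1 : tends (fun h => / h * (exp (lam * (0 + h)) - exp (lam * 0))) (at_right 0) lam).
    { apply (tends_right_of_is_derive (k := fun x => exp (lam * x)) (t := 0)).
      auto_derive; auto. rewrite Rmult_0_r, exp_0. ring. }
    assert (K2 := hcont_right (Rle_refl 0) (hcont_exp lam)). simpl in K2.
    assert (K3 := rderiv_RInt (Rle_refl 0) (laplace_hcont u)).
    simpl in K3. unfold rderiv in K3. rewrite (sg_zero (sub_C0 hT)) in K3.
    replace (lam ⊙ w ⊖ u) with
      (lam ⊙ w ⊖ exp (lam * 0) ⊙ (exp (- lam * 0) ⊙ u))
      by (rewrite !Rmult_0_r, exp_0; module).
    eapply tends_ext_loc;
      [|apply (tends_vsub (tends_vscal K1 (tends_const (c := w))) (tends_vscal K2 K3))].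
    apply at_right_0_iff. exists 1. split; [lra|]. intros h Hh. simpl.
    rewrite E by lra. rewrite RInt_point, Rplus_0_l, Rmult_0_r, exp_0.
    unfold laplace. module. }
  destruct G as [D G]. split; auto. rewrite G. module.
Qed.

(** Injectivity of lam minus the generator: for an eigenvector, exp(-lam t) T(t)w is constant in t,
    whereas the uniform bound on the semigroup makes it decay. *)
Lemma generator_eigen_zero w :
  dom (generator T) w -> generator T w = lam ⊙ w -> w = vzero.
Proof.
  intros D E. assert (HM1 : 1 <= M) by apply HM.
  (* With this [t] the damping is exp(-2M), and exp(2M) > 1 + 2M > M forces [norm w = 0]. *)
  set (t := 2 * M / lam). assert (Ht : 0 < t) by (apply Rdiv_lt_0_compat; lra).
  assert (K : exp (- lam * t) ⊙ T t w = exp (- lam * 0) ⊙ T 0 w).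
  { apply (rderiv_zero_const (f := fun s => exp (- lam * s) ⊙ T s w)); [lra|apply laplace_hcont|].
    intros s Hs.
    replace vzero with ((- lam * exp (- lam * s)) ⊙ T s w ⊕ exp (- lam * s) ⊙ T s (generator T w)).
    - apply (rderiv_exp_vscal (- lam) (f := fun s => T s w)); [lra|].
      apply generator_rderiv; auto; lra.
    - rewrite E, (linear_vscal (sgr_linear (t := s) ltac:(lra))). module. }
  rewrite (sg_zero (sub_C0 hT)), Rmult_0_r, exp_0 in K.
  assert (N : norm w <= exp (- lam * t) * (M * norm w)).
  { replace w with (1 ⊙ w) at 1 by module. rewrite <- K.
    eapply Rle_trans; [apply norm_vscal|]. rewrite Rabs_pos_eq by (left; apply exp_pos).
    apply Rmult_le_compat_l; [left; apply exp_pos|]. apply sgr_norm. lra. }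
  replace (- lam * t) with (- (2 * M)) in N by (unfold t; field; lra).
  rewrite exp_Ropp in N.
  assert (P : 1 + 2 * M < exp (2 * M)) by (apply exp_ineq1; lra).
  assert (N2 : exp (2 * M) * norm w <= M * norm w).
  { replace (M * norm w) with (exp (2 * M) * (/ exp (2 * M) * (M * norm w)))
      by (field; lra).
    apply Rmult_le_compat_l; lra. }
  assert (N3 := norm_ge_0 w).
  apply norm_vsub_eq. replace (w ⊖ vzero) with w by module. nra.
Qed.

Notation Res := (resolvent (generator T) lam).

Lemma resolvent_unique {u w} :
  dom (generator T) w -> lam ⊙ w ⊖ generator T w = u -> Res u = w.
Proof.
  intros D E.
  apply (iota_unique (fun w => dom (generator T) w /\ minus (scal lam w) (generator T w) = u)).
  2: split; [exact D|exact E].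
  intros y [Dy Ey]. change (lam ⊙ y ⊖ generator T y = u) in Ey.
  destruct (generator_vsub Dy D) as [D' E'].
  assert (Z : y ⊖ w = vzero).
  { apply generator_eigen_zero; auto. rewrite E'.
    replace (generator T y) with (lam ⊙ y ⊖ (lam ⊙ y ⊖ generator T y)) by module.
    replace (generator T w) with (lam ⊙ w ⊖ (lam ⊙ w ⊖ generator T w)) by module.
    rewrite E, Ey. module. }
  replace y with ((y ⊖ w) ⊕ w) by module. rewrite Z. module.
Qed.

Lemma resolvent_spec u :
  dom (generator T) (Res u) /\ lam ⊙ Res u ⊖ generator T (Res u) = u.
Proof.
  assert (K : exists w, dom (generator T) w /\ lam ⊙ w ⊖ generator T w = u).
  { destruct (generating u) as (p & q & Hp & Hq & ->).
    destruct (laplace_resolvent Hp) as (wp & _ & _ & Dp & Ep).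
    destruct (laplace_resolvent Hq) as (wq & _ & _ & Dq & Eq).
    destruct (generator_vsub Dp Dq) as [D E]. exists (wp ⊖ wq). split; auto.
    rewrite E, <- Ep, <- Eq. module. }
  destruct K as (w & D & E). now rewrite (resolvent_unique D E).
Qed.

Lemma dom_resolvent u : dom (generator T) (Res u).
Proof. apply resolvent_spec. Qed.

Lemma generator_resolvent u : generator T (Res u) = lam ⊙ Res u ⊖ u.
Proof. rewrite <- (proj2 (resolvent_spec u)) at 3. module. Qed.

Lemma resolvent_generator {u} : dom (generator T) u -> Res (lam ⊙ u ⊖ generator T u) = u.
Proof. intros D. now apply resolvent_unique. Qed.

Lemma resolvent_vadd u v : Res (u ⊕ v) = Res u ⊕ Res v.
Proof.
  destruct (generator_vadd (dom_resolvent u) (dom_resolvent v)) as [D E].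
  apply resolvent_unique; auto. rewrite E, !generator_resolvent. module.
Qed.

Lemma resolvent_vscal r u : Res (r ⊙ u) = r ⊙ Res u.
Proof.
  destruct (generator_vscal r (dom_resolvent u)) as [D E].
  apply resolvent_unique; auto. rewrite E, !generator_resolvent. module.
Qed.

Lemma resolvent_tends {u} : cone u ->
  tends (fun n => laplace (INR n) u) eventually (Res u).
Proof.
  intros Hu. destruct (laplace_resolvent Hu) as (w & Hw & _ & D & E).
  now rewrite (resolvent_unique D E).
Qed.

Lemma cone_resolvent {u} : cone u -> cone (Res u).
Proof.
  intros Hu. destruct (laplace_resolvent Hu) as (w & _ & Hc & D & E).
  now rewrite (resolvent_unique D E).
Qed.

Lemma resolvent_linear : is_linear Res.
Proof.
  apply (is_linear_of_cone _ (/ lam)).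
  - left. now apply Rinv_0_lt_compat.
  - apply resolvent_vadd.
  - apply resolvent_vscal.
  - intros u Hu. rewrite <- !(Psi_norm hPsi); auto; [|now apply cone_resolvent].
    apply (tends_le (F := eventually) (f := fun n => Psi (laplace (INR n) u))
      (g := fun _ => / lam * Psi u)).
    + apply filter_forall. intros n. rewrite Rmult_comm.
      apply Psi_laplace; auto. apply pos_INR.
    + exact (tends_Psi hPsi (resolvent_tends Hu)).
    + apply tends_const.
Qed.

End Resolvent.
End Semigroup.

(** * Finite sums in normed modules *)

Section FiniteSums.
Context {V : NormedModule R_AbsRing}.

Lemma vsum_ext (x y : nat -> V) n :
  (forall k, (k < n)%nat -> x k = y k) -> vsum x n = vsum y n.
Proof.
  intros H. induction n as [|n IH]; simpl; auto.
  rewrite IH, H; auto.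
Qed.

Lemma vsum_head (x : nat -> V) n : vsum x (S n) = x 0%nat ⊕ vsum (fun k => x (S k)) n.
Proof.
  induction n as [|n IH]; [simpl; module|].
  change (vsum x (S (S n))) with (vsum x (S n) ⊕ x (S n)). rewrite IH. simpl. module.
Qed.

Lemma vsum_vadd (x y : nat -> V) n :
  vsum (fun k => x k ⊕ y k) n = vsum x n ⊕ vsum y n.
Proof. induction n as [|n IH]; simpl; [module|]. rewrite IH. module. Qed.

Lemma vsum_vscal r (x : nat -> V) n : vsum (fun k => r ⊙ x k) n = r ⊙ vsum x n.
Proof. induction n as [|n IH]; simpl; [module|]. rewrite IH. module. Qed.

Lemma norm_vsum_le (x : nat -> V) n c :
  (forall k, (k < n)%nat -> norm (x k) <= c) -> norm (vsum x n) <= INR n * c.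
Proof.
  intros H. induction n as [|n IH].
  - simpl. rewrite norm_vzero. lra.
  - rewrite S_INR. simpl. eapply Rle_trans; [apply norm_vadd|].
    assert (norm (vsum x n) <= INR n * c) by (apply IH; intros; apply H; lia).
    assert (norm (x n) <= c) by (apply H; lia). lra.
Qed.

Lemma tends_vsum {T} {F : (T -> Prop) -> Prop} {FF : Filter F}
    (f : nat -> T -> V) (l : nat -> V) n :
  (forall k, (k < n)%nat -> tends (f k) F (l k)) ->
  tends (fun p => vsum (fun k => f k p) n) F (vsum l n).
Proof.
  intros H. induction n as [|n IH]; simpl; [apply tends_const|].
  apply tends_vadd; [apply IH; intros; apply H; lia|apply H; lia].
Qed.

Lemma is_RInt_vadd (f g : R -> V) a b lf lg :
  is_RInt f a b lf -> is_RInt g a b lg -> is_RInt (fun s => f s ⊕ g s) a b (lf ⊕ lg).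
Proof. apply is_RInt_plus. Qed.

Lemma is_RInt_vsum (f : nat -> R -> V) (l : nat -> V) a b n :
  (forall k, (k < n)%nat -> is_RInt (f k) a b (l k)) ->
  is_RInt (fun s => vsum (fun k => f k s) n) a b (vsum l n).
Proof.
  intros H. induction n as [|n IH]; simpl.
  - assert (K := is_RInt_const a b (vzero : V)).
    change (is_RInt (fun _ => vzero) a b ((b - a) ⊙ (vzero : V))) in K.
    replace ((b - a) ⊙ vzero) with (vzero : V) in K by module. exact K.
  - apply is_RInt_vadd; [apply IH; intros; apply H; lia|apply H; lia].
Qed.
End FiniteSums.

Lemma is_linear_vsum {V W : NormedModule R_AbsRing} (L : nat -> V -> W) n :
  (forall k, (k < n)%nat -> is_linear (L k)) -> is_linear (fun u => vsum (fun k => L k u) n).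
Proof.
  intros H. induction n as [|n IH]; simpl.
  - apply (@is_linear_zero R_AbsRing V W).
  - assert (H1 : is_linear (fun u => vsum (fun k => L k u) n)) by (apply IH; auto).
    assert (H2 : is_linear (L n)) by auto.
    constructor.
    + intros x y. change (plus x y) with (x ⊕ y).
      change (vsum (fun k => L k (x ⊕ y)) n ⊕ L n (x ⊕ y) =
        vsum (fun k => L k x) n ⊕ L n x ⊕ (vsum (fun k => L k y) n ⊕ L n y)).
      rewrite (linear_vadd H2). assert (E := linear_vadd H1 x y). cbv beta in E.
      rewrite E. module.
    + intros r x. change (vsum (fun k => L k (r ⊙ x)) n ⊕ L n (r ⊙ x) =
        r ⊙ (vsum (fun k => L k x) n ⊕ L n x)).
      rewrite (linear_vscal H2). assert (E := linear_vscal H1 r x). cbv beta in E.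
      rewrite E. module.
    + destruct (linear_norm _ H1) as (C1 & P1 & K1).
      destruct (linear_norm _ H2) as (C2 & P2 & K2).
      exists (C1 + C2). split; [lra|]. intros x.
      eapply Rle_trans; [apply norm_vadd|]. rewrite Rmult_plus_distr_r.
      apply Rplus_le_compat; auto.
Qed.

(** * Dyson-Phillips iterates *)

Section DysonPhillips.
Context {X : AbstractStateSpace} {Psi : X -> R} (hPsi : is_norm_functional Psi).
Context {U : R -> X -> X} (hU : is_substochastic U).
Context {M : R} (HM : decomposition_bound (X := X) M).
Context {B : X -> X} (hB : is_positive_linear_on (dom (generator U)) B).
Context (hAB : forall u, dom (generator U) u -> cone u ->
       Psi (plus (generator U u) (B u)) <= 0).
Context {Vn : nat -> R -> X -> X} (hVn : is_dyson_phillips U B Vn).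
Implicit Types u v w : X.

Notation A := (generator U).
Notation D := (dom (generator U)).

Lemma B_vadd u v : D u -> D v -> B (u ⊕ v) = B u ⊕ B v.
Proof. intros Hu Hv. exact (pl_plus hB u v Hu Hv). Qed.

Lemma B_vscal r u : D u -> B (r ⊙ u) = r ⊙ B u.
Proof. intros Hu. exact (pl_scal hB r u Hu). Qed.

Lemma B_vsub u v : D u -> D v -> B (u ⊖ v) = B u ⊖ B v.
Proof.
  intros Hu Hv. replace (u ⊖ v) with (u ⊕ (-1) ⊙ v) by module.
  rewrite B_vadd, B_vscal; auto; [module|]. now apply (generator_vscal hU).
Qed.

Lemma cone_B u : D u -> cone u -> cone (B u).
Proof. apply (pl_positive hB). Qed.

Lemma Psi_B_le u : D u -> cone u -> Psi (B u) <= - Psi (A u).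
Proof.
  intros Hu Hc. assert (K : Psi (A u ⊕ B u) <= 0) by exact (hAB u Hu Hc).
  rewrite (Psi_vadd hPsi) in K. lra.
Qed.

(** Time averages of the orbit lie in the domain and keep positivity, so inequalities on positive
    vectors of the domain extend to the cone. *)
Lemma dom_dense u : exists f : R -> X, tends f (at_right 0) u /\
  forall h, 0 < h -> D (f h) /\ (cone u -> cone (f h)).
Proof.
  exists (fun h => / h ⊙ RInt (fun s => U s u) 0 h). split.
  { apply (sgr_RInt_average hU HM). }
  intros h Hh. split.
  - apply (generator_vscal hU), (generator_RInt hU HM). lra.
  - intros Hu. apply cone_vscal; [left; now apply Rinv_0_lt_compat|].
    apply (cone_sgr_RInt hU HM); auto; lra.
Qed.

Lemma linear_eq_of_dom (L L' : X -> X) : is_linear L -> is_linear L' ->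
  (forall u, D u -> L u = L' u) -> forall u, L u = L' u.
Proof.
  intros HL HL' H u. destruct (dom_dense u) as (f & Hf & Hd).
  apply (tends_unique (F := at_right 0) (f := fun h => L (f h))).
  - now apply tends_linear.
  - apply tends_ext_loc with (f := fun h => L' (f h)).
    + apply at_right_0_iff. exists 1. split; [lra|]. intros h Hh.
      symmetry. apply H, Hd. lra.
    + now apply tends_linear.
Qed.

Lemma dp_linear n {t} : 0 <= t -> is_linear (Vn n t).
Proof. apply (dp_bounded hVn). Qed.

Lemma cone_dp n t u : 0 <= t -> cone u -> cone (Vn n t u).
Proof.
  revert t u. induction n as [|n IH]; intros t u Ht Hu.
  - rewrite (dp_zero hVn) by auto. now apply (cone_sgr hU).
  - destruct (dom_dense u) as (f & Hf & Hd).
    apply (cone_tends (F := at_right 0) (f := fun h => Vn (S n) t (f h))).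
    2: now apply tends_linear; [apply dp_linear|].
    apply at_right_0_iff. exists 1. split; [lra|]. intros h Hh.
    destruct (Hd h ltac:(lra)) as [Df Cf].
    apply (cone_RInt (f := fun s => Vn n (t - s) (B (U s (f h)))) (a := 0) (b := t)); auto.
    2: exact (dp_succ hVn n Ht Df).
    intros s Hs. apply IH; [lra|]. apply cone_B.
    + apply (generator_sgr hU); auto; lra.
    + apply (cone_sgr hU); auto; lra.
Qed.

Definition dp_sum (N : nat) (t : R) u : X := vsum (fun k => Vn k t u) N.

Lemma dp_sum_linear N {t} : 0 <= t -> is_linear (dp_sum N t).
Proof. intros Ht. apply is_linear_vsum. intros k _. now apply dp_linear. Qed.

Lemma cone_dp_sum N t u : 0 <= t -> cone u -> cone (dp_sum N t u).
Proof.
  intros Ht Hu. unfold dp_sum. induction N as [|N IH]; simpl; [apply cone_vzero|].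
  apply cone_vadd; auto. now apply cone_dp.
Qed.

Lemma dp_sum_Duhamel N t u : 0 <= t -> D u ->
  is_RInt (fun s => dp_sum N (t - s) (B (U s u))) 0 t (dp_sum (S N) t u ⊖ U t u).
Proof.
  intros Ht Hu. unfold dp_sum. rewrite vsum_head, (dp_zero hVn) by auto.
  replace (U t u ⊕ vsum (fun k => Vn (S k) t u) N ⊖ U t u)
    with (vsum (fun k => Vn (S k) t u) N) by module.
  apply (is_RInt_vsum (fun k s => Vn k (t - s) (B (U s u)))).
  intros k _. exact (dp_succ hVn k Ht Hu).
Qed.

(** Induction on [N] through the Duhamel identity: the integrand has mass at most Psi(B U(s)u),
    itself at most -Psi(A U(s)u). This is minus the derivative of Psi(U(s)u) and integrates to
    Psi(u) - Psi(U(t)u). *)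
Lemma Psi_dp_sum_le N t u : 0 <= t -> cone u -> Psi (dp_sum N t u) <= Psi u.
Proof.
  revert t u. induction N as [|N IH]; intros t u Ht Hu.
  { unfold dp_sum. simpl. rewrite (Psi_vzero hPsi). now apply (Psi_ge_0 hPsi). }
  destruct (dom_dense u) as (f & Hf & Hd).
  apply (tends_le (F := at_right 0) (f := fun h => Psi (dp_sum (S N) t (f h)))
    (g := fun h => Psi (f h))).
  2: apply (tends_Psi hPsi (F := at_right 0)), tends_linear; [now apply dp_sum_linear|exact Hf].
  2: now apply (tends_Psi hPsi (F := at_right 0)).
  apply at_right_0_iff. exists 1. split; [lra|]. intros h Hh.
  destruct (Hd h ltac:(lra)) as [Df Cf]. specialize (Cf Hu).
  generalize (f h) Df Cf. clear - IH Ht hPsi hU HM hB hAB hVn. intros u Du Cu.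
  assert (K1 : is_RInt (fun s => Psi (dp_sum N (t - s) (B (U s u)))) 0 t
    (Psi (dp_sum (S N) t u ⊖ U t u))).
  { apply (is_RInt_linear (Psi_linear hPsi)). now apply dp_sum_Duhamel. }
  assert (E : RInt (fun s => U s (A u)) 0 t = U t u ⊖ u).
  { assert (E := rderiv_is_RInt (f := fun s => U s u) (g := fun s => U s (A u)) Ht
      (sgr_hcont hU HM u) (sgr_hcont hU HM (A u))). cbv beta in E.
    rewrite (sg_zero (sub_C0 hU)) in E. apply E.
    intros s Hs. apply (generator_rderiv hU); auto; lra. }
  assert (K2 : is_RInt (fun s => - 1 * Psi (U s (A u))) 0 t (- 1 * Psi (U t u ⊖ u))).
  { apply (is_RInt_scal (V := R_NormedModule) (fun s => Psi (U s (A u)))).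
    apply (is_RInt_linear (Psi_linear hPsi)). rewrite <- E.
    apply hcont_is_RInt; [lra|apply (sgr_hcont hU HM)]. }
  assert (K := is_RInt_le _ _ _ _ _ _ Ht K1 K2).
  rewrite !(Psi_vsub hPsi) in K.
  assert (H : Psi (dp_sum (S N) t u) - Psi (U t u) <= - 1 * (Psi (U t u) - Psi u)); [|lra].
  apply K. intros s Hs.
  destruct (generator_sgr hU Du (t := s) ltac:(lra)) as [Ds Es].
  assert (Cs : cone (U s u)) by (apply (cone_sgr hU); auto; lra).
  eapply Rle_trans; [apply IH; [lra|now apply cone_B]|].
  rewrite <- Es. generalize (Psi_B_le (U s u) Ds Cs). lra.
Qed.

Lemma norm_dp_sum N t u : 0 <= t -> norm (dp_sum N t u) <= M * norm u.
Proof.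
  intros Ht. rewrite <- (Rmult_1_l M). apply (norm_le_of_cone _ _ _ HM); [lra| |].
  - intros; apply linear_vsub, dp_sum_linear, Ht.
  - intros v Hv. rewrite Rmult_1_l, <- !(Psi_norm hPsi); auto.
    + now apply Psi_dp_sum_le.
    + now apply cone_dp_sum.
Qed.

Lemma Psi_dp_le n t u : 0 <= t -> cone u -> Psi (Vn n t u) <= Psi u.
Proof.
  intros Ht Hu. assert (K := Psi_dp_sum_le (S n) t u Ht Hu).
  unfold dp_sum in K. simpl in K. rewrite (Psi_vadd hPsi) in K.
  assert (K2 := Psi_ge_0 hPsi _ (cone_dp_sum n t u Ht Hu)). unfold dp_sum in K2. lra.
Qed.

Lemma norm_dp n t u : 0 <= t -> norm (Vn n t u) <= M * norm u.
Proof.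
  intros Ht. rewrite <- (Rmult_1_l M). apply (norm_le_of_cone _ _ _ HM); [lra| |].
  - intros; apply linear_vsub, dp_linear, Ht.
  - intros v Hv. rewrite Rmult_1_l, <- !(Psi_norm hPsi); auto.
    + now apply Psi_dp_le.
    + now apply cone_dp.
Qed.

Lemma hcont_small (f : R -> X) eps : hcont f -> 0 < eps ->
  exists d, 0 < d /\ forall h, 0 <= h < d -> norm (f h ⊖ f 0) < eps.
Proof.
  intros Hf He. assert (K := proj1 (tends_norm_iff _ _) (hcont_right (Rle_refl 0) Hf) eps He).
  apply at_right_0_iff in K. destruct K as (d & Hd & K). exists d. split; auto.
  intros h Hh. destruct (Req_dec h 0) as [->|Hn].
  - now rewrite norm_vsub_diag.
  - replace h with (0 + h) by ring. apply K. lra.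
Qed.

(* The mass of [U h u] controls everything outside of the first iterate,
   because the iterates share the mass of [u]. *)
Lemma dp_sum_small u eps : 0 < eps -> exists d, 0 < d /\ forall h N, 0 <= h < d ->
  norm (dp_sum (S N) h u ⊖ u) <= eps /\ norm (Vn (S N) h u) <= eps.
Proof.
  assert (Hcone : forall u eps, cone u -> 0 < eps -> exists d, 0 < d /\ forall h N, 0 <= h < d ->
    norm (dp_sum (S N) h u ⊖ u) <= eps /\ norm (Vn (S N) h u) <= eps).
  { clear u eps. intros u eps Hu He.
    destruct (hcont_small (fun s => U s u) (eps / 2) (sgr_hcont hU HM u) ltac:(lra))
      as (d & Hd & K).
    exists d. split; auto. intros h N Hh. specialize (K h Hh).
    rewrite (sg_zero (sub_C0 hU)) in K.
    assert (C : forall N, cone (vsum (fun k => Vn (S k) h u) N)).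
    { intros m. induction m; simpl; [apply cone_vzero|]. apply cone_vadd; auto.
      apply cone_dp; auto; lra. }
    assert (P : forall N, norm (vsum (fun k => Vn (S k) h u) N) <= eps / 2).
    { intros m. rewrite <- (Psi_norm hPsi) by auto.
      assert (K2 := Psi_dp_sum_le (S m) h u ltac:(lra) Hu). unfold dp_sum in K2.
      rewrite vsum_head, (Psi_vadd hPsi), (dp_zero hVn) in K2 by lra.
      assert (K3 := norm_triangle_inv u (U h u)).
      rewrite <- !(Psi_norm hPsi) in K3 by (auto; apply (cone_sgr hU); auto; lra).
      change (Rabs (Psi u - Psi (U h u)) <= norm (u ⊖ U h u)) in K3.
      rewrite norm_vsub_sym in K3. generalize (Rle_abs (Psi u - Psi (U h u))). lra. }
    split.
    - unfold dp_sum. rewrite vsum_head, (dp_zero hVn) by lra.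
      replace (U h u ⊕ vsum (fun k => Vn (S k) h u) N ⊖ u) with
        ((U h u ⊖ u) ⊕ vsum (fun k => Vn (S k) h u) N) by module.
      eapply Rle_trans; [apply norm_vadd|]. generalize (P N). lra.
    - assert (K3 : Psi (Vn (S N) h u) <= Psi (vsum (fun k => Vn (S k) h u) (S N))).
      { simpl. rewrite (Psi_vadd hPsi). generalize (Psi_ge_0 hPsi _ (C N)). lra. }
      rewrite !(Psi_norm hPsi) in K3 by (auto; apply cone_dp; auto; lra).
      generalize (P (S N)). lra. }
  intros He. destruct (generating u) as (p & q & Hp & Hq & ->).
  destruct (Hcone p (eps / 2) Hp ltac:(lra)) as (d1 & Hd1 & K1).
  destruct (Hcone q (eps / 2) Hq ltac:(lra)) as (d2 & Hd2 & K2).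
  exists (Rmin d1 d2). split; [now apply Rmin_glb_lt|]. intros h N Hh.
  assert (A1 := Rmin_l d1 d2). assert (A2 := Rmin_r d1 d2).
  destruct (K1 h N ltac:(lra)) as [P1 P2]. destruct (K2 h N ltac:(lra)) as [Q1 Q2].
  rewrite (linear_vsub (dp_sum_linear (S N) (t := h) ltac:(lra))).
  rewrite (linear_vsub (dp_linear (S N) (t := h) ltac:(lra))). split.
  - replace (dp_sum (S N) h p ⊖ dp_sum (S N) h q ⊖ (p ⊖ q)) with
      ((dp_sum (S N) h p ⊖ p) ⊖ (dp_sum (S N) h q ⊖ q)) by module.
    eapply Rle_trans; [apply norm_vsub|]. lra.
  - eapply Rle_trans; [apply norm_vsub|]. lra.
Qed.

(** The recursion over an empty interval gives this on the domain; smallness in mass near time 0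
    covers all vectors. *)
Lemma dp_at_0 n u : Vn (S n) 0 u = vzero.
Proof.
  apply norm_vsub_eq. apply le_epsilon. intros eps He.
  destruct (dp_sum_small u eps He) as (d & Hd & K).
  replace (Vn (S n) 0 u ⊖ vzero) with (Vn (S n) 0 u) by module.
  rewrite Rplus_0_l. apply K. lra.
Qed.

(** [Vn n] plays the part of the coefficient of degree [n] in [B] of a semigroup, whence a Cauchy
    product. The integral in the recursion is split at time [s]: before it the induction hypothesis
    lets [Vn k t] be pulled out, after it what remains is [Vn (S n) t (U s u)]. Density extends the
    identity beyond the domain. *)
Lemma dp_product n t s u : 0 <= t -> 0 <= s ->
  Vn n (t + s) u = vsum (fun k => Vn k t (Vn (n - k) s u)) (S n).
Proof.
  revert t s u. induction n as [|n IH]; intros t s u Ht Hs.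
  { simpl. rewrite !(dp_zero hVn) by lra. rewrite (sgr_plus hU) by auto. module. }
  revert u. apply linear_eq_of_dom.
  { apply dp_linear. lra. }
  { apply (is_linear_vsum (fun k u => Vn k t (Vn (S n - k) s u))). intros k _.
    apply (is_linear_comp (Vn (S n - k) s) (Vn k t)); now apply dp_linear. }
  intros u Du.
  assert (K1 : is_RInt (fun r => Vn n (t + s - r) (B (U r u))) 0 s
    (vsum (fun k => Vn k t (Vn (S (n - k)) s u)) (S n))).
  { apply (is_RInt_ext (fun r => vsum (fun k => Vn k t (Vn (n - k) (s - r) (B (U r u)))) (S n))).
    - rewrite Rmin_left, Rmax_right by lra. intros r Hr.
      rewrite <- IH by lra. f_equal. ring.
    - apply (is_RInt_vsum (fun k r => Vn k t (Vn (n - k) (s - r) (B (U r u))))).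
      intros k _. apply (is_RInt_linear (L := Vn k t)); [now apply dp_linear|].
      exact (dp_succ hVn (n - k) Hs Du). }
  assert (K2 : is_RInt (fun r => Vn n (t + s - r) (B (U r u))) s (t + s)
    (Vn (S n) t (U s u))).
  { assert (K := dp_succ hVn n Ht (proj1 (generator_sgr hU Du Hs))).
    apply (is_RInt_ext (fun r => Vn n (t - (r + - s)) (B (U (r + - s) (U s u))))).
    - rewrite Rmin_left, Rmax_right by lra. intros r Hr.
      rewrite <- (sgr_plus hU) by lra. f_equal; [ring|]. do 2 f_equal. ring.
    - apply (is_RInt_shift (f := fun r => Vn n (t - r) (B (U r (U s u))))).
      replace (s + - s) with 0 by ring. replace (t + s + - s) with t by ring. exact K. }
  assert (K3 := dp_succ hVn n (t := t + s) ltac:(lra) Du).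
  assert (K4 := is_RInt_Chasles _ _ _ _ _ _ K1 K2).
  rewrite <- (is_RInt_unique _ _ _ _ K3), (is_RInt_unique _ _ _ _ K4).
  change (vsum (fun k => Vn k t (Vn (S n - k) s u)) (S (S n))) with
    (vsum (fun k => Vn k t (Vn (S n - k) s u)) (S n) ⊕ Vn (S n) t (Vn (S n - S n) s u)).
  rewrite Nat.sub_diag, (dp_zero hVn) by auto.
  rewrite (vsum_ext (fun k => Vn k t (Vn (S n - k) s u)) (fun k => Vn k t (Vn (S (n - k)) s u))).
  - reflexivity.
  - intros k Hk. do 2 f_equal. lia.
Qed.

(** In the product expansion of [Vn n (s + h) u] each term but the last contains an iterate of
    positive index at time [h], small uniformly in [s]; the last term is close to [Vn n s u]. *)
Lemma dp_hcont n u : hcont (fun t => Vn n t u).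
Proof.
  apply hcont_modulus. intros eps He.
  assert (HM1 : 1 <= M) by apply HM. assert (Hn := pos_INR n).
  (* There are n + 1 error terms of size at most [M * e], together [eps / 2]. *)
  set (e := eps / (2 * M * (INR n + 1))).
  assert (He' : 0 < e) by (apply Rdiv_lt_0_compat; auto; nra).
  destruct (dp_sum_small u e He') as (d & Hd & K).
  exists d. split; auto. intros s h Hs Hh.
  rewrite dp_product by lra. simpl. rewrite Nat.sub_diag, (dp_zero hVn) by lra.
  replace (vsum (fun k => Vn k s (Vn (n - k) h u)) n ⊕ Vn n s (U h u) ⊖ Vn n s u)
    with (vsum (fun k => Vn k s (Vn (n - k) h u)) n ⊕ Vn n s (U h u ⊖ u))
    by (rewrite (linear_vsub (dp_linear n Hs)); module).
  assert (K1 : norm (vsum (fun k => Vn k s (Vn (n - k) h u)) n) <= INR n * (M * e)).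
  { apply norm_vsum_le. intros k Hk. eapply Rle_trans; [now apply norm_dp|].
    apply Rmult_le_compat_l; [lra|]. replace (n - k)%nat with (S (n - k - 1)) by lia.
    apply K. lra. }
  assert (K2 : norm (Vn n s (U h u ⊖ u)) <= M * e).
  { eapply Rle_trans; [now apply norm_dp|]. apply Rmult_le_compat_l; [lra|].
    destruct (K h 0%nat ltac:(lra)) as [K2 _]. unfold dp_sum in K2. simpl in K2.
    rewrite (dp_zero hVn) in K2 by lra.
    replace (vzero ⊕ U h u ⊖ u) with (U h u ⊖ u) in K2 by module. exact K2. }
  eapply Rle_lt_trans; [apply norm_vadd|].
  assert (E : (INR n + 1) * (M * e) = eps / 2) by (unfold e; field; lra). lra.
Qed.

(** With R the resolvent, this operator does not increase mass on the cone: Psi(B R u) <= -Psi(A R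
    u) = Psi(u) - lam Psi(R u). *)
Lemma B_resolvent_linear {lam} : 0 < lam -> is_linear (fun u => B (resolvent A lam u)).
Proof.
  intros Hl. assert (HR := resolvent_linear hPsi hU HM Hl).
  assert (HD := dom_resolvent hPsi hU HM Hl).
  apply (is_linear_of_cone _ 1); [lra| | |].
  - intros u v. rewrite (linear_vadd HR). now apply B_vadd.
  - intros r u. rewrite (linear_vscal HR). now apply B_vscal.
  - intros u Hu. assert (HC := cone_resolvent hPsi hU HM Hl Hu).
    rewrite Rmult_1_l, <- !(Psi_norm hPsi) by (auto; now apply cone_B).
    assert (K := Psi_B_le _ (HD u) HC).
    rewrite (generator_resolvent hPsi hU HM Hl), (Psi_vsub hPsi), (Psi_vscal hPsi) in K.
    assert (0 <= lam * Psi (resolvent A lam u)); [|lra].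
    apply Rmult_le_pos; [lra|]. now apply (Psi_ge_0 hPsi).
Qed.

(** Factors [B] through a bounded operator and 1 - A, so that limits pass through [B] as soon as [u]
    and [A u] converge together; the spectral parameter 1 is arbitrary. *)
Lemma B_eq_resolvent u : D u -> B u = B (resolvent A 1 (1 ⊙ u ⊖ A u)).
Proof. intros Hu. now rewrite (resolvent_generator hU HM Rlt_0_1). Qed.

Lemma B_sgr_hcont u : D u -> hcont (fun s => B (U s u)).
Proof.
  intros Hu t.
  apply (continuous_ext (fun s => B (resolvent A 1 (U (Rabs s) (1 ⊙ u ⊖ A u))))).
  - intros s. destruct (generator_sgr hU Hu (Rabs_pos s)) as [Ds Es].
    rewrite (B_eq_resolvent (U (Rabs s) u)) by auto. rewrite Es.
    rewrite (linear_vsub (sgr_linear hU (Rabs_pos s))).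
    now rewrite (linear_vscal (sgr_linear hU (Rabs_pos s))).
  - apply (hcont_linear (L := fun u => B (resolvent A 1 u)) (f := fun s => U s (1 ⊙ u ⊖ A u))).
    + apply B_resolvent_linear, Rlt_0_1.
    + apply (sgr_hcont hU HM).
Qed.

(** The Duhamel integrand tends to [B u] as time goes to 0. The radius [d] does not depend on [N],
    which later lets [N] go to infinity at fixed [h]. *)
Lemma dp_sum_average u eps : D u -> 0 < eps -> exists d, 0 < d /\
  forall h N, 0 < h < d ->
    norm (/ h ⊙ (dp_sum (S (S N)) h u ⊖ U h u) ⊖ B u) <= eps.
Proof.
  intros Hu He. assert (HM1 : 1 <= M) by apply HM.
  destruct (dp_sum_small (B u) (eps / 2) ltac:(lra)) as (d1 & Hd1 & K1).
  destruct (hcont_small (fun s => B (U s u)) (eps / (2 * M)) (B_sgr_hcont u Hu))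
    as (d2 & Hd2 & K2).
  { apply Rdiv_lt_0_compat; lra. }
  rewrite (sg_zero (sub_C0 hU)) in K2.
  exists (Rmin d1 d2). split; [now apply Rmin_glb_lt|]. intros h N Hh.
  assert (A1 := Rmin_l d1 d2). assert (A2 := Rmin_r d1 d2).
  apply (RInt_average (f := fun s => dp_sum (S N) (h - s) (B (U s u))) (a := 0)); [lra| |].
  { rewrite Rplus_0_l. apply dp_sum_Duhamel; auto; lra. }
  rewrite Rplus_0_l. intros s Hs.
  destruct (K1 (h - s) N ltac:(lra)) as [P _]. assert (Q := K2 s ltac:(lra)).
  replace (dp_sum (S N) (h - s) (B (U s u)) ⊖ B u) with
    (dp_sum (S N) (h - s) (B (U s u) ⊖ B u) ⊕ (dp_sum (S N) (h - s) (B u) ⊖ B u))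
    by (rewrite (linear_vsub (dp_sum_linear (S N) (t := h - s) ltac:(lra))); module).
  eapply Rle_trans; [apply norm_vadd|].
  assert (K3 := norm_dp_sum (S N) (h - s) (B (U s u) ⊖ B u) ltac:(lra)).
  assert (K4 : M * norm (B (U s u) ⊖ B u) <= M * (eps / (2 * M)))
    by (apply Rmult_le_compat_l; lra).
  replace (M * (eps / (2 * M))) with (eps / 2) in K4 by (field; lra). lra.
Qed.

(** Consecutive partial sums with at least two terms share the contribution [B u], so their
    difference, an iterate of index at least 2, has derivative zero. *)
Lemma dp_right_derivative_0 k u : D u ->
  tends (fun h => / h ⊙ Vn (S k) h u) (at_right 0) (match k with O => B u | S _ => vzero end).
Proof.
  intros Hu. apply tends_norm_iff. intros eps He. apply at_right_0_iff.
  destruct (dp_sum_average u (eps / 3) Hu ltac:(lra)) as (d & Hd & K).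
  exists d. split; auto. intros h Hh.
  assert (K0 := K h k Hh). unfold dp_sum in K0.
  destruct k as [|k].
  - simpl in K0. rewrite (dp_zero hVn) in K0 by lra.
    replace (vzero ⊕ U h u ⊕ Vn 1 h u ⊖ U h u) with (Vn 1 h u) in K0 by module. lra.
  - assert (K1 := K h k Hh). unfold dp_sum in K1.
    change (vsum (fun k => Vn k h u) (S (S (S k)))) with
      (vsum (fun k => Vn k h u) (S (S k)) ⊕ Vn (S (S k)) h u) in K0.
    replace (/ h ⊙ Vn (S (S k)) h u ⊖ vzero) with
      ((/ h ⊙ (vsum (fun k => Vn k h u) (S (S k)) ⊕ Vn (S (S k)) h u ⊖ U h u) ⊖ B u)
       ⊖ (/ h ⊙ (vsum (fun k => Vn k h u) (S (S k)) ⊖ U h u) ⊖ B u)) by module.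
    eapply Rle_lt_trans; [apply norm_vsub|]. lra.
Qed.

(** * Time integrals of the iterates *)

Definition dp_int n t u : X := RInt (fun s => Vn n s u) 0 t.

Lemma is_RInt_dp n u a b : 0 <= a <= b ->
  is_RInt (fun s => Vn n s u) a b (RInt (fun s => Vn n s u) a b).
Proof. intros H. apply hcont_is_RInt; auto. apply dp_hcont. Qed.

Lemma cone_dp_int n t u : 0 <= t -> cone u -> cone (dp_int n t u).
Proof.
  intros Ht Hu. apply (cone_RInt (f := fun s => Vn n s u) (a := 0) (b := t)); auto.
  - intros s Hs. apply cone_dp; auto; lra.
  - apply is_RInt_dp. lra.
Qed.

Lemma dp_int_vsub n t u v : 0 <= t -> dp_int n t (u ⊖ v) = dp_int n t u ⊖ dp_int n t v.
Proof.
  intros Ht. apply is_RInt_unique.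
  apply (is_RInt_ext (fun s => Vn n s u ⊖ Vn n s v)).
  - rewrite Rmin_left, Rmax_right by lra. intros s Hs.
    symmetry. apply linear_vsub, dp_linear. lra.
  - apply (is_RInt_minus (fun s => Vn n s u) (fun s => Vn n s v)); apply is_RInt_dp; lra.
Qed.

(* [(U h - 1) S_n] is computed from [V_n (s + h)], expanded by the product
   formula: only the terms with at most one factor [B] survive division by [h]. *)
Lemma generator_dp_int n t v : 0 <= t ->
  D (dp_int n t v) /\
  A (dp_int n t v) = Vn n t v ⊖ match n with O => v | S m => B (dp_int m t v) end.
Proof.
  (* Strong induction: the limit of the k-th term requires [dp_int (n - S k) t v] to be in the
     domain already. *)
  intros Ht. revert n. apply (well_founded_ind Nat.lt_wf_0). intros n IH.
  assert (Hc := dp_hcont n v).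
  assert (E : forall h, 0 < h -> RInt (fun s => Vn n s v) h (t + h) =
    U h (dp_int n t v) ⊕ vsum (fun k => Vn (S k) h (dp_int (n - S k) t v)) n).
  { intros h Hh.
    transitivity (vsum (fun k => Vn k h (dp_int (n - k) t v)) (S n)).
    2: now rewrite vsum_head, Nat.sub_0_r, (dp_zero hVn) by lra.
    transitivity (RInt (fun s => Vn n (s + h) v) 0 t).
    - symmetry. apply (is_RInt_unique (fun s => Vn n (s + h) v)).
      apply (is_RInt_shift (f := fun s => Vn n s v)). rewrite Rplus_0_l.
      apply is_RInt_dp. lra.
    - apply is_RInt_unique.
      apply (is_RInt_ext (fun s => vsum (fun k => Vn k h (Vn (n - k) s v)) (S n))).
      + rewrite Rmin_left, Rmax_right by lra. intros s Hs.
        rewrite <- dp_product by lra. f_equal. ring.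
      + apply (is_RInt_vsum (fun k s => Vn k h (Vn (n - k) s v))).
        intros k _. apply (is_RInt_linear (L := Vn k h)); [apply dp_linear; lra|].
        apply is_RInt_dp. lra. }
  (* Limits of the quotients of [Vn (S k) h]: one factor [B] survives at k = 0, the others
     vanish. *)
  set (b := fun k => match k with O => B (dp_int (n - 1) t v) | S _ => vzero end).
  assert (Eb : Vn n t v ⊖ match n with O => v | S m => B (dp_int m t v) end =
    Vn n t v ⊖ Vn n 0 v ⊖ vsum b n).
  { destruct n as [|m].
    - rewrite !(dp_zero hVn), (sg_zero (sub_C0 hU)) by lra. simpl. module.
    - rewrite dp_at_0, vsum_head.
      replace (vsum (fun k => b (S k)) m) with (vzero : X).
      + unfold b. simpl. rewrite Nat.sub_0_r. module.
      + clear. induction m as [|m IH]; simpl; [reflexivity|]. rewrite <- IH. module. }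
  rewrite Eb. apply (generator_value (T := U)).
  eapply tends_ext_loc.
  2: { apply tends_vsub.
       - apply tends_vsub; [exact (rderiv_RInt Ht Hc)|exact (rderiv_RInt (Rle_refl 0) Hc)].
       - apply (tends_vsum (fun k h => / h ⊙ Vn (S k) h (dp_int (n - S k) t v)) b).
         intros k Hk. destruct (IH (n - S k)%nat ltac:(lia)) as [Dk _].
         assert (K := dp_right_derivative_0 k _ Dk). unfold b.
         destruct k; exact K. }
  apply at_right_0_iff. exists 1. split; [lra|]. intros h Hh. cbv beta.
  rewrite RInt_point, Rplus_0_l, vsum_vscal.
  assert (E0 := E h ltac:(lra)).
  assert (C1 := @hcont_RInt_Chasles X (fun s => Vn n s v) 0 t (t + h) ltac:(lra) ltac:(lra) Hc).
  assert (C2 := @hcont_RInt_Chasles X (fun s => Vn n s v) 0 h (t + h) ltac:(lra) ltac:(lra) Hc).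
  rewrite <- C2, E0. unfold dp_int at 1 4 5. module.
Qed.

Lemma cone_vsum_vsub (x y : nat -> X) n :
  (forall k, (k < n)%nat -> cone (x k ⊖ y k)) -> cone (vsum x n ⊖ vsum y n).
Proof.
  intros H. induction n as [|n IH]; simpl.
  - replace (vzero ⊖ vzero) with (vzero : X) by module. apply cone_vzero.
  - replace (vsum x n ⊕ x n ⊖ (vsum y n ⊕ y n)) with
      ((vsum x n ⊖ vsum y n) ⊕ (x n ⊖ y n)) by module.
    apply cone_vadd; [apply IH; intros; apply H; lia|apply H; lia].
Qed.

Lemma dp_sum_vsub N {t} u v : 0 <= t -> dp_sum N t (u ⊖ v) = dp_sum N t u ⊖ dp_sum N t v.
Proof. intros Ht. apply linear_vsub. now apply dp_sum_linear. Qed.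

Lemma dp_vsub n {t} u v : 0 <= t -> Vn n t (u ⊖ v) = Vn n t u ⊖ Vn n t v.
Proof. intros Ht. apply linear_vsub. now apply dp_linear. Qed.

Lemma dp_sum_S N t u : dp_sum (S N) t u = dp_sum N t u ⊕ Vn N t u.
Proof. reflexivity. Qed.

(** * The semigroup defined by the Dyson-Phillips series *)

Definition dp_semigroup (t : R) u : X :=
  iota (fun l => tends (fun N => dp_sum N t u) eventually l).

Lemma dp_sum_converges t u : 0 <= t -> cone u -> exists l,
  tends (fun N => dp_sum N t u) eventually l /\ forall N, cone (l ⊖ dp_sum N t u).
Proof.
  intros Ht Hu.
  apply (increasing_bounded_tends hPsi (fun N => dp_sum N t u) (Psi u)).
  - intros N. rewrite dp_sum_S.
    replace (dp_sum N t u ⊕ Vn N t u ⊖ dp_sum N t u) with (Vn N t u) by module.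
    now apply cone_dp.
  - intros N. now apply Psi_dp_sum_le.
Qed.

Lemma dp_semigroup_tends t u : 0 <= t ->
  tends (fun N => dp_sum N t u) eventually (dp_semigroup t u).
Proof.
  intros Ht.
  assert (K : exists l, tends (fun N => dp_sum N t u) eventually l).
  { destruct (generating u) as (p & q & Hp & Hq & ->).
    destruct (dp_sum_converges t p Ht Hp) as (lp & Lp & _).
    destruct (dp_sum_converges t q Ht Hq) as (lq & Lq & _).
    exists (lp ⊖ lq). eapply tends_ext; [|apply (tends_vsub Lp Lq)].
    intros N. simpl. now rewrite dp_sum_vsub. }
  destruct K as [l Hl].
  replace (dp_semigroup t u) with l; auto. symmetry.
  exact (iota_filterlim_locally (F := eventually) (fun N => dp_sum N t u) l Hl).
Qed.

Lemma cone_dp_semigroup_vsub N t u : 0 <= t -> cone u ->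
  cone (dp_semigroup t u ⊖ dp_sum N t u).
Proof.
  intros Ht Hu. destruct (dp_sum_converges t u Ht Hu) as (l & Hl & Hi).
  rewrite (tends_unique (F := eventually) (dp_semigroup_tends t u Ht) Hl). apply Hi.
Qed.

Lemma cone_dp_semigroup t u : 0 <= t -> cone u -> cone (dp_semigroup t u).
Proof.
  intros Ht Hu. assert (K := cone_dp_semigroup_vsub 0 t u Ht Hu).
  unfold dp_sum in K. simpl in K.
  replace (dp_semigroup t u ⊖ vzero) with (dp_semigroup t u) in K by module. exact K.
Qed.

Lemma Psi_dp_semigroup t u : 0 <= t -> cone u -> Psi (dp_semigroup t u) <= Psi u.
Proof.
  intros Ht Hu.
  apply (tends_le (F := eventually) (f := fun N => Psi (dp_sum N t u)) (g := fun _ => Psi u)).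
  - apply filter_forall. intros N. now apply Psi_dp_sum_le.
  - exact (tends_Psi hPsi (dp_semigroup_tends t u Ht)).
  - apply tends_const.
Qed.

Lemma dp_semigroup_linear {t} : 0 <= t -> is_linear (dp_semigroup t).
Proof.
  intros Ht. apply (is_linear_of_cone _ 1); [lra| | |].
  - intros u v. apply (tends_unique (F := eventually) (dp_semigroup_tends t (u ⊕ v) Ht)).
    eapply tends_ext;
      [|apply (tends_vadd (dp_semigroup_tends t u Ht) (dp_semigroup_tends t v Ht))].
    intros N. simpl. symmetry. apply linear_vadd. now apply dp_sum_linear.
  - intros r u. apply (tends_unique (F := eventually) (dp_semigroup_tends t (r ⊙ u) Ht)).
    eapply tends_ext; [|apply (tends_vscal_r r (dp_semigroup_tends t u Ht))].
    intros N. simpl. symmetry. apply linear_vscal. now apply dp_sum_linear.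
  - intros u Hu. rewrite Rmult_1_l, <- !(Psi_norm hPsi); auto.
    + now apply Psi_dp_semigroup.
    + now apply cone_dp_semigroup.
Qed.

(** A Cauchy product, squeezed in the order between [dp_sum a t (x m)], where a + m <= N, and
    [dp_semigroup t l]; [Psi] measures the gap. It yields the semigroup law with [x] the partial
    sums at time [s], and the resolvent with [x] the Neumann sums. *)
Lemma dp_convolution_tends t (x : nat -> X) l : 0 <= t ->
  (forall n, cone (x n)) -> (forall n, cone (x (S n) ⊖ x n)) -> tends x eventually l ->
  tends (fun N => vsum (fun k => Vn k t (x (N - k)%nat)) N) eventually (dp_semigroup t l).
Proof.
  intros Ht Hx Hi Hl. assert (Hm := increasing_cone Hi).
  assert (Hlx : forall n, cone (l ⊖ x n)).
  { intros n. apply (cone_tends (F := eventually) (f := fun m => x m ⊖ x n)).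
    - exists n. intros m H. now apply Hm.
    - apply tends_vsub; auto. apply tends_const. }
  assert (Cl : cone l).
  { apply (cone_tends (F := eventually) (f := x)); auto. now apply filter_forall. }
  assert (Hup : forall N, cone (dp_semigroup t l ⊖ vsum (fun k => Vn k t (x (N - k)%nat)) N)).
  { intros N. apply (cone_trans (dp_sum N t l)); [now apply cone_dp_semigroup_vsub|].
    apply (cone_vsum_vsub (fun k => Vn k t l)). intros k _.
    rewrite <- dp_vsub by auto. now apply cone_dp. }
  assert (Hlow : forall a m N, (a + m <= N)%nat ->
    cone (vsum (fun k => Vn k t (x (N - k)%nat)) N ⊖ dp_sum a t (x m))).
  { intros a m N HN.
    apply (cone_trans (vsum (fun k => Vn k t (x (N - k)%nat)) a)).
    - apply (increasing_cone (x := fun n => vsum (fun k => Vn k t (x (N - k)%nat)) n)); [|lia].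
      intros n. simpl.
      match goal with |- cone (?p ⊕ ?q ⊖ ?p) => replace (p ⊕ q ⊖ p) with q by module end.
      now apply cone_dp.
    - apply cone_vsum_vsub. intros k Hk. rewrite <- dp_vsub by auto.
      apply cone_dp; auto. apply Hm. lia. }
  apply tends_norm_iff. intros eps He.
  (* Half of the tolerance pays for truncating the series at [a], half for replacing [l] by
     [x m]. *)
  assert (T1 := tends_Psi hPsi (dp_semigroup_tends t l Ht)).
  apply (tends_norm_iff (V := R_NormedModule)) with (eps := eps / 2) in T1; [|lra].
  destruct T1 as [a Ha]. specialize (Ha a (le_n a)).
  change (Rabs (Psi (dp_sum a t l) - Psi (dp_semigroup t l)) < eps / 2) in Ha.
  apply Rabs_def2 in Ha.
  assert (T2 := tends_Psi hPsi Hl).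
  apply (tends_norm_iff (V := R_NormedModule)) with (eps := eps / 2) in T2; [|lra].
  destruct T2 as [m Hm2]. specialize (Hm2 m (le_n m)).
  change (Rabs (Psi (x m) - Psi l) < eps / 2) in Hm2. apply Rabs_def2 in Hm2.
  exists (a + m)%nat. intros N HN. rewrite norm_vsub_sym, (norm_vsub_Psi hPsi) by auto.
  assert (K1 := Psi_mono hPsi _ _ (Hlow a m N HN)).
  assert (K2 := Psi_dp_sum_le a t (l ⊖ x m) Ht (Hlx m)).
  rewrite dp_sum_vsub, !(Psi_vsub hPsi) in K2 by auto. lra.
Qed.

Lemma dp_sum_product N t s u : 0 <= t -> 0 <= s ->
  dp_sum N (t + s) u = vsum (fun k => Vn k t (dp_sum (N - k) s u)) N.
Proof.
  intros Ht Hs. induction N as [|N IH]; [reflexivity|].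
  rewrite dp_sum_S, IH, dp_product by auto.
  transitivity (vsum (fun k => Vn k t (dp_sum (N - k) s u) ⊕ Vn k t (Vn (N - k) s u)) (S N)).
  - rewrite vsum_vadd. simpl. rewrite Nat.sub_diag. unfold dp_sum at 3. simpl.
    rewrite (linear_vzero (dp_linear N Ht)). module.
  - apply vsum_ext. intros k Hk. replace (S N - k)%nat with (S (N - k)) by lia.
    rewrite dp_sum_S. symmetry. apply linear_vadd. now apply dp_linear.
Qed.

Lemma dp_semigroup_plus t s u : 0 <= t -> 0 <= s ->
  dp_semigroup (t + s) u = dp_semigroup t (dp_semigroup s u).
Proof.
  intros Ht Hs.
  assert (K : forall u, cone u -> dp_semigroup (t + s) u = dp_semigroup t (dp_semigroup s u)).
  { clear u. intros u Hu.
    apply (tends_unique (F := eventually) (dp_semigroup_tends (t + s) u ltac:(lra))).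
    eapply tends_ext.
    2: apply (dp_convolution_tends t (fun n => dp_sum n s u) (dp_semigroup s u) Ht).
    - intros N. simpl. now rewrite dp_sum_product.
    - intros n. now apply cone_dp_sum.
    - intros n. rewrite dp_sum_S.
      replace (dp_sum n s u ⊕ Vn n s u ⊖ dp_sum n s u) with (Vn n s u) by module.
      now apply cone_dp.
    - now apply dp_semigroup_tends. }
  destruct (generating u) as (p & q & Hp & Hq & ->).
  rewrite (linear_vsub (dp_semigroup_linear (t := t + s) ltac:(lra))), !K by auto.
  rewrite (linear_vsub (dp_semigroup_linear Hs)).
  now rewrite (linear_vsub (dp_semigroup_linear Ht)).
Qed.

Lemma dp_semigroup_substochastic : is_substochastic dp_semigroup.
Proof.
  constructor.
  - constructor.
    + intros t Ht. now apply dp_semigroup_linear.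
    + intros u. apply norm_vsub_eq. apply le_epsilon. intros eps He.
      destruct (dp_sum_small u eps He) as (d & Hd & K). rewrite Rplus_0_l.
      apply (tends_norm_le (F := eventually) _ _ (dp_semigroup_tends 0 u (Rle_refl 0))).
      exists 1%nat. intros [|N] HN; [lia|]. apply K. lra.
    + intros t s u. apply dp_semigroup_plus.
    + intros u. apply (tends_norm_iff (F := at_right 0) (fun t => dp_semigroup t u)).
      intros eps He. destruct (dp_sum_small u (eps / 2) ltac:(lra)) as (d & Hd & K).
      apply at_right_0_iff. exists d. split; auto. intros h Hh.
      apply Rle_lt_trans with (eps / 2); [|lra].
      apply (tends_norm_le (F := eventually) _ _ (dp_semigroup_tends h u ltac:(lra))).
      exists 1%nat. intros [|N] HN; [lia|]. apply K. lra.
  - intros t u. apply cone_dp_semigroup.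
  - intros t u Ht Hu. rewrite <- !(Psi_norm hPsi); auto.
    + now apply Psi_dp_semigroup.
    + now apply cone_dp_semigroup.
Qed.

Lemma dp_semigroup_extends : extends_sum (generator dp_semigroup) (generator U) B.
Proof.
  intros u Hu. apply (generator_value (T := dp_semigroup) (w := A u ⊕ B u)).
  apply tends_ext with (f := fun h => / h ⊙ (U h u ⊖ u) ⊕
    / h ⊙ (dp_semigroup h u ⊖ U h u)); [intros h; module|].
  apply tends_vadd; [now apply generator_tends|].
  apply tends_norm_iff. intros eps He.
  destruct (dp_sum_average u (eps / 2) Hu ltac:(lra)) as (d & Hd & K).
  apply at_right_0_iff. exists d. split; auto. intros h Hh.
  apply Rle_lt_trans with (eps / 2); [|lra].
  apply (tends_norm_le (F := eventually)
    (f := fun N => / h ⊙ (dp_sum N h u ⊖ U h u))).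
  - apply tends_vscal_r, tends_vsub; [apply dp_semigroup_tends; lra|apply tends_const].
  - exists 2%nat. intros [|[|N]] HN; try lia. now apply K.
Qed.

(** Product formula with the small time on the right, next to [z]: there the right derivatives at 0
    apply, and only those of [U] and of the first iterate can be nonzero. *)
Lemma dp_rderiv n s z : 0 <= s -> D z ->
  rderiv (fun r => Vn n r z) s
    (Vn n s (A z) ⊕ match n with O => vzero | S m => Vn m s (B z) end).
Proof.
  intros Hs Hz. assert (HL := dp_linear n Hs).
  set (b := fun k => match (n - S k)%nat with O => B z | S _ => vzero end).
  assert (Eb : match n with O => vzero | S m => Vn m s (B z) end =
    vsum (fun k => Vn k s (b k)) n).
  { destruct n as [|m]; [reflexivity|]. simpl. unfold b at 2.
    rewrite Nat.sub_diag.
    replace (vsum (fun k => Vn k s (b k)) m) with (vzero : X); [module|].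
    rewrite (vsum_ext (fun k => Vn k s (b k)) (fun _ => vzero)).
    - clear. induction m as [|m IH]; simpl; [reflexivity|]. rewrite <- IH. module.
    - intros k Hk. unfold b. destruct (S m - S k)%nat eqn:E; [lia|].
      apply (linear_vzero (dp_linear k Hs)). }
  rewrite Eb. unfold rderiv.
  eapply tends_ext_loc.
  2: { apply tends_vadd.
       - apply (tends_linear HL (generator_tends Hz)).
       - apply (tends_vsum (fun k h => Vn k s (/ h ⊙ Vn (n - k) h z)) (fun k => Vn k s (b k))).
         intros k Hk. apply tends_linear; [now apply dp_linear|].
         unfold b. replace (n - k)%nat with (S (n - S k)) by lia.
         apply (dp_right_derivative_0 (n - S k) z Hz). }
  apply at_right_0_iff. exists 1. split; [lra|]. intros h Hh. cbv beta.
  rewrite dp_product by lra. simpl. rewrite Nat.sub_diag, (dp_zero hVn) by lra.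
  rewrite (linear_vscal HL), (linear_vsub HL).
  rewrite (vsum_ext (fun k => Vn k s (/ h ⊙ Vn (n - k) h z))
    (fun k => / h ⊙ Vn k s (Vn (n - k) h z))).
  - rewrite vsum_vscal. module.
  - intros k _. apply linear_vscal. now apply dp_linear.
Qed.

Lemma rderiv_vsum (f : nat -> R -> X) (l : nat -> X) t n :
  (forall k, (k < n)%nat -> rderiv (f k) t (l k)) ->
  rderiv (fun s => vsum (fun k => f k s) n) t (vsum l n).
Proof.
  intros H. induction n as [|n IH]; simpl.
  - unfold rderiv. apply tends_ext with (f := fun _ => vzero); [intros; module|].
    apply tends_const.
  - apply rderiv_vadd; [apply IH; intros; apply H; lia|apply H; lia].
Qed.

Lemma hcont_vsum (f : nat -> R -> X) n :
  (forall k, (k < n)%nat -> hcont (f k)) -> hcont (fun s => vsum (fun k => f k s) n).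
Proof.
  intros H. induction n as [|n IH]; simpl; [apply hcont_const|].
  apply (hcont_vadd (f := fun s => vsum (fun k => f k s) n) (g := f n));
    [apply IH; intros; apply H; lia|apply H; lia].
Qed.

(** * The resolvent as a Neumann series *)

Section Neumann.
Context {lam : R} (Hlam : 0 < lam).

Notation Res := (resolvent A lam).

Definition B_res_iter (n : nat) u : X := Nat.iter n (fun w => B (resolvent A lam w)) u.

Definition neumann_sum (N : nat) u : X := vsum (fun n => Res (B_res_iter n u)) N.

Lemma B_res_iter_linear n : is_linear (B_res_iter n).
Proof.
  induction n as [|n IH]; [apply is_linear_id|].
  apply (is_linear_comp (B_res_iter n) (fun w => B (Res w))); auto.
  now apply B_resolvent_linear.
Qed.

Lemma cone_B_res_iter n u : cone u -> cone (B_res_iter n u).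
Proof.
  intros Hu. induction n as [|n IH]; auto.
  apply cone_B; [apply (dom_resolvent hPsi hU HM Hlam)|].
  now apply (cone_resolvent hPsi hU HM Hlam).
Qed.

Lemma cone_neumann_term n u : cone u -> cone (Res (B_res_iter n u)).
Proof. intros Hu. now apply (cone_resolvent hPsi hU HM Hlam), cone_B_res_iter. Qed.

Lemma neumann_sum_S N u : neumann_sum (S N) u = neumann_sum N u ⊕ Res (B_res_iter N u).
Proof. reflexivity. Qed.

Lemma neumann_sum_linear N : is_linear (neumann_sum N).
Proof.
  apply (is_linear_vsum (fun n u => Res (B_res_iter n u))). intros n _.
  apply (is_linear_comp (B_res_iter n) (fun w => Res w)); [apply B_res_iter_linear|].
  exact (resolvent_linear hPsi hU HM Hlam).
Qed.

Lemma neumann_sum_spec N u : D (neumann_sum N u) /\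
  A (neumann_sum N u) = lam ⊙ neumann_sum N u ⊖ vsum (fun n => B_res_iter n u) N /\
  B (neumann_sum N u) = vsum (fun n => B_res_iter (S n) u) N.
Proof.
  induction N as [|N (ID & IA & IB)].
  - destruct (generator_vzero hU) as [D0 A0].
    change (neumann_sum 0 u) with (vzero : X). split; auto.
    rewrite A0. cbn [vsum]. split; [module|].
    replace (vzero : X) with (0 ⊙ (vzero : X)) at 1 by module.
    rewrite B_vscal by auto. module.
  - assert (DR := dom_resolvent hPsi hU HM Hlam (B_res_iter N u)).
    destruct (generator_vadd hU ID DR) as [D1 A1].
    rewrite neumann_sum_S. split; auto. split.
    + rewrite A1, IA, (generator_resolvent hPsi hU HM Hlam). cbn [vsum]. module.
    + rewrite B_vadd, IB by auto. reflexivity.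
Qed.

Lemma generator_B_neumann_sum N u :
  A (neumann_sum N u) ⊕ B (neumann_sum N u) = lam ⊙ neumann_sum N u ⊖ u ⊕ B_res_iter N u.
Proof.
  destruct (neumann_sum_spec N u) as (_ & -> & ->).
  assert (E : vsum (fun n => B_res_iter n u) (S N) = u ⊕ vsum (fun n => B_res_iter (S n) u) N)
    by now rewrite vsum_head.
  cbn [vsum] in E.
  replace (vsum (fun n => B_res_iter (S n) u) N) with
    (u ⊕ vsum (fun n => B_res_iter (S n) u) N ⊖ u) by module.
  rewrite <- E. module.
Qed.

(** Mass balance: the hypothesis on [A] and [B] applied to the Neumann sum, which is positive and in
    the domain. It bounds both the sums and the iterates [B_res_iter]. *)
Lemma Psi_neumann_sum N u : cone u ->
  lam * Psi (neumann_sum N u) + Psi (B_res_iter N u) <= Psi u.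
Proof.
  intros Hu. destruct (neumann_sum_spec N u) as (DN & _).
  assert (C : cone (neumann_sum N u)).
  { clear DN. unfold neumann_sum. induction N as [|N IH]; simpl; [apply cone_vzero|].
    apply cone_vadd; auto. now apply cone_neumann_term. }
  assert (K : Psi (A (neumann_sum N u) ⊕ B (neumann_sum N u)) <= 0) by exact (hAB _ DN C).
  rewrite generator_B_neumann_sum, (Psi_vadd hPsi), (Psi_vsub hPsi), (Psi_vscal hPsi) in K.
  lra.
Qed.

Lemma cone_neumann_sum_S N u : cone u -> cone (neumann_sum (S N) u ⊖ neumann_sum N u).
Proof.
  intros Hu. rewrite neumann_sum_S.
  match goal with |- cone (?p ⊕ ?q ⊖ ?p) => replace (p ⊕ q ⊖ p) with q by module end.
  now apply cone_neumann_term.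
Qed.

Lemma cone_neumann_sum N u : cone u -> cone (neumann_sum N u).
Proof.
  intros Hu. unfold neumann_sum. induction N as [|N IH]; simpl; [apply cone_vzero|].
  apply cone_vadd; auto. now apply cone_neumann_term.
Qed.

Lemma neumann_sum_converges u : cone u -> exists v,
  tends (fun N => neumann_sum N u) eventually v /\ forall N, cone (v ⊖ neumann_sum N u).
Proof.
  intros Hu.
  apply (increasing_bounded_tends hPsi (fun N => neumann_sum N u) (Psi u / lam)).
  - intros N. now apply cone_neumann_sum_S.
  - intros N. assert (K := Psi_neumann_sum N u Hu).
    assert (K2 := Psi_ge_0 hPsi _ (cone_B_res_iter N u Hu)).
    apply Rmult_le_reg_l with lam; auto.
    replace (lam * (Psi u / lam)) with (Psi u) by (field; lra). lra.
Qed.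

(** Approximates [dp_semigroup h v] for [v] the limit of the Neumann sums. Pairing the index [k]
    with [N - k], instead of applying a full partial sum to a full Neumann sum, makes the derivative
    telescope exactly. *)
Definition dp_neumann (N : nat) (h : R) u : X :=
  vsum (fun k => Vn k h (neumann_sum (N - k) u)) N.

(* The terms telescope since
   [A (neumann_sum (S m) u) + B (neumann_sum m u) = lam (neumann_sum (S m) u) - u]. *)
Lemma dp_neumann_rderiv N s u : 0 <= s ->
  rderiv (fun r => dp_neumann N r u) s (lam ⊙ dp_neumann N s u ⊖ dp_sum N s u).
Proof.
  intros Hs.
  set (l := fun k => Vn k s (A (neumann_sum (N - k) u)) ⊕
    match k with O => vzero | S m => Vn m s (B (neumann_sum (N - k) u)) end).
  replace (lam ⊙ dp_neumann N s u ⊖ dp_sum N s u) with (vsum l N).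
  { apply (rderiv_vsum (fun k r => Vn k r (neumann_sum (N - k) u)) l). intros k _.
    apply dp_rderiv; auto. apply neumann_sum_spec. }
  unfold l. rewrite vsum_vadd.
  destruct N as [|N]; [unfold dp_neumann, dp_sum; simpl; module|].
  rewrite (vsum_head (fun k => match k with O => vzero
    | S m => Vn m s (B (neumann_sum (S N - k) u)) end)).
  assert (E : vsum (fun k => Vn k s (B (neumann_sum (N - k) u))) N =
    vsum (fun k => Vn k s (B (neumann_sum (N - k) u))) (S N)).
  { simpl. rewrite Nat.sub_diag. destruct (neumann_sum_spec 0 u) as (_ & _ & ->).
    simpl. rewrite (linear_vzero (dp_linear N Hs)). module. }
  change (fun k => Vn k s (B (neumann_sum (S N - S k) u))) with
    (fun k => Vn k s (B (neumann_sum (N - k) u))).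
  rewrite E.
  match goal with |- ?a ⊕ (vzero ⊕ ?b) = _ => replace (a ⊕ (vzero ⊕ b)) with (a ⊕ b) by module end.
  rewrite <- vsum_vadd. unfold dp_neumann, dp_sum. rewrite <- vsum_vscal.
  transitivity (vsum (fun k => lam ⊙ Vn k s (neumann_sum (S N - k) u) ⊕ (-1) ⊙ Vn k s u) (S N)).
  2: rewrite vsum_vadd, !vsum_vscal; module.
  apply vsum_ext. intros k Hk. replace (S N - k)%nat with (S (N - k)) by lia.
  rewrite <- (linear_vadd (dp_linear k Hs)).
  replace (A (neumann_sum (S (N - k)) u) ⊕ B (neumann_sum (N - k) u)) with
    (lam ⊙ neumann_sum (S (N - k)) u ⊖ u).
  - rewrite (linear_vsub (dp_linear k Hs)), (linear_vscal (dp_linear k Hs)). module.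
  - destruct (neumann_sum_spec (S (N - k)) u) as (_ & -> & _).
    destruct (neumann_sum_spec (N - k) u) as (_ & _ & ->).
    rewrite (vsum_head (fun n => B_res_iter n u)).
    change (B_res_iter 0 u) with u. module.
Qed.

Lemma dp_neumann_0 N u : dp_neumann (S N) 0 u = neumann_sum (S N) u.
Proof.
  unfold dp_neumann. rewrite vsum_head, Nat.sub_0_r, (dp_zero hVn), (sg_zero (sub_C0 hU)) by lra.
  replace (vsum (fun k => Vn (S k) 0 (neumann_sum (S N - S k) u)) N) with (vzero : X); [module|].
  rewrite (vsum_ext _ (fun _ => vzero)).
  - clear. induction N as [|N IH]; simpl; [reflexivity|]. rewrite <- IH. module.
  - intros k _. apply dp_at_0.
Qed.

(** The damped convolution plus s u has right derivative u - exp(-lam s) [dp_sum (S N) s u], small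
    near 0 uniformly in [N]; the mean value inequality integrates this. Uniformity allows N -> oo
    before h -> 0. *)
Lemma dp_neumann_increment u eps : 0 < eps -> exists d, 0 < d /\ forall h N, 0 < h < d ->
  norm (exp (- lam * h) ⊙ dp_neumann (S N) h u ⊕ h ⊙ u ⊖ neumann_sum (S N) u) <= eps * h.
Proof.
  intros He. assert (HM1 : 1 <= M) by apply HM.
  destruct (dp_sum_small u (eps / 2) ltac:(lra)) as (d1 & Hd1 & K1).
  assert (Hc : hcont (fun s => exp (- lam * s) ⊙ u))
    by (apply hcont_vscal; [apply hcont_exp|apply hcont_const]).
  destruct (hcont_small (fun s => exp (- lam * s) ⊙ u) (eps / 2) Hc ltac:(lra))
    as (d2 & Hd2 & K2).
  exists (Rmin d1 d2). split; [now apply Rmin_glb_lt|]. intros h N Hh.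
  assert (A1 := Rmin_l d1 d2). assert (A2 := Rmin_r d1 d2).
  assert (K : norm ((exp (- lam * h) ⊙ dp_neumann (S N) h u ⊕ h ⊙ u) ⊖
    (exp (- lam * 0) ⊙ dp_neumann (S N) 0 u ⊕ 0 ⊙ u)) <= eps * h).
  { apply (rderiv_bound_mean (f := fun s => exp (- lam * s) ⊙ dp_neumann (S N) s u ⊕ s ⊙ u));
      try lra.
    - apply hcont_vadd; apply hcont_vscal.
      + apply hcont_exp.
      + apply (hcont_vsum (fun k s => Vn k s (neumann_sum (S N - k) u))).
        intros k _. apply dp_hcont.
      + apply hcont_of_continuous. intros t. apply continuous_id.
      + apply hcont_const.
    - intros s Hs.
      exists ((- lam * exp (- lam * s)) ⊙ dp_neumann (S N) s u ⊕
        exp (- lam * s) ⊙ (lam ⊙ dp_neumann (S N) s u ⊖ dp_sum (S N) s u) ⊕ u). split.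
      + apply rderiv_vadd.
        * apply (rderiv_exp_vscal (- lam) (f := fun s => dp_neumann (S N) s u)); [lra|].
          apply dp_neumann_rderiv. lra.
        * unfold rderiv. eapply tends_ext_loc; [|apply (tends_const (c := u))].
          apply at_right_0_iff. exists 1. split; [lra|]. intros r Hr.
          module by (field; lra).
      + match goal with |- norm ?z <= _ =>
          replace z with (exp (- lam * s) ⊙ (u ⊖ dp_sum (S N) s u) ⊖
            (exp (- lam * s) ⊙ u ⊖ u)) by module end.
        destruct (K1 s N ltac:(lra)) as [P _]. assert (Q := K2 s ltac:(lra)).
        cbv beta in Q. rewrite Rmult_0_r, exp_0 in Q.
        replace (1 ⊙ u) with u in Q by module.
        eapply Rle_trans; [apply norm_vsub|].
        assert (P2 := norm_vscal (exp (- lam * s)) (u ⊖ dp_sum (S N) s u)).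
        rewrite Rabs_pos_eq in P2 by (left; apply exp_pos).
        rewrite (norm_vsub_sym u) in P2.
        assert (E1 : exp (- lam * s) <= 1).
        { rewrite <- exp_0. destruct (Req_dec s 0) as [->|Hn].
          - rewrite Rmult_0_r. lra.
          - left. apply exp_increasing. nra. }
        assert (0 <= norm (dp_sum (S N) s u ⊖ u)) by apply norm_ge_0.
        assert (exp (- lam * s) * norm (dp_sum (S N) s u ⊖ u) <= 1 * norm (dp_sum (S N) s u ⊖ u))
          by now apply Rmult_le_compat_r.
        lra. }
  rewrite dp_neumann_0, Rmult_0_r, exp_0 in K.
  replace (1 ⊙ neumann_sum (S N) u ⊕ 0 ⊙ u) with (neumann_sum (S N) u) in K by module.
  exact K.
Qed.

(** Letting [N] grow in the increment estimate shows that exp(-lam h) [dp_semigroup h v] has right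
    derivative -u at 0, where v is the limit of the Neumann sums; so v is in the domain of the
    generator, with value lam v - u. *)
Lemma dp_semigroup_resolvent_tends u : cone u ->
  tends (fun N => neumann_sum N u) eventually (resolvent (generator dp_semigroup) lam u).
Proof.
  intros Hu. destruct (neumann_sum_converges u Hu) as (v & Hv & _).
  assert (G : dom (generator dp_semigroup) v /\ generator dp_semigroup v = lam ⊙ v ⊖ u).
  { apply generator_value.
    assert (K0 : tends (fun h => / h ⊙ (exp (- lam * h) ⊙ dp_semigroup h v ⊖ v))
      (at_right 0) (vzero ⊖ u)).
    { apply tends_norm_iff. intros eps He.
      destruct (dp_neumann_increment u (eps / 2) ltac:(lra)) as (d & Hd & K).
      apply at_right_0_iff. exists d. split; auto. intros h Hh.
      assert (K1 : norm (exp (- lam * h) ⊙ dp_semigroup h v ⊕ h ⊙ u ⊖ v) <= eps / 2 * h).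
      { apply (tends_le (F := eventually)
          (f := fun N => norm (exp (- lam * h) ⊙ dp_neumann N h u ⊕ h ⊙ u ⊖ neumann_sum N u))
          (g := fun _ => eps / 2 * h)).
        - exists 1%nat. intros [|N] HN; [lia|]. now apply K.
        - apply tends_norm, tends_vsub; auto.
          apply tends_vadd; [|apply tends_const]. apply tends_vscal_r.
          apply (dp_convolution_tends h (fun n => neumann_sum n u)); auto; try lra.
          + intros n. now apply cone_neumann_sum.
          + intros n. now apply cone_neumann_sum_S.
        - apply tends_const. }
      replace (/ h ⊙ (exp (- lam * h) ⊙ dp_semigroup h v ⊖ v) ⊖ (vzero ⊖ u)) with
        (/ h ⊙ (exp (- lam * h) ⊙ dp_semigroup h v ⊕ h ⊙ u ⊖ v)) by (module by (field; lra)).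
      eapply Rle_lt_trans; [apply norm_vscal|].
      assert (0 < / h) by (apply Rinv_0_lt_compat; lra).
      rewrite Rabs_pos_eq by lra.
      apply Rle_lt_trans with (/ h * (eps / 2 * h)); [now apply Rmult_le_compat_l; [lra|]|].
      replace (/ h * (eps / 2 * h)) with (eps / 2) by (field; lra). lra. }
    assert (K1 : tends (fun h => / h * (exp (lam * (0 + h)) - exp (lam * 0))) (at_right 0) lam).
    { apply (tends_right_of_is_derive (k := fun x => exp (lam * x)) (t := 0)).
      auto_derive; auto. rewrite Rmult_0_r, exp_0. ring. }
    assert (K2 := hcont_right (Rle_refl 0) (hcont_exp lam)). cbv beta in K2.
    (* The damping is removed by the product rule: multiply the quotient by [exp (lam * h)] and add
       the difference quotient of this exponential times [v]. *)
    replace (lam ⊙ v ⊖ u) with (exp (lam * 0) ⊙ (vzero ⊖ u) ⊕ lam ⊙ v)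
      by (rewrite Rmult_0_r, exp_0; module).
    eapply tends_ext; [|apply (tends_vadd (tends_vscal K2 K0) (tends_vscal K1 (tends_const (c := v))))].
    intros h. cbv beta. rewrite Rplus_0_l, Rmult_0_r, exp_0.
    replace (exp (- lam * h)) with (/ exp (lam * h))
      by (rewrite <- exp_Ropp; f_equal; ring).
    assert (P := exp_pos (lam * h)). generalize (/ h). intros q.
    module by (field; lra). }
  destruct G as [Dv Gv].
  rewrite (resolvent_unique dp_semigroup_substochastic HM Hlam Dv (u := u)); auto.
  rewrite Gv. module.
Qed.

Context {V : R -> X -> X} (hV : is_minimal_semigroup U B V).

(** Minimality compares the Laplace integrals and gives one inequality between the resolvents. For
    the other, since the generator of [V] extends A + B, its resolvent maps [u - B_res_iter N u] to
    [neumann_sum N u], which therefore lies below the resolvent at [u]. *)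
Lemma minimal_resolvent_tends u : cone u ->
  tends (fun N => neumann_sum N u) eventually (resolvent (generator V) lam u).
Proof.
  intros Hu. assert (sV := min_substochastic hV). assert (sW := dp_semigroup_substochastic).
  assert (K := dp_semigroup_resolvent_tends u Hu).
  replace (resolvent (generator V) lam u) with (resolvent (generator dp_semigroup) lam u); auto.
  apply cone_antisym.
  - apply (cone_tends (F := eventually)
      (f := fun n => laplace (T := dp_semigroup) (lam := lam) (INR n) u ⊖
                     laplace (T := V) (lam := lam) (INR n) u)).
    + apply filter_forall. intros n.
      apply (cone_RInt (f := fun s => exp (- lam * s) ⊙ dp_semigroup s u ⊖
        exp (- lam * s) ⊙ V s u) (a := 0) (b := INR n)); [apply pos_INR| |].
      * intros s Hs.
        replace (exp (- lam * s) ⊙ dp_semigroup s u ⊖ exp (- lam * s) ⊙ V s u)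
          with (exp (- lam * s) ⊙ (dp_semigroup s u ⊖ V s u)) by module.
        apply cone_vscal; [left; apply exp_pos|].
        assert (Hs0 : 0 <= s) by lra.
        change (ord (V s u) (dp_semigroup s u)).
        now apply (min_least hV sW dp_semigroup_extends).
      * apply (is_RInt_minus (fun s => exp (- lam * s) ⊙ dp_semigroup s u)
          (fun s => exp (- lam * s) ⊙ V s u)); apply hcont_is_RInt;
          try (split; [lra|apply pos_INR]).
        -- apply (laplace_hcont sW HM).
        -- apply (laplace_hcont sV HM).
    + apply tends_vsub.
      * exact (resolvent_tends hPsi sW HM Hlam Hu).
      * exact (resolvent_tends hPsi sV HM Hlam Hu).
  - apply (cone_tends (F := eventually)
      (f := fun N => resolvent (generator V) lam u ⊖ neumann_sum N u)).
    + apply filter_forall. intros N.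
      destruct (neumann_sum_spec N u) as (DN & _).
      destruct (min_extends hV DN) as [DV EV].
      change (generator V (neumann_sum N u) = A (neumann_sum N u) ⊕ B (neumann_sum N u)) in EV.
      rewrite generator_B_neumann_sum in EV.
      replace (neumann_sum N u) with (resolvent (generator V) lam (u ⊖ B_res_iter N u)).
      * rewrite <- (linear_vsub (resolvent_linear hPsi sV HM Hlam)).
        replace (u ⊖ (u ⊖ B_res_iter N u)) with (B_res_iter N u) by module.
        apply (cone_resolvent hPsi sV HM Hlam). now apply cone_B_res_iter.
      * apply (resolvent_unique sV HM Hlam DV). rewrite EV. module.
    + apply tends_vsub; auto. apply tends_const.
Qed.

Lemma minimal_resolvent_eq u : cone u ->
  resolvent (generator dp_semigroup) lam u = resolvent (generator V) lam u.
Proof.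
  intros Hu. exact (tends_unique (F := eventually) (dp_semigroup_resolvent_tends u Hu)
    (minimal_resolvent_tends u Hu)).
Qed.
End Neumann.

(** * Mass absorbed along the integrated iterates *)

Lemma fun_a_vsub u v : D u -> D v ->
  fun_a Psi A B (u ⊖ v) = fun_a Psi A B u - fun_a Psi A B v.
Proof.
  intros Hu Hv. unfold fun_a.
  change (- Psi (A (u ⊖ v) ⊕ B (u ⊖ v)) = - Psi (A u ⊕ B u) - - Psi (A v ⊕ B v)).
  rewrite (proj2 (generator_vsub hU Hu Hv)), B_vsub by auto.
  rewrite !(Psi_vadd hPsi), !(Psi_vsub hPsi). ring.
Qed.

Lemma fun_a_ge_0 u : D u -> cone u -> 0 <= fun_a Psi A B u.
Proof. intros Hu Hc. unfold fun_a. generalize (hAB u Hu Hc). lra. Qed.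

Lemma dp_int_0_scaled_tends u :
  tends (fun t => / t ⊙ dp_int 0 t u) (at_right 0) u.
Proof.
  assert (K := rderiv_RInt (Rle_refl 0) (dp_hcont 0 u)). unfold rderiv in K.
  rewrite (dp_zero hVn), (sg_zero (sub_C0 hU)) in K by lra.
  eapply tends_ext; [|exact K]. intros h. cbv beta.
  rewrite RInt_point, Rplus_0_l. unfold dp_int. module.
Qed.

(** [fun_a] is controlled in the graph norm of [A]. For [y] in the domain the averages of the orbit
    converge together with their images under [A], and [B] follows through the resolvent at 1. *)
Lemma fun_a_dp_int_0_tends y : D y ->
  tends (fun t => / t * fun_a Psi A B (dp_int 0 t y)) (at_right 0) (fun_a Psi A B y).
Proof.
  intros Hy.
  assert (K1 : tends (fun t => / t ⊙ A (dp_int 0 t y)) (at_right 0) (A y)).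
  { eapply tends_ext_loc; [|apply (generator_tends Hy)].
    apply at_right_0_iff. exists 1. split; [lra|]. intros t Ht.
    rewrite (proj2 (generator_dp_int 0 t y ltac:(lra))), (dp_zero hVn) by lra.
    reflexivity. }
  assert (K2 : tends (fun t => / t ⊙ B (dp_int 0 t y)) (at_right 0) (B y)).
  { assert (L := B_resolvent_linear Rlt_0_1).
    rewrite (B_eq_resolvent y) by auto.
    eapply tends_ext_loc.
    2: apply (tends_linear L (tends_vsub (tends_vscal_r 1 (dp_int_0_scaled_tends y)) K1)).
    apply at_right_0_iff. exists 1. split; [lra|]. intros t Ht. cbv beta.
    rewrite (B_eq_resolvent (dp_int 0 t y)) by (apply generator_dp_int; lra).
    rewrite <- (linear_vscal L). cbv beta. f_equal. f_equal. module. }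
  apply tends_ext with (f := fun t => -1 * Psi (/ t ⊙ A (dp_int 0 t y) ⊕ / t ⊙ B (dp_int 0 t y))).
  { intros t. unfold fun_a. change (plus (A (dp_int 0 t y)) (B (dp_int 0 t y))) with
      (A (dp_int 0 t y) ⊕ B (dp_int 0 t y)).
    rewrite !(Psi_vadd hPsi), !(Psi_vscal hPsi).
    match goal with |- ?a = ?b => change (@eq R a b) end. ring. }
  replace (fun_a Psi A B y) with (-1 * Psi (A y ⊕ B y))
    by (unfold fun_a; change (plus (A y) (B y)) with (A y ⊕ B y); ring).
  apply (tends_vscal_r (V := R_NormedModule) (-1)), (tends_Psi hPsi).
  now apply tends_vadd.
Qed.

(** Telescopes because [A] of an integrated iterate contains minus [B] of the preceding one. The
    last term is the mass still in transit after step [N]; bounding it from below is the purpose of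
    [defect]. *)
Lemma sum_fun_a_dp_int N t v : 0 <= t ->
  sum_n (fun n => fun_a Psi A B (dp_int n t v)) N =
  Psi v - Psi (dp_sum (S N) t v) - Psi (B (dp_int N t v)).
Proof.
  intros Ht. unfold fun_a.
  induction N as [|N IH].
  - rewrite sum_O. destruct (generator_dp_int 0 t v Ht) as [_ E].
    change (- Psi (A (dp_int 0 t v) ⊕ B (dp_int 0 t v)) =
      Psi v - Psi (vzero ⊕ Vn 0 t v) - Psi (B (dp_int 0 t v))).
    rewrite E, !(Psi_vadd hPsi), (Psi_vsub hPsi), (Psi_vzero hPsi). ring.
  - rewrite sum_Sn, IH. destruct (generator_dp_int (S N) t v Ht) as [_ E].
    change (Psi v - Psi (dp_sum (S N) t v) - Psi (B (dp_int N t v)) +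
      - Psi (A (dp_int (S N) t v) ⊕ B (dp_int (S N) t v)) =
      Psi v - Psi (dp_sum (S (S N)) t v) - Psi (B (dp_int (S N) t v))).
    rewrite (dp_sum_S (S N)), E, !(Psi_vadd hPsi), (Psi_vsub hPsi). ring.
Qed.

Lemma series_fun_a_converges t v : 0 <= t -> cone v ->
  ex_series (fun n => fun_a Psi A B (dp_int n t v)).
Proof.
  intros Ht Hv.
  assert (Hd : forall n, D (dp_int n t v) /\ cone (dp_int n t v)).
  { intros n. split; [now apply generator_dp_int|now apply cone_dp_int]. }
  assert (K : ex_finite_lim_seq (sum_n (fun n => fun_a Psi A B (dp_int n t v)))).
  { apply ex_finite_lim_seq_incr with (Psi v).
    - intros n. rewrite sum_Sn.
      change (plus (sum_n (fun n => fun_a Psi A B (dp_int n t v)) n)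
        (fun_a Psi A B (dp_int (S n) t v))) with
        (sum_n (fun n => fun_a Psi A B (dp_int n t v)) n + fun_a Psi A B (dp_int (S n) t v)).
      assert (K := fun_a_ge_0 _ (proj1 (Hd (S n))) (proj2 (Hd (S n)))). lra.
    - intros n. rewrite sum_fun_a_dp_int by auto.
      assert (K1 := Psi_ge_0 hPsi _ (cone_dp_sum (S n) t v Ht Hv)).
      assert (K2 := Psi_ge_0 hPsi _ (cone_B _ (proj1 (Hd n)) (proj2 (Hd n)))). lra. }
  destruct K as [l Hl]. exists l. exact Hl.
Qed.

Lemma sum_le_series (x : nat -> R) N :
  (forall n, 0 <= x n) -> ex_series x -> sum_n x N <= Series x.
Proof.
  intros Hx [l Hl]. rewrite (is_series_unique _ _ Hl).
  apply (is_lim_seq_incr_compare (sum_n x) l Hl).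
  intros n. rewrite sum_Sn. change (sum_n x n <= sum_n x n + x (S n)).
  specialize (Hx (S n)). lra.
Qed.

Section Loss.
Context {lam : R} (Hlam : 0 < lam).

Notation Res := (resolvent A lam).
Notation K := (B_res_iter (lam := lam)).

Lemma B_res_mass_converges u : exists l, tends (fun N => Psi (K N u)) eventually l.
Proof.
  assert (Hc : forall u, cone u -> exists l, tends (fun N => Psi (K N u)) eventually l).
  { clear u. intros u Hu.
    assert (H : ex_finite_lim_seq (fun N => Psi (K N u))).
    { apply ex_finite_lim_seq_decr with 0.
      (* The one-term mass balance at [K n u] shows that the masses decrease. *)
      - intros n. assert (H := Psi_neumann_sum Hlam 1 (K n u) (cone_B_res_iter Hlam n u Hu)).
        change (B_res_iter 1 (K n u)) with (K (S n) u) in H.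
        assert (H2 := Psi_ge_0 hPsi _ (cone_neumann_sum Hlam 1 _ (cone_B_res_iter Hlam n u Hu))).
        assert (0 <= lam * Psi (neumann_sum (lam := lam) 1 (K n u)))
          by (apply Rmult_le_pos; lra). lra.
      - intros n. apply (Psi_ge_0 hPsi). now apply (cone_B_res_iter Hlam). }
    destruct H as [l Hl]. exists l. exact Hl. }
  destruct (generating u) as (p & q & Hp & Hq & ->).
  destruct (Hc p Hp) as [lp Lp]. destruct (Hc q Hq) as [lq Lq].
  exists (lp ⊖ lq : R). eapply tends_ext; [|apply (tends_vsub Lp Lq)].
  intros n. cbv beta. rewrite (linear_vsub (B_res_iter_linear Hlam n)), (Psi_vsub hPsi).
  reflexivity.
Qed.

(* [defect u] is the mass of [u] that never gets absorbed; it is invariant under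
   [B (lam - A)^{-1}], which makes it telescope along the iterates. *)
Definition defect u : R := real (Lim_seq (fun N => Psi (K N u))).

Lemma defect_tends u : tends (fun N => Psi (K N u)) eventually (defect u).
Proof.
  destruct (B_res_mass_converges u) as [l Hl].
  unfold defect. rewrite (is_lim_seq_unique (fun N => Psi (K N u)) l Hl). exact Hl.
Qed.

Lemma defect_unique u l : tends (fun N => Psi (K N u)) eventually l -> defect u = l.
Proof.
  intros Hl. unfold defect. now rewrite (is_lim_seq_unique (fun N => Psi (K N u)) l Hl).
Qed.

Lemma defect_vadd u v : defect (u ⊕ v) = defect u + defect v.
Proof.
  apply defect_unique. eapply tends_ext; [|apply (tends_vadd (defect_tends u) (defect_tends v))].
  intros n. cbv beta. rewrite (linear_vadd (B_res_iter_linear Hlam n)), (Psi_vadd hPsi).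
  reflexivity.
Qed.

Lemma defect_vscal r u : defect (r ⊙ u) = r * defect u.
Proof.
  apply defect_unique. eapply tends_ext; [|apply (tends_vscal_r r (defect_tends u))].
  intros n. cbv beta. rewrite (linear_vscal (B_res_iter_linear Hlam n)), (Psi_vscal hPsi).
  reflexivity.
Qed.

Lemma defect_vsub u v : defect (u ⊖ v) = defect u - defect v.
Proof.
  replace (u ⊖ v) with (u ⊕ (-1) ⊙ v) by module.
  rewrite defect_vadd, defect_vscal. ring.
Qed.

Lemma defect_ge_0 u : cone u -> 0 <= defect u.
Proof.
  intros Hu. apply (tends_le (F := eventually) (f := fun _ => 0) (g := fun N => Psi (K N u))).
  - apply filter_forall. intros n. now apply (Psi_ge_0 hPsi), (cone_B_res_iter Hlam).
  - apply tends_const.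
  - apply defect_tends.
Qed.

Lemma defect_le_Psi u : cone u -> defect u <= Psi u.
Proof.
  intros Hu. apply (tends_le (F := eventually) (f := fun N => Psi (K N u)) (g := fun _ => Psi u)).
  - apply filter_forall. intros n. assert (H := Psi_neumann_sum Hlam n u Hu).
    assert (H2 := Psi_ge_0 hPsi _ (cone_neumann_sum Hlam n u Hu)).
    assert (0 <= lam * Psi (neumann_sum (lam := lam) n u)) by (apply Rmult_le_pos; lra). lra.
  - apply defect_tends.
  - apply tends_const.
Qed.

Lemma defect_linear : is_linear (V := R_NormedModule) defect.
Proof.
  constructor; [exact defect_vadd|exact defect_vscal|].
  destruct HM as [HM1 Hd]. exists M. split; [lra|]. intros u.
  destruct (Hd u) as (p & q & Hp & Hq & -> & H).
  change (Rabs (defect (p ⊖ q)) <= M * norm (p ⊖ q)). rewrite defect_vsub.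
  rewrite <- !(Psi_norm hPsi) in H by auto.
  generalize (defect_ge_0 p Hp) (defect_ge_0 q Hq) (defect_le_Psi p Hp) (defect_le_Psi q Hq).
  intros. apply Rabs_le. lra.
Qed.

(** [B z] is the image of lam z - A z under the operator iterated in [K], and shifting a sequence by
    one does not change its limit. *)
Lemma defect_B z : D z -> defect (B z) = lam * defect z - defect (A z).
Proof.
  intros Hz. rewrite <- defect_vscal, <- defect_vsub.
  apply defect_unique.
  apply tends_ext with (f := fun N => Psi (K (S N) (lam ⊙ z ⊖ A z))).
  - intros n. f_equal. unfold B_res_iter. rewrite Nat.iter_succ_r.
    now rewrite (resolvent_generator hU HM Hlam Hz).
  - apply (tends_subst_seq (V := R_CompleteNormedModule)
      (x := fun N => Psi (K N (lam ⊙ z ⊖ A z))) S); auto. apply defect_tends.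
Qed.

(** An identity up to dropped terms: each step contributes the nonnegative
    [lam * defect (dp_int n t v)], and only n = 0 is kept, whose quotient by [t] tends to
    [lam * defect v]. *)
Lemma defect_B_dp_int_ge N t v : 0 <= t -> cone v ->
  lam * defect (dp_int 0 t v) + defect v - defect (dp_sum (S N) t v) <=
  defect (B (dp_int N t v)).
Proof.
  intros Ht Hv. induction N as [|N IH].
  - destruct (generator_dp_int 0 t v Ht) as [D0 E0]. rewrite defect_B, E0 by auto.
    rewrite dp_sum_S. change (dp_sum 0 t v) with (vzero : X).
    replace (vzero ⊕ Vn 0 t v) with (Vn 0 t v) by module. rewrite defect_vsub. lra.
  - destruct (generator_dp_int (S N) t v Ht) as [DS ES]. rewrite defect_B, ES by auto.
    rewrite dp_sum_S, defect_vadd, defect_vsub.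
    assert (P : 0 <= lam * defect (dp_int (S N) t v)).
    { apply Rmult_le_pos; [lra|]. apply defect_ge_0. now apply cone_dp_int. }
    lra.
Qed.

(** The remainder [Psi (B (dp_int N t v))] is at least its [defect], for which a lower bound is
    available; then N -> oo, by boundedness of [Psi] and [defect]. *)
Lemma series_fun_a_le t v : 0 <= t -> cone v ->
  Series (fun n => fun_a Psi A B (dp_int n t v)) <=
  (Psi v - defect v) - (Psi (dp_semigroup t v) - defect (dp_semigroup t v)) -
  lam * defect (dp_int 0 t v).
Proof.
  intros Ht Hv. destruct (series_fun_a_converges t v Ht Hv) as [l Hl].
  rewrite (is_series_unique _ _ Hl).
  apply (tends_le (F := eventually) (f := sum_n (fun n => fun_a Psi A B (dp_int n t v)))
    (g := fun N => (Psi v - defect v) - (Psi (dp_sum (S N) t v) - defect (dp_sum (S N) t v)) -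
      lam * defect (dp_int 0 t v))).
  - apply filter_forall. intros N. rewrite sum_fun_a_dp_int by auto.
    assert (H := defect_B_dp_int_ge N t v Ht Hv).
    assert (C : cone (B (dp_int N t v))).
    { apply cone_B; [now apply generator_dp_int|now apply cone_dp_int]. }
    generalize (defect_le_Psi _ C). lra.
  - exact Hl.
  - assert (T : tends (fun N => dp_sum (S N) t v) eventually (dp_semigroup t v)).
    { apply (tends_subst_seq (x := fun N => dp_sum N t v) S); auto.
      now apply dp_semigroup_tends. }
    apply (tends_vsub (V := R_NormedModule)); [|apply tends_const].
    apply (tends_vsub (V := R_NormedModule)); [apply tends_const|].
    apply (tends_vsub (V := R_NormedModule)).
    + exact (tends_Psi hPsi T).
    + exact (tends_linear defect_linear T).
Qed.

Lemma series_fun_a_ge t v y : 0 <= t -> cone v -> D y -> cone (v ⊖ y) ->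
  fun_a Psi A B (dp_int 0 t y) <= Series (fun n => fun_a Psi A B (dp_int n t v)).
Proof.
  intros Ht Hv Hy Hvy.
  assert (H := sum_le_series (fun n => fun_a Psi A B (dp_int n t v)) 0).
  rewrite sum_O in H. eapply Rle_trans; [|apply H].
  - assert (P : 0 <= fun_a Psi A B (dp_int 0 t (v ⊖ y))).
    { apply fun_a_ge_0; [now apply generator_dp_int|now apply cone_dp_int]. }
    rewrite dp_int_vsub, fun_a_vsub in P by (auto; now apply generator_dp_int). lra.
  - intros n. apply fun_a_ge_0; [now apply generator_dp_int|now apply cone_dp_int].
  - now apply series_fun_a_converges.
Qed.

Context {V : R -> X -> X} (hV : is_minimal_semigroup U B V).
Notation RV := (resolvent (generator V) lam).

(** The common value of the two functionals at [RV u]. The formula involves [lam]; independence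
    comes from recognising it as a limit in which [lam] does not occur. *)
Definition loss u : R := Psi u - defect u - lam * Psi (RV u).

Lemma neumann_sum_tends u : tends (fun N => neumann_sum (lam := lam) N u) eventually (RV u).
Proof.
  destruct (generating u) as (p & q & Hp & Hq & ->).
  rewrite (linear_vsub (resolvent_linear hPsi (min_substochastic hV) HM Hlam)).
  eapply tends_ext; [|apply (tends_vsub (minimal_resolvent_tends Hlam hV p Hp)
    (minimal_resolvent_tends Hlam hV q Hq))].
  intros n. cbv beta. now rewrite (linear_vsub (neumann_sum_linear Hlam n)).
Qed.

Lemma fun_a_neumann_sum N u : fun_a Psi A B (neumann_sum (lam := lam) N u) =
  Psi u - Psi (K N u) - lam * Psi (neumann_sum (lam := lam) N u).
Proof.
  unfold fun_a.
  change (- Psi (A (neumann_sum (lam := lam) N u) ⊕ B (neumann_sum (lam := lam) N u)) =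
    Psi u - Psi (K N u) - lam * Psi (neumann_sum (lam := lam) N u)).
  rewrite (generator_B_neumann_sum Hlam).
  rewrite (Psi_vadd hPsi), (Psi_vsub hPsi), (Psi_vscal hPsi). ring.
Qed.

Lemma fun_a_neumann_sum_tends u :
  tends (fun N => fun_a Psi A B (neumann_sum (lam := lam) N u)) eventually (loss u).
Proof.
  apply tends_ext with (f := fun N => Psi u - Psi (K N u) - lam * Psi (neumann_sum (lam := lam) N u)).
  { intros N. symmetry. apply fun_a_neumann_sum. }
  apply (tends_vsub (V := R_NormedModule)).
  - apply (tends_vsub (V := R_NormedModule)); [apply tends_const|apply defect_tends].
  - apply (tends_vscal_r (V := R_NormedModule)). exact (tends_Psi hPsi (neumann_sum_tends u)).
Qed.

Lemma abar_series u :
  is_series (fun n => fun_a Psi A B (Res (K n u))) (loss u).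
Proof.
  change (tends (sum_n (fun n => fun_a Psi A B (Res (K n u)))) eventually (loss u)).
  apply tends_ext with (f := fun N => fun_a Psi A B (neumann_sum (lam := lam) (S N) u)).
  2: { apply (tends_subst_seq (V := R_CompleteNormedModule)
         (x := fun N => fun_a Psi A B (neumann_sum (lam := lam) N u)) S); auto.
       apply fun_a_neumann_sum_tends. }
  assert (Hstep : forall N, fun_a Psi A B (neumann_sum (lam := lam) (S N) u) =
    fun_a Psi A B (neumann_sum (lam := lam) N u) + fun_a Psi A B (Res (K N u))).
  { intros N. destruct (neumann_sum_spec Hlam (S N) u) as [D1 _].
    destruct (neumann_sum_spec Hlam N u) as [D2 _].
    replace (Res (K N u)) with (neumann_sum (lam := lam) (S N) u ⊖ neumann_sum (lam := lam) N u)
      by (rewrite neumann_sum_S; module).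
    rewrite fun_a_vsub by auto. ring. }
  intros N. induction N as [|N IH].
  - rewrite sum_O, Hstep, fun_a_neumann_sum.
    change (K 0 u) with u. change (neumann_sum (lam := lam) 0 u) with (vzero : X).
    rewrite (Psi_vzero hPsi).
    match goal with |- ?a = ?b => change (@eq R a b) end. ring.
  - rewrite sum_Sn, <- IH. apply Hstep.
Qed.

Lemma ahat_limit_cone u : cone u ->
  tends (fun t => / t * Series (fun n => fun_a Psi A B (dp_int n t (RV u))))
    (at_right 0) (loss u).
Proof.
  intros Hu. set (v := RV u).
  assert (sV := min_substochastic hV). assert (sW := dp_semigroup_substochastic).
  assert (Cv : cone v) by (apply (cone_resolvent hPsi sV HM Hlam); auto).
  (* Equality of the resolvents puts [v] in the domain of the generator of [dp_semigroup], with
     value lam v - u. In the limit the two occurrences of lam times the defect of [v] cancel and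
     leave [loss u]. *)
  assert (Up : tends (fun t =>
      Psi (/ t ⊙ (v ⊖ dp_semigroup t v)) - defect (/ t ⊙ (v ⊖ dp_semigroup t v)) -
      lam * defect (/ t ⊙ dp_int 0 t v)) (at_right 0) (loss u)).
  { assert (Ev := minimal_resolvent_eq Hlam hV u Hu). fold v in Ev.
    assert (Dv := dom_resolvent hPsi sW HM Hlam u).
    assert (Gv := generator_resolvent hPsi sW HM Hlam u). rewrite Ev in Dv, Gv.
    assert (T1 : tends (fun t => / t ⊙ (v ⊖ dp_semigroup t v)) (at_right 0) (u ⊖ lam ⊙ v)).
    { replace (u ⊖ lam ⊙ v) with ((-1) ⊙ generator dp_semigroup v) by (rewrite Gv; module).
      eapply tends_ext; [|apply (tends_vscal_r (-1) (generator_tends Dv))].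
      intros t. cbv beta. module. }
    replace (loss u) with (Psi (u ⊖ lam ⊙ v) - defect (u ⊖ lam ⊙ v) - lam * defect v).
    2: { unfold loss. fold v. rewrite (Psi_vsub hPsi), (Psi_vscal hPsi), defect_vsub, defect_vscal.
         ring. }
    apply (tends_vsub (V := R_NormedModule)).
    - apply (tends_vsub (V := R_NormedModule)).
      + exact (tends_Psi hPsi T1).
      + exact (tends_linear defect_linear T1).
    - apply (tends_vscal_r (V := R_NormedModule)).
      exact (tends_linear defect_linear (dp_int_0_scaled_tends v)). }
  apply tends_norm_iff. intros eps He.
  (* [J] is fixed before [t]: half of [eps] for passing to the Neumann sum [y], which lies in the
     domain of [A], half for the limit in [t] at [y]. *)
  assert (TJ := proj1 (tends_norm_iff _ _) (fun_a_neumann_sum_tends u) (eps / 2) ltac:(lra)).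
  destruct TJ as [J HJ]. specialize (HJ J (le_n J)).
  set (y := neumann_sum (lam := lam) J u) in *.
  change (Rabs (fun_a Psi A B y - loss u) < eps / 2) in HJ. apply Rabs_def2 in HJ.
  destruct (neumann_sum_spec Hlam J u) as [Dy _]. fold y in Dy.
  assert (Cvy : cone (v ⊖ y)).
  { destruct (neumann_sum_converges Hlam u Hu) as (v' & Hv' & Hc).
    replace v with v'; [apply Hc|].
    exact (tends_unique (F := eventually) Hv' (neumann_sum_tends u)). }
  assert (L := proj1 (tends_norm_iff _ _) (fun_a_dp_int_0_tends y Dy) (eps / 2) ltac:(lra)).
  assert (Up' := proj1 (tends_norm_iff _ _) Up eps He).
  apply at_right_0_iff in L, Up'.
  destruct L as (d1 & Hd1 & L). destruct Up' as (d2 & Hd2 & Up').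
  apply at_right_0_iff. exists (Rmin d1 d2). split; [now apply Rmin_glb_lt|].
  intros t Ht. assert (A1 := Rmin_l d1 d2). assert (A2 := Rmin_r d1 d2).
  specialize (L t ltac:(lra)). specialize (Up' t ltac:(lra)).
  set (S := Series (fun n => fun_a Psi A B (dp_int n t v))).
  change (Rabs (/ t * S - loss u) < eps).
  change (Rabs (/ t * fun_a Psi A B (dp_int 0 t y) - fun_a Psi A B y) < eps / 2) in L.
  match type of Up' with norm (?z ⊖ _) < _ => change (Rabs (z - loss u) < eps) in Up' end.
  apply Rabs_def2 in L. apply Rabs_def2 in Up'.
  assert (Hi : 0 < / t) by (apply Rinv_0_lt_compat; lra).
  assert (B1 := series_fun_a_ge t v y ltac:(lra) Cv Dy Cvy).
  assert (B2 := series_fun_a_le t v ltac:(lra) Cv). fold S in B1, B2.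
  apply (Rmult_le_compat_l (/ t)) in B1; [|lra].
  apply (Rmult_le_compat_l (/ t)) in B2; [|lra].
  rewrite !(Psi_vscal hPsi), !defect_vscal, (Psi_vsub hPsi), defect_vsub in Up'.
  apply Rabs_def1; lra.
Qed.

(** [Series] is a total function, so splitting it over p - q uses convergence for both parts, known
    because [RV p] and [RV q] are positive. *)
Lemma ahat_limit u : is_ahat Psi A B Vn (RV u) (loss u).
Proof.
  assert (sV := min_substochastic hV).
  destruct (generating u) as (p & q & Hp & Hq & ->).
  assert (HR := resolvent_linear hPsi sV HM Hlam).
  replace (loss (p ⊖ q)) with (loss p - loss q).
  2: { unfold loss. rewrite (linear_vsub HR), !(Psi_vsub hPsi), defect_vsub. ring. }
  rewrite (linear_vsub HR).
  eapply (tends_ext_loc (V := R_NormedModule));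
    [|apply (tends_vsub (ahat_limit_cone p Hp) (ahat_limit_cone q Hq))].
  apply at_right_0_iff. exists 1. split; [lra|]. intros t Ht. cbv beta.
  assert (Cp := cone_resolvent hPsi sV HM Hlam Hp).
  assert (Cq := cone_resolvent hPsi sV HM Hlam Hq).
  destruct (series_fun_a_converges t (RV p) ltac:(lra) Cp) as [lp Lp].
  destruct (series_fun_a_converges t (RV q) ltac:(lra) Cq) as [lq Lq].
  change (fun n => fun_a Psi A B (RInt (fun s => Vn n s (RV p ⊖ RV q)) 0 t)) with
    (fun n => fun_a Psi A B (dp_int n t (RV p ⊖ RV q))).
  assert (E : is_series (fun n => fun_a Psi A B (dp_int n t (RV p ⊖ RV q))) (lp - lq)).
  { eapply is_series_ext; [|apply (is_series_minus _ _ _ _ Lp Lq)].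
    intros n. cbv beta. rewrite dp_int_vsub, fun_a_vsub by (try lra; apply generator_dp_int; lra).
    reflexivity. }
  rewrite (is_series_unique _ _ E), (is_series_unique _ _ Lp), (is_series_unique _ _ Lq).
  change (/ t * lp - / t * lq = / t * (lp - lq)). ring.
Qed.
End Loss.

(** * Equality of the two functionals *)

Context {V : R -> X -> X} (hV : is_minimal_semigroup U B V).

Lemma ahat_eq_abar v : dom (generator V) v ->
  ahat Psi A B Vn v = abar Psi A B (generator V) v.
Proof.
  intros Hv. assert (sV := min_substochastic hV).
  set (u := 1 ⊙ v ⊖ generator V v).
  assert (Ev : resolvent (generator V) 1 u = v)
    by exact (resolvent_generator sV HM Rlt_0_1 Hv).
  set (l := loss (lam := 1) (V := V) u).
  assert (Hhat : is_ahat Psi A B Vn v l).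
  { rewrite <- Ev. apply (ahat_limit Rlt_0_1 hV). }
  assert (Hbar : is_abar Psi A B (generator V) v l).
  { intros lam w Hlam Ew.
    assert (H := ahat_limit Hlam hV w). rewrite <- Ew in H.
    rewrite (tends_unique (V := R_NormedModule) (F := at_right 0) Hhat H).
    apply (abar_series Hlam hV). }
  transitivity l.
  - apply (iota_unique (V := R_CompleteNormedModule) (is_ahat Psi A B Vn v)); auto.
    intros y Hy. exact (tends_unique (V := R_NormedModule) (F := at_right 0) Hy Hhat).
  - symmetry.
    apply (iota_unique (V := R_CompleteNormedModule) (is_abar Psi A B (generator V) v)); auto.
    intros y Hy.
    exact (tends_unique (V := R_NormedModule) (F := eventually)
      (Hy 1 u Rlt_0_1 (eq_sym Ev)) (Hbar 1 u Rlt_0_1 (eq_sym Ev))).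
Qed.
End DysonPhillips.

Theorem theorem4p9 (X : AbstractStateSpace) (Psi : X -> R)
    (U : R -> X -> X) (B : X -> X) (V : R -> X -> X) (Vn : nat -> R -> X -> X)
    (hPsi : is_norm_functional Psi)
    (hU : is_substochastic U)
    (hB : is_positive_linear_on (dom (generator U)) B)
    (hAB : forall u, dom (generator U) u -> cone u ->
       Psi (plus (generator U u) (B u)) <= 0)
    (hV : is_minimal_semigroup U B V)
    (hVn : is_dyson_phillips U B Vn) :
  (forall v, dom (generator V) v ->
     ahat Psi (generator U) B Vn v = abar Psi (generator U) B (generator V) v)
  /\
  (forall u, cone u ->
     (honest Psi (generator U) B V u <->
      mild_honest Psi (generator U) B Vn V u)).
Proof.
  destruct (@bounded_decomposition X) as [M HM].
  assert (E := ahat_eq_abar hPsi hU HM hB hAB hVn hV).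
  split; [exact E|]. intros u Hu.
  unfold honest, mild_honest, balanced_trajectory.
  split; intros H t Ht; specialize (H t Ht).
  (* The equality applies because the integrated orbit lies in the domain of the generator of
     [V]. *)
  - rewrite E; [exact H|]. now apply (generator_RInt (min_substochastic hV) HM).
  - rewrite E in H; [exact H|]. now apply (generator_RInt (min_substochastic hV) HM).
Qed.
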